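(* Let $X,X_1,X_2,\dots$ be a sequence of i.i.d. real random variables, let $\phi(x):=(x+1)\log(x+1)$ for $x\ge 0$, and for real $y\ge 1$ let $m_y:=\mathbb{E}\big[X\,\mathbf{1}_{\{|X|\le\phi(y+1)\}}\big]$ (so $m_k=\mathbb{E}[X_k\mathbf{1}_{\{|X_k|\le\phi(k+1)\}}]$ for integers $k\ge1$); the same formula defines $m_y$ for all real $y\ge0$. The following statements are equivalent: (i) $\mathbb{E}\big[e^{W(|X|)}\big]<\infty$; i.e. $\mathbb{E}\left[\dfrac{|X|}{\max(\log|X|,1)}\right]<\infty$; or $\mathbb{E}\left[\dfrac{|X|}{1+\log_+|X|}\right]<\infty$. (ii) $X_n/(n\log n)\to0$ a.s. $(n\to\infty)$. (iii) $(X_n-m_n)\to0$ a.s. $(\ell)$. (iv) $(X_n-m_n)\to0$ a.s. $(L)$. (v) $(X_n-m_n)\to0$ a.s. $(R(\log n))$, or $(\mathcal{L}(\lambda))$, or $(\mathcal{L}_x(\lambda))$, or $(\ell_x)$. (vi) $\dfrac{1}{\phi(n)}\displaystyle\sum_{1\le i\le n}(X_i-m_i)\to0$ a.s. as $n\to\infty$ through the integers; or the same with a real variable $x\to\infty$ instead of $n$. (vii) For all $\beta>1$, $\dfrac{1}{\phi(n)}\displaystyle\sum_{\phi^{\leftarrow}(\beta^{-1}\phi(n))<i\le n}(X_i-m_i)\to0$ a.s. as $n\to\infty$ through the integers; or the same with a real variable $x\to\infty$ instead of $n$. (viii) For all $\epsilon>0$ and all $\gamma>1$, $$\sum_{n=1}^\infty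 n^{-1}\,\mathbb{P}\left[\left|\sum_{1\le i\le n}\big(X_i-m_{i+n/(\gamma-1)}\big)\right|>\phi\big(n/(\gamma-1)\big)\epsilon\right]<\infty.$$ (ix) For all $\epsilon>0$ and all $\gamma>1$, $$\sum_{n=1}^\infty n^{-1}\,\mathbb{P}\left[\max_{1\le k\le n}\left|\sum_{1\le i\le k}\big(X_i-m_{i+n/(\gamma-1)}\big)\right|>\phi\big(n/(\gamma-1)\big)\epsilon\right]<\infty.$$ Here the alternatives joined by ''or'' (or ''i.e.'') within (i), (v), (vi) and (vii) are each separately equivalent to all the other statements; in (v), $\mathcal{L}(\lambda)$ and $\mathcal{L}_x(\lambda)$ may be taken for some, or for all, $\lambda>1$.
   Context: $W$ is the Lambert W function: for real $z\ge0$, $W(z)\ge0$ is the solution of $z=W(z)e^{W(z)}$. $\log_+ t:=\max(\log t,0)$, with $\log 0:=-\infty$. $\phi^{\leftarrow}$ is the inverse function of $\phi$ on $[0,\infty)$. Summability methods, for a real sequence $\{s_n\}_{n\ge0}$ and $s\in\mathbb{R}$ (applied above pathwise, with $s_n=X_n-m_n$ for $n\ge1$, $s_0=0$ and $s=0$; ''a.s.'' means the convergence holds with probability one); $n$ denotes integers $\ge2$, $x$ real, $\lambda>1$ real, and sums are over integers $i$: - $s_n\to s$ $(\ell)$: $\frac{1}{\log n}\sum_{i=0}^n\frac{s_i}{i+1}\to s$ as $n\to\infty$. - $s_n\to s$ $(\ell_x)$: $\frac{1}{\log x}\sum_{0\le i\le x}\frac{s_i}{i+1}\to s$ as $x\to\infty$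 through real values. - $s_n\to s$ $(L)$: the series converges for $0<x<1$ and $\frac{1}{-\log(1-x)}\sum_{i=0}^\infty\frac{s_i}{i+1}x^{i+1}\to s$ as $x\uparrow1$. - $s_n\to s$ $(\mathcal{L}(\lambda))$: $\frac{1}{\log n}\sum_{n^{1/\lambda}<i\le n}\frac{s_i}{i+1}\to(1-\lambda^{-1})s$ as $n\to\infty$. - $s_n\to s$ $(\mathcal{L}_x(\lambda))$: $\frac{1}{\log x}\sum_{x^{1/\lambda}<i\le x}\frac{s_i}{i+1}\to(1-\lambda^{-1})s$ as $x\to\infty$ through real values. - $s_n\to s$ $(R(\log n))$: with $\{a_n\}_{n\ge0}$ defined by $s_n=\sum_{k=0}^n a_k$, $\frac1x\int_0^x\{\sum_{k\ge 0:\,\log(k+1)<y}a_k\}\,dy\to s$ as $x\to\infty$ through real values. *)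

(* Defs.v *)
From mathcomp Require Import all_boot all_order all_algebra finmap.
From mathcomp Require Import all_classical all_reals all_analysis.
Set Implicit Arguments.
Unset Strict Implicit.
Unset Printing Implicit Defensive.
Import Order.TTheory GRing.Theory Num.Theory.
Import numFieldNormedType.Exports.
Local Open Scope classical_set_scope.
Local Open Scope ring_scope.

Definition mutually_independent (d : measure_display) (T : measurableType d)
    (R : realType) (P : probability T R) (X : nat -> {RV P >-> R}) : Prop :=
  forall (J : {fset nat}) (B : nat -> set R),
    (forall j, j \in J -> measurable (B j)) ->
    P (\bigcap_(j in [set` J]) (X j @^-1` B j)) =
    (\prod_(j <- J) P (X j @^-1` B j))%E.

Definition identically_distributed (d : measure_display) (T : measurableType d)
    (R : realType) (P : probability T R) (X : nat -> {RV P >-> R}) : Prop :=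
  forall (i j : nat) (B : set R), measurable B ->
    distribution P (X i) B = distribution P (X j) B.

Definition iid (d : measure_display) (T : measurableType d)
    (R : realType) (P : probability T R) (X : nat -> {RV P >-> R}) : Prop :=
  mutually_independent X /\ identically_distributed X.

Definition lambertW (R : realType) : R -> R :=
  'pinv_(fun=> 0) `[0, +oo[%classic (fun w : R => w * expR w).

Definition phi (R : realType) (x : R) : R := (x + 1) * ln (x + 1).

Definition phi_inv (R : realType) : R -> R :=
  'pinv_(fun=> 0) `[0, +oo[%classic (@phi R).

Lemma pinv_ray (R : realType) (f : R -> R) : f 0 = 0 ->
    (forall b, 0 <= b -> {within `[0, b], continuous f}) ->
    (forall z, 0 <= z -> exists2 b, 0 <= b & z <= f b) ->
  forall z, 0 <= z -> 0 <= 'pinv_(fun=> 0) `[0, +oo[%classic f z /\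
    f ('pinv_(fun=> 0) `[0, +oo[%classic f z) = z.
Proof.
move=> f0 cf uf z z0.
have sf : set_surj `[0, +oo[%classic `[0, +oo[%classic f.
  move=> y /=; rewrite in_itv/= andbT => y0; have [b b0 yb] := uf _ y0.
  have [|c] := @IVT R f 0 b y b0 (cf _ b0).
    by rewrite f0 ge_min y0/= le_max yb orbT.
  by rewrite in_itv/= => /andP[c0 _] <-; exists c => //=; rewrite in_itv/= c0.
have zI : (`[0, +oo[%classic : set R) z by rewrite /= in_itv/= z0.
split; last by apply: (surjpK (fun=> 0) sf); exact: mem_set.
have := @surjpinv_image_sub _ _ (fun=> 0) _ _ _ sf _ (imageP _ zI).
by rewrite /= in_itv/= andbT.
Qed.

Lemma lambertWP (R : realType) (z : R) : 0 <= z ->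
  0 <= lambertW z /\ lambertW z * expR (lambertW z) = z.
Proof.
apply: (@pinv_ray R (fun w => w * expR w)) => [|b _|y y0].
- by rewrite mul0r.
- apply: continuous_subspaceT => x.
  by apply: cvgM; [exact: cvg_id|exact: continuous_expR].
- by exists y => //; rewrite ler_peMr// -expR0 ler_expR.
Qed.

Lemma phi_invP (R : realType) (y : R) : 0 <= y ->
  0 <= phi_inv y /\ phi (phi_inv y) = y.
Proof.
apply: pinv_ray => [|b b0|z z0].
- by rewrite /phi add0r mul1r ln1.
- apply: continuous_in_subspaceT => x; rewrite inE/= in_itv/= => /andP[x0 _].
  have cD : {for x, continuous (fun x : R => x + 1)}.
    by apply: cvgD; [exact: cvg_id|exact: cvg_cst].
  apply: cvgM => //; apply: (@continuous_comp _ _ _ (fun x : R => x + 1)) => //.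
  by apply: continuous_ln; rewrite ltr_wpDl.
- have e0 := expR_gt0 (1 : R); exists (z + expR 1).
    by rewrite addr_ge0// ltW.
  have h : 1 <= ln (z + expR 1 + 1).
    rewrite -[leLHS](expRK 1) ler_ln ?posrE//; last first.
      by rewrite ltr_wpDr// ltr_wpDl.
    by rewrite addrAC lerDr addr_ge0.
  rewrite /phi; apply: (@le_trans _ _ (z + expR 1 + 1)).
    by rewrite -addrA lerDl addr_ge0// ltW.
  by rewrite ler_peMr// addr_ge0// addr_ge0// ltW.
Qed.

(* The indicator makes the integrand bounded, so the expectation is finite and
   [fine] loses nothing. *)
Definition trunc_mean (d : measure_display) (T : measurableType d)
    (R : realType) (P : probability T R) (X : T -> R) (y : R) : R :=
  fine 'E_P[fun w => X w * \1_[set v | `|X v| <= phi (y + 1)] w].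

Definition centered (d : measure_display) (T : measurableType d)
    (R : realType) (P : probability T R) (X : nat -> {RV P >-> R})
    (w : T) (n : nat) : R :=
  if n == 0%N then 0 else X n w - trunc_mean P (X 0%N) n%:R.

Definition summable_ell (R : realType) (s : nat -> R) (l : R) : Prop :=
  (ln n%:R)^-1 * (\sum_(0 <= i < n.+1) s i / i.+1%:R) @[n --> \oo] --> l.

(* Index sets given by real bounds are finite, so \sum_(i \in A) is the
   ordinary finite sum, here and below. *)
Definition summable_ellx (R : realType) (s : nat -> R) (l : R) : Prop :=
  (ln x)^-1 * (\sum_(i \in [set i : nat | i%:R <= x]) s i / i.+1%:R)
    @[x --> +oo%R] --> l.

Definition summable_L (R : realType) (s : nat -> R) (l : R) : Prop :=
  (forall x : R, 0 < x < 1 ->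
    cvgn [series s i / i.+1%:R * x ^+ i.+1]_i) /\
  (- ln (1 - x))^-1 * limn [series s i / i.+1%:R * x ^+ i.+1]_i
    @[x --> (1 : R)^'-] --> l.

Definition summable_calL (R : realType) (lambda : R) (s : nat -> R) (l : R)
    : Prop :=
  (ln n%:R)^-1 *
    (\sum_(0 <= i < n.+1 | n%:R `^ lambda^-1 < i%:R) s i / i.+1%:R)
    @[n --> \oo] --> (1 - lambda^-1) * l.

Definition summable_calLx (R : realType) (lambda : R) (s : nat -> R) (l : R)
    : Prop :=
  (ln x)^-1 *
    (\sum_(i \in [set i : nat | x `^ lambda^-1 < i%:R <= x]) s i / i.+1%:R)
    @[x --> +oo%R] --> (1 - lambda^-1) * l.

Definition summable_Rlog (R : realType) (s : nat -> R) (l : R) : Prop :=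
  exists a : nat -> R,
    (forall n, s n = \sum_(0 <= k < n.+1) a k) /\
    x^-1 * (\int[lebesgue_measure]_(y in `[0, x])
              (\sum_(k \in [set k : nat | (ln k.+1%:R < y)%R]) a k))
      @[x --> +oo%R] --> l.

(* [ln 0 = 0] in the library, which under a maximum with a nonnegative constant
   agrees with the convention [log 0 = -oo]. *)
Definition ln_plus (R : realType) (t : R) : R := Num.max (ln t) 0.

(* Main.v *)
(* Everything is compared with the moment condition E[u(|X|)] < oo, where
   u = exp o W inverts x log x, so that phi(y) < t iff y + 1 < u(t) and the
   condition says that sum_n P(|X| > C phi(n)) < oo for some (every) C > 0.

   From the moment condition: truncating X_i at phi(i + 1), Kolmogorov's maximal
   inequality gives a.s. convergence of the centered series with weights
   1/((i + 1) log(i + 2)), and Abel summation turns this into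
   T_n := sum_(i <= n) s_i/(i + 1) = o(log n) a.s., where s_i = X_i - m_i.
   All the means in (iii)-(vii) tend to 0 pathwise as a consequence of
   T_n = o(log n) alone, by summation by parts against monotone weights.
   (ii) is Borel-Cantelli, and (ix) is Chebyshev's inequality together with
   E[|X|; |X| <= phi(n)] = o(log n).

   Back to the moment condition: each of (ii)-(vii) makes some linear
   combination sum_(i < M_n) a_(n,i) X_i + b_n with a_(n,n) of exact order
   1/phi(n) tend to 0 a.s.  The event that the n-th summand is large is
   independent of the event that the rest is small, and the latter has
   probability at least 1/2; a second-moment bound on the union of these events
   then forces sum_n P(|X| > C phi(n)) < oo.  Applied to the summands of a single
   sum, the same bound shows that the n-th probability in (viii) is at least of
   order min(1, n P(|X| > C phi(n))), and summing against 1/n gives the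
   moment condition because P(|X| > C phi(n)) is monotone in n. *)
Require Import Defs.
From mathcomp Require Import all_boot all_order all_algebra finmap.
From mathcomp Require Import all_classical all_reals all_analysis.
From mathcomp Require Import measurable_realfun ring lra zify.
Set Implicit Arguments.
Unset Strict Implicit.
Unset Printing Implicit Defensive.
Import Order.TTheory GRing.Theory Num.Theory.
Import numFieldNormedType.Exports.
Local Open Scope classical_set_scope.
Local Open Scope ring_scope.

(** * Summation by parts and logarithmic growth *)

Section Summation.
Context (R : realType).
Implicit Types (b c s : nat -> R).

(** The two-sided bound on the diagonal coefficient has two uses: the upper bound makes the n-th
    term small in probability, so that deleting it leaves a small rest, and the lower bound turns
    [phi n < K * |X|] into a large n-th term. The continuous methods are sampled where the n-th
    coefficient has the right order: the Riesz mean at [x = ln n.+2], the Abel mean at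
    [x = 1 - 1 / n.+2]. The Abel series is infinite and is first cut off at an index [M n] past
    which the remainder is almost surely bounded. In the direct part, (ix) uses no cancellation: as
    the truncated absolute mean is o(log n), the sum of the [|X_i|] is itself small against [phi n]
    outside a rare event, and the maximum over partial sums costs nothing extra. *)

Lemma summation_by_parts b c n :
  \sum_(0 <= i < n.+1) b i * c i =
  b n * (\sum_(0 <= i < n.+1) c i) -
  \sum_(0 <= i < n) (b i.+1 - b i) * (\sum_(0 <= j < i.+1) c j).
Proof.
elim: n => [|n IH]; first by rewrite !big_nat1 big_geq// subr0.
rewrite big_nat_recr//= IH [in RHS]big_nat_recr//= [X in _ = _ - X]big_nat_recr//=.
by ring.
Qed.

(** The increments of a nondecreasing nonnegative weight telescope to at most [b n], so the boundary
    term and the correction term each cost at most [b n * M]. *)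
Lemma abel_bound b c n M : (forall i, 0 <= b i) -> (forall i, b i <= b i.+1) ->
  (forall k, (k <= n)%N -> `|\sum_(0 <= i < k.+1) c i| <= M) ->
  `|\sum_(0 <= i < n.+1) b i * c i| <= 2 * M * b n.
Proof.
move=> b0 bS cM; rewrite summation_by_parts.
have M0 : 0 <= M by rewrite (le_trans _ (cM n _)).
apply: (@le_trans _ _ (b n * M + \sum_(0 <= i < n) (b i.+1 - b i) * M)).
  rewrite (le_trans (ler_normB _ _))// lerD//.
    by rewrite normrM (ger0_norm (b0 n)) ler_wpM2l// cM.
  rewrite (le_trans (ler_norm_sum _ _ _))// !big_nat ler_sum// => i /andP[_ ni].
  by rewrite normrM ger0_norm ?subr_ge0// ler_wpM2l ?subr_ge0// cM// ltnW.
rewrite -mulr_suml telescope_sumr// -mulrDl (_ : 2 * M * b n = (2 * b n) * M); last by ring.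
by rewrite ler_wpM2r// mulr2n mulrDl mul1r lerD2l lerBlDr lerDl.
Qed.

(* [u n = o(log n)], as bounds valid for every [n]. *)
Definition log_small (u : nat -> R) := forall e : R, 0 < e ->
  exists K : R, forall n, `|u n| <= e * ln n.+1%:R + K.

(** The bound holds for all [n <= x] at once, so a single threshold in [x] controls both ends of
    every window inside [[0, x]]. *)
Lemma log_small_near u (e : R) : log_small u -> 0 < e ->
  \forall x \near +oo, forall n, n%:R <= x -> `|u n| <= e * ln x.
Proof.
move=> us e0; have [K uK] := us (e / 2) (divr_gt0 e0 (ltr0n _ 2)).
near=> x => n nx.
have x1 : 1 <= x by near: x; exact: nbhs_pinfty_ge.
have x0 : 0 < x by exact: lt_le_trans x1.
(* For [n <= x] and [1 <= x] one has [ln n.+1 <= ln 2 + ln x]; beyond this threshold [e / 2 * ln x]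
   absorbs both [e / 2 * ln 2] and [K]. *)
have lx : ln 2 + 2 * K / e <= ln x.
  rewrite -[leLHS]expRK ler_ln ?posrE ?expR_gt0//; near: x; exact: nbhs_pinfty_ge.
apply: le_trans (uK n) _.
have : ln n.+1%:R <= ln 2 + ln x.
  rewrite -lnM ?posrE// ler_ln ?posrE ?ltr0n ?mulr_gt0// -natr1; lra.
move=> h; apply: (@le_trans _ _ (e / 2 * (ln 2 + ln x) + K)).
  by rewrite lerD2r ler_wpM2l// divr_ge0// ltW.
have -> : e * ln x = e / 2 * ln x + e / 2 * ln x by field.
rewrite mulrDr addrAC addrC lerD2l.
have -> : e / 2 * ln 2 + K = e / 2 * (ln 2 + 2 * K / e) by field; rewrite gt_eqF.
by rewrite ler_wpM2l// divr_ge0// ltW.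
Unshelve. all: by end_near. Qed.

Lemma fsum_range (A : set nat) (f : nat -> R) m n :
  (forall i, A i <-> (m <= i < n)%N) ->
  \sum_(i \in A) f i = \sum_(m <= i < n) f i.
Proof.
move=> AE; rewrite [RHS]fsbig_seq ?iota_uniq//; apply: eq_fsbigl.
by apply/seteqP; split=> i /=; rewrite mem_index_iota => /AE.
Qed.

Lemma fsum_le (f : nat -> R) (x : R) : 0 <= x ->
  \sum_(i \in [set i : nat | i%:R <= x]) f i =
  \sum_(0 <= i < (Num.truncn x).+1) f i.
Proof.
move=> x0; apply: fsum_range => i /=; rewrite ltnS.
by rewrite truncn_ge_nat.
Qed.

Lemma fsum_itv (f : nat -> R) (a x : R) : 0 <= a -> a <= x ->
  \sum_(i \in [set i : nat | a < i%:R <= x]) f i =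
  \sum_(0 <= i < (Num.truncn x).+1) f i - \sum_(0 <= i < (Num.truncn a).+1) f i.
Proof.
move=> a0 ax; have x0 := le_trans a0 ax.
rewrite (@fsum_range _ _ (Num.truncn a).+1 (Num.truncn x).+1); last first.
  by move=> i /=; rewrite ltnS truncn_ge_nat// ltnNge truncn_ge_nat// -ltNge.
rewrite [X in _ = X - _](big_cat_nat (n := (Num.truncn a).+1))//=.
  by rewrite addrAC subrr add0r.
by rewrite ltnS truncn_le_nat (le_lt_trans ax)// truncnS_gt.
Qed.

End Summation.

(** * Independence and Kolmogorov's inequality *)

Section Independence.
Context d (T : measurableType d) (R : realType) (P : probability T R).
Variable X : nat -> T -> R.
Hypothesis mX : forall i, measurable_fun [set: T] (X i).

Definition cylinders (J : {fset nat}) : set (set T) :=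
  [set A | exists2 B : nat -> set R, (forall j, measurable (B j)) &
     A = \bigcap_(j in [set` J]) (X j @^-1` B j)].

(** Arbitrary finite index sets take the place of a filtration: the converses need a sum with one
    index removed, whose remaining indices are not an initial segment. *)
Definition adapted (J : {fset nat}) (U : T -> R) : Prop :=
  measurable_fun [set: g_sigma_algebraType (cylinders J)] U.

Lemma measurable_cylinders J : cylinders J `<=` measurable.
Proof.
move=> A [B mB ->]; apply: fin_bigcap_measurable => // j _.
by rewrite -[X in measurable X]setTI; exact: mX.
Qed.

Lemma setI_closed_cylinders J : setI_closed (cylinders J).
Proof.
move=> A A' [B mB ->] [B' mB' ->]; exists (fun j => B j `&` B' j).
  by move=> j; exact: measurableI.
by rewrite -bigcapI.
Qed.

Lemma adapted_preimage J U B : adapted J U -> measurable B ->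
  <<s cylinders J>> (U @^-1` B).
Proof. by move=> aU mB; rewrite -[X in <<s _ >> X]setTI; exact: aU. Qed.

Lemma adapted_measurable J U : adapted J U -> measurable_fun [set: T] U.
Proof.
move=> aU _ B mB; rewrite setTI.
apply: (smallest_sub (@sigma_algebra_measurable _ T) (@measurable_cylinders J)).
exact: adapted_preimage.
Qed.

Lemma adapted_coord (J : {fset nat}) j : j \in J -> adapted J (X j).
Proof.
move=> jJ _ B mB; rewrite setTI; apply: sub_sigma_algebra.
exists (fun i => if i == j then B else setT).
  by move=> i; case: ifP.
apply/seteqP; split=> [w Xw i /= iJ|w /(_ j jJ)/=]; last by rewrite eqxx.
by case: eqP => // ->.
Qed.

Hypothesis indepX : forall (J : {fset nat}) (B : nat -> set R),
  (forall j, j \in J -> measurable (B j)) ->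
  P (\bigcap_(j in [set` J]) (X j @^-1` B j)) =
  (\prod_(j <- J) P (X j @^-1` B j))%E.

(** For fixed [B], the restriction of [P] to the event on [X j] and the multiple of [P] by its
    probability are finite measures that agree on the pi-system of cylinders, hence on the
    sigma-algebra it generates. *)
Lemma independent_cylinders (J : {fset nat}) (j : nat) (A : set T) (B : set R) :
  j \notin J -> <<s cylinders J>> A -> measurable B ->
  P (A `&` X j @^-1` B) = (P A * P (X j @^-1` B))%E.
Proof.
move=> jJ sA mB.
have mXB : measurable (X j @^-1` B).
  by rewrite -[X in measurable X]setTI; exact: mX.
pose c : {nonneg R} := NngNum (fine_ge0 (measure_ge0 P (X j @^-1` B))).
have cE : c%:num%:E = P (X j @^-1` B) by rewrite /= fineK// fin_num_measure.
have := @g_sigma_algebra_measure_unique _ _ _ (cylinders J)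
  (@measurable_cylinders J) (fun=> setT) _ _ (mrestr P mXB)
  (mscale c P) (@setI_closed_cylinders J) _ _ A sA.
move=> E; suff : (mrestr P mXB A = mscale c P A)%E.
  by rewrite /mrestr /mscale/= cE muleC.
apply: E => //.
- move=> _; exists (fun=> setT) => //.
  by apply/seteqP; split=> // w _ i _.
- by apply/seteqP; split=> // w _; exists 0%N.
- move=> _ [C mC ->].
  rewrite /mrestr/= /mscale/= cE.
  transitivity (P ((\bigcap_(i in [set` J]) X i @^-1` C i) `&` X j @^-1` B)).
    by [].
  (* As [j] is outside [J], the condition on [X j] merges with the cylinder into one over [J] with
     [j] added, where independence applies. *)
  pose C' i := if i == j then B else C i.
  have -> : \bigcap_(i in [set` J]) X i @^-1` C i `&` X j @^-1` B =
     \bigcap_(i in [set` (j |` J)%fset]) X i @^-1` C' i.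
    apply/seteqP; split=> [w [Cw Bw] i /=|w Cw].
      rewrite !inE /C' => /orP[/eqP->|iJ]; first by rewrite eqxx.
      by case: eqP => [->//|_]; exact: Cw.
    split=> [i /= iJ|].
      have /= := Cw i; rewrite /C' !inE iJ orbT => /(_ isT).
      by case: eqP => // ij; move: iJ jJ; rewrite ij => ->.
    by have /= := Cw j; rewrite /C' !inE eqxx => /(_ isT).
  rewrite !indepX//; last by move=> i _; rewrite /C'; case: ifP.
  rewrite big_fsetU1//= {1}/C' eqxx muleC [RHS]muleC; congr (_ * _)%E.
  apply: eq_big_seq => i iJ; rewrite /C'; case: eqP => // ij.
  by move: iJ jJ; rewrite ij => ->.
- move=> _; apply: (le_lt_trans _ (ltry 1)).
  exact: (probability_le1 P (measurableI _ _ measurableT mXB)).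
Qed.

End Independence.

Lemma measurable_gt d (T : measurableType d) (R : realType) (f : T -> R) t :
  measurable_fun [set: T] f -> measurable [set w | t < f w].
Proof.
move=> mf; have := mf measurableT `]t, +oo[%classic (measurable_itv _).
rewrite setTI; congr measurable.
by apply/seteqP; split=> w /=; rewrite in_itv/= andbT.
Qed.

Section BoundedRandomVariables.
Context d (T : measurableType d) (R : realType) (P : probability T R).

(** Truncations and indicators are bounded, so integrability is automatic and expectations can be
    handled as real numbers. *)
Definition bounded_rv (U : T -> R) :=
  measurable_fun [set: T] U /\ exists M : R, forall w, `|U w| <= M.

Lemma bounded_rv_integrable U : bounded_rv U ->
  P.-integrable [set: T] (EFin \o U).
Proof.
move=> [mU [M UM]]; apply: measurable_bounded_integrable => //.
  by rewrite ltey_eq fin_num_measure.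
by exists M; split; [exact: num_real|move=> x Mx w _; exact: le_trans (UM w) (ltW Mx)].
Qed.

Lemma bounded_rv_cst r : bounded_rv (fun=> r).
Proof. by split; [exact: measurable_cst|exists `|r|]. Qed.

Lemma bounded_rvD U V : bounded_rv U -> bounded_rv V ->
  bounded_rv (fun w => U w + V w).
Proof.
move=> [mU [M UM]] [mV [N VN]]; split; first exact: measurable_funD.
by exists (M + N) => w; rewrite (le_trans (ler_normD _ _))// lerD.
Qed.

Lemma bounded_rvM U V : bounded_rv U -> bounded_rv V ->
  bounded_rv (fun w => U w * V w).
Proof.
move=> [mU [M UM]] [mV [N VN]]; split; first exact: measurable_funM.
by exists (M * N) => w; rewrite normrM ler_pM.
Qed.

Lemma bounded_rvZ r U : bounded_rv U -> bounded_rv (fun w => r * U w).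
Proof. by apply: bounded_rvM; exact: bounded_rv_cst. Qed.

Lemma bounded_rvB U V : bounded_rv U -> bounded_rv V ->
  bounded_rv (fun w => U w - V w).
Proof.
move=> bU bV; have := bounded_rvD bU (bounded_rvZ (-1) bV).
by under eq_fun do rewrite mulN1r.
Qed.

Lemma bounded_rv_sum (I : Type) (r : seq I) (U : I -> T -> R) :
  (forall i, bounded_rv (U i)) -> bounded_rv (fun w => \sum_(i <- r) U i w).
Proof.
move=> bU; elim: r => [|i r IH].
  by under eq_fun do rewrite big_nil; exact: bounded_rv_cst.
by under eq_fun do rewrite big_cons; exact: bounded_rvD.
Qed.

Lemma bounded_rv_indic A : measurable A -> bounded_rv (\1_A : T -> R).
Proof.
move=> mA; split; first exact: measurable_indic.
by exists 1 => w; rewrite indicE; case: (_ \in _); rewrite ?normr1 ?normr0.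
Qed.

Lemma bounded_rv_sqr U : bounded_rv U -> bounded_rv (fun w => U w ^+ 2).
Proof. by move=> bU; under eq_fun do rewrite expr2; exact: bounded_rvM. Qed.

Lemma mean_indic A : measurable A -> \int[P]_w (\1_A w : R) = fine (P A).
Proof. by move=> mA; rewrite /Rintegral integral_indic// setIT. Qed.

Lemma mean_cst (r : R) : \int[P]_w r = r.
Proof.
rewrite Rintegral_cst// (_ : fine _ = fine 1%E) ?mulr1//; congr fine.
exact: probability_setT.
Qed.

Lemma mean_sum (I : Type) (r : seq I) (U : I -> T -> R) :
  (forall i, bounded_rv (U i)) ->
  \int[P]_w (\sum_(i <- r) U i w) = \sum_(i <- r) \int[P]_w U i w.
Proof.
move=> bU; elim: r => [|i r IH].
  under eq_Rintegral do rewrite big_nil.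
  by rewrite big_nil mean_cst.
under eq_Rintegral do rewrite big_cons.
rewrite big_cons RintegralD// ?IH//; apply: bounded_rv_integrable => //.
exact: bounded_rv_sum.
Qed.

(** The joint law of [(U, Y)] is the product of the marginal laws by uniqueness of the product
    measure, and Fubini's theorem factors the integral. *)
Lemma meanM_independent U Y : bounded_rv U -> bounded_rv Y ->
  (forall A B, measurable A -> measurable B ->
     P (U @^-1` A `&` Y @^-1` B) = (P (U @^-1` A) * P (Y @^-1` B))%E) ->
  \int[P]_w (U w * Y w) = (\int[P]_w U w) * (\int[P]_w Y w).
Proof.
move=> bU bY UY; have [mU [M UM]] := bU; have [mY [N YN]] := bY.
pose FU : {mfun T >-> R} :=
  MeasurableFun.Pack (MeasurableFun.Class (isMeasurableFun.Build _ _ _ _ _ mU)).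
pose FY : {mfun T >-> R} :=
  MeasurableFun.Pack (MeasurableFun.Class (isMeasurableFun.Build _ _ _ _ _ mY)).
have mZ : measurable_fun [set: T] (fun w => (U w, Y w)).
  exact: measurable_fun_pair.
pose FZ : {mfun T >-> (R * R)%type} :=
  MeasurableFun.Pack (MeasurableFun.Class (isMeasurableFun.Build _ _ _ _ _ mZ)).
(* Clipping makes the product function bounded, hence integrable, on the whole plane without
   changing it on the range of [(U, Y)]. *)
pose clip (M x : R) := Num.max (- M) (Num.min x M).
have mclip M' : measurable_fun [set: R] (clip M').
  by apply: measurable_maxr => //; exact: measurable_minr.
have clip_le M' x : 0 <= M' -> `|clip M' x| <= M'.
  move=> M0; rewrite ler_norml le_max lexx ge_max ge_min lexx orbT/= andbT.
  by rewrite (le_trans _ M0)// oppr_le0.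
have clip_id M' x : `|x| <= M' -> clip M' x = x.
  by rewrite /clip ler_norml => /andP[h1 h2]; rewrite min_l// max_r.
pose m1 := distribution P FU; pose m2 := distribution P FY.
pose mz := distribution P FZ.
pose f (z : R * R) := clip M z.1 * clip N z.2.
(* A probability space is nonempty; evaluating the bounds at a point shows that [M] and [N] are
   nonnegative. *)
have [w0 _] : exists w : T, True.
  apply: contrapT => h; have := probability_setT P.
  have -> : [set: T] = set0 by rewrite -subset0 => w _; apply: h; exists w.
  by rewrite measure0 => /eqP; rewrite eq_sym onee_eq0.
have M0 : 0 <= M by exact: le_trans (UM w0).
have N0 : 0 <= N by exact: le_trans (YN w0).
have mf : measurable_fun [set: R * R] f.
  by apply: measurable_funM; apply: measurableT_comp.
have intf (m : {measure set (R * R)%type -> \bar R}) : (m setT < +oo)%E ->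
    m.-integrable setT (EFin \o f).
  move=> mfin.
  apply: measurable_bounded_integrable => //.
  exists (M * N); split; [exact: num_real|move=> x Mx z _].
  by apply: (le_trans _ (ltW Mx)); rewrite /f normrM ler_pM// clip_le.
rewrite /Rintegral -fineM; last 2 first.
- exact: (integrable_fin_num _ (bounded_rv_integrable bU)).
- exact: (integrable_fin_num _ (bounded_rv_integrable bY)).
congr fine.
transitivity (\int[mz]_z (f z)%:E)%E.
  rewrite integral_distribution//=.
  - by apply: eq_integral => w _ /=; rewrite /f/= !clip_id.
  - exact/measurable_EFinP.
  - have -> : (fun z => (f z)%:E) \o FZ = EFin \o (fun w => U w * Y w).
      by apply/funext => w /=; rewrite /f/= !clip_id.
    exact/bounded_rv_integrable/bounded_rvM.
transitivity (\int[m1 \x m2]_z (f z)%:E)%E.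
  apply: eq_measure_integral => A mA _; apply/esym.
  by apply: product_measure_unique => // B C mB mC; exact: UY.
have distI (U' : T -> R) (FU' : {mfun T >-> R}) M' : FU' =1 U' -> bounded_rv U' ->
    (forall w, `|U' w| <= M') ->
    (\int[distribution P FU']_x (clip M' x)%:E = \int[P]_w (U' w)%:E)%E.
  move=> FUE bU' UM'.
  have E : (fun z => (clip M' z)%:E) \o FU' = EFin \o U'.
    by apply/funext => w /=; rewrite FUE clip_id.
  rewrite integral_distribution ?E//; first exact/measurable_EFinP.
  exact/bounded_rv_integrable.
have intclip (m : {measure set R -> \bar R}) M' : 0 <= M' -> (m setT < +oo)%E ->
    m.-integrable setT (EFin \o clip M').
  move=> M'0 mfin; apply: measurable_bounded_integrable => //.
  exists M'; split; [exact: num_real|move=> x Mx z _].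
  by apply: (le_trans _ (ltW Mx)); exact: clip_le.
have mfin (FU' : {mfun T >-> R}) : (distribution P FU' setT < +oo)%E.
  by rewrite ltey_eq fin_num_measure.
have EY : (\int[m2]_y (clip N y)%:E = \int[P]_w (Y w)%:E)%E by exact: distI.
have EU : (\int[m1]_y (clip M y)%:E = \int[P]_w (U w)%:E)%E by exact: distI.
have Yfin : (\int[P]_w (Y w)%:E \is a fin_num)%E.
  exact: (integrable_fin_num _ (bounded_rv_integrable bY)).
rewrite -(@integral12_prod_meas1 _ _ _ _ _ m1 m2 (EFin \o f)); last first.
  apply: intf; apply: (@le_lt_trans _ _ ((m1 \x m2)%E (setT `*` setT))).
    by rewrite setXTT.
  rewrite product_measure1E//; apply: lte_mul_pinfty => //.
    by rewrite fin_num_measure.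
  exact: mfin.
rewrite -EU -(fineK Yfin) muleC -integralZl//; last first.
  by apply: intclip => //; exact: mfin.
apply: eq_integral => x _; rewrite /fubini_F/= fineK// -EY muleC -integralZl//.
by apply: intclip => //; exact: mfin.
Qed.

End BoundedRandomVariables.

Section MaximalInequality.
Context d (T : measurableType d) (R : realType) (P : probability T R).
Variable X : nat -> T -> R.
Hypothesis mX : forall i, measurable_fun [set: T] (X i).
Hypothesis indepX : forall (J : {fset nat}) (B : nat -> set R),
  (forall j, j \in J -> measurable (B j)) ->
  P (\bigcap_(j in [set` J]) (X j @^-1` B j)) =
  (\prod_(j <- J) P (X j @^-1` B j))%E.

Lemma meanM_adapted (J : {fset nat}) j (U : T -> R) (g : R -> R) :
  j \notin J -> adapted X J U -> bounded_rv U ->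
  measurable_fun [set: R] g -> bounded_rv (fun w => g (X j w)) ->
  \int[P]_w (U w * g (X j w)) = (\int[P]_w U w) * (\int[P]_w g (X j w)).
Proof.
move=> jJ aU bU mg bg; apply: meanM_independent => // A B mA mB.
have -> : (fun w => g (X j w)) @^-1` B = X j @^-1` (g @^-1` B) by [].
apply: (independent_cylinders mX indepX jJ).
  exact: adapted_preimage.
by rewrite -[X in measurable X]setTI; exact: mg.
Qed.

Variable g : nat -> R -> R.
Hypothesis mg : forall i, measurable_fun [set: R] (g i).
Let Y i w := g i (X i w).
Hypothesis bY : forall i, bounded_rv (Y i).
Hypothesis Y0 : forall i, \int[P]_w Y i w = 0.

Definition psum n w := \sum_(0 <= i < n) g i (X i w).

(** The walk [psum] frozen at the first time its modulus exceeds [t]. The recursion tests its own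
    previous value, so no stopping time has to be named. *)
Fixpoint stopped (t : R) n w : R :=
  if n is n'.+1 then
    if t < `|stopped t n' w| then stopped t n' w
    else stopped t n' w + g n' (X n' w)
  else 0.

Lemma adapted_stopped t n (J : {fset nat}) :
  (forall i, (i < n)%N -> i \in J) -> adapted X J (stopped t n).
Proof.
elim: n => [|n IH] nJ /=; first exact: measurable_cst.
have aZ : adapted X J (stopped t n) by apply: IH => i /ltnW/nJ.
apply: measurable_fun_ifT => //.
  apply: measurable_fun_ltr; first exact: measurable_cst.
  exact: measurableT_comp.
apply: measurable_funD => //; apply: measurableT_comp => //.
by apply: (adapted_coord (X := X)); exact: nJ.
Qed.

Lemma bounded_stopped t n : bounded_rv (stopped t n).
Proof.
split.
  apply: (adapted_measurable mX (J := [fset i in iota 0 n]%fset)).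
  by apply: adapted_stopped => i ni; rewrite !inE/= mem_iota.
elim: n => [|n [M IH]]; first by exists 0 => w /=; rewrite normr0.
have [_ [N YN]] := bY n; exists (M + `|N|) => w /=; case: ifP => _.
  by rewrite (le_trans (IH w))// lerDl.
rewrite (le_trans (ler_normD _ _))// lerD//.
by rewrite (le_trans (YN w))// ler_norm.
Qed.

Lemma stoppedP t n w :
  (t < `|stopped t n w|) \/
  (stopped t n w = psum n w /\ forall k, (k <= n)%N -> `|psum k w| <= t) \/
  (n = 0%N /\ t < 0).
Proof.
elim: n => [|n IH] /=.
  have [t0|t0] := ltP t 0; first by right; right.
  right; left; split; first by rewrite /psum big_geq.
  by move=> k; rewrite leqn0 => /eqP ->; rewrite /psum big_geq ?normr0.
case: ifP => [|/negbT]; first by left.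
rewrite -leNgt => Zt; case: IH => [|[[ZE Sle]|[n0 t0]]].
- by rewrite ltNge Zt.
- have SE : stopped t n w + g n (X n w) = psum n.+1 w.
    by rewrite /psum big_nat_recr//= -/(psum n w) -ZE.
  rewrite SE; have [h|h] := ltP t `|psum n.+1 w|; first by left.
  right; left; split=> // k; rewrite leq_eqVlt => /orP[/eqP ->//|]; exact: Sle.
- by have := le_lt_trans Zt t0; rewrite normr_lt0.
Qed.

(** The increment at step [n] is the centered [g n (X n)] while the walk runs and 0 afterwards.
    Whether it runs is decided by earlier coordinates, so the cross term has mean 0 and only squares
    add up. *)
Lemma mean_stopped_sqr t n :
  \int[P]_w (stopped t n w ^+ 2) <= \sum_(0 <= i < n) \int[P]_w (g i (X i w) ^+ 2).
Proof.
elim: n => [|n IH] /=.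
  rewrite big_geq//; under eq_Rintegral do rewrite expr0n.
  by rewrite mean_cst.
rewrite big_nat_recr//=; set Z := stopped t n in IH *.
(* The walk where it still runs, and 0 once frozen: the factor of the next summand in the cross
   term, depending only on coordinates below [n]. *)
pose V w := if t < `|Z w| then 0 else Z w.
have bZ : bounded_rv Z by exact: bounded_stopped.
have aZ : adapted X [fset i in iota 0 n]%fset Z.
  by apply: adapted_stopped => i ni; rewrite !inE/= mem_iota.
have aV : adapted X [fset i in iota 0 n]%fset V.
  apply: measurable_fun_ifT => //.
  by apply: measurable_fun_ltr; [exact: measurable_cst|exact: measurableT_comp].
have bV : bounded_rv V.
  split; first exact: (adapted_measurable mX aV).
  have [_ [M ZM]] := bZ; exists M => w; rewrite /V; case: ifP => // _.
  by rewrite normr0 (le_trans _ (ZM w)).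
have bYn : bounded_rv (fun w => g n (X n w)) by exact: bY.
have VY : \int[P]_w (V w * g n (X n w)) = 0.
  rewrite (meanM_adapted (J := [fset i in iota 0 n]%fset))//.
    by rewrite [X in _ * X]Y0 mulr0.
  by rewrite !inE/= mem_iota /= add0n ltnn.
apply: (le_trans _ (lerD IH (lexx _))).
have -> : \int[P]_w (Z w ^+ 2) = \int[P]_w (Z w ^+ 2) + 2 * \int[P]_w (V w * g n (X n w)).
  by rewrite VY mulr0 addr0.
pose W w := Z w ^+ 2 + 2 * (V w * g n (X n w)) + g n (X n w) ^+ 2.
have bVY := bounded_rvM bV bYn.
apply: (@le_trans _ _ (\int[P]_w W w)); last first.
  rewrite /W RintegralD//.
  - rewrite lerD2r// RintegralD//.
    + rewrite lerD// RintegralZl//; exact: bounded_rv_integrable.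
    + exact/bounded_rv_integrable/bounded_rv_sqr.
    + exact/bounded_rv_integrable/bounded_rvZ.
  - apply/bounded_rv_integrable/bounded_rvD; first exact: bounded_rv_sqr.
    exact: bounded_rvZ.
  - exact/bounded_rv_integrable/bounded_rv_sqr.
apply: le_Rintegral => //.
- exact/bounded_rv_integrable/bounded_rv_sqr/(bounded_stopped t n.+1).
- apply/bounded_rv_integrable/bounded_rvD; last exact: bounded_rv_sqr.
  by apply: bounded_rvD; [exact: bounded_rv_sqr|exact: bounded_rvZ].
move=> w _; rewrite /W /V /= -/(Z w); case: ifP => _.
  by rewrite mul0r mulr0 addr0 lerDl sqr_ge0.
by rewrite le_eqVlt; apply/orP; left; apply/eqP; ring.
Qed.

(** Chebyshev's inequality for the stopped walk: if some partial sum up to [n] exceeds [t] in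
    modulus, so does the value at which the stopped walk ends. *)
Lemma kolmogorov_maximal (t : R) n : 0 < t ->
  measurable [set w | exists2 k, (k <= n)%N & t < `|psum k w|] /\
  t ^+ 2 * fine (P [set w | exists2 k, (k <= n)%N & t < `|psum k w|]) <=
  \sum_(0 <= i < n) \int[P]_w (g i (X i w) ^+ 2).
Proof.
move=> t0; set A := [set w | _].
have mS k : measurable_fun [set: T] (psum k).
  have [] // := bounded_rv_sum (index_iota 0 k) bY.
have mA : measurable A.
  have -> : A = \bigcup_(k in [set k | (k <= n)%N]) [set w | t < `|psum k w|].
    by apply/seteqP; split=> w [k]; exists k.
  apply: bigcup_measurable => k _; apply: measurable_gt.
  exact: measurableT_comp.
split=> //; apply: le_trans (mean_stopped_sqr t n).
have bZ := bounded_stopped t n.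
rewrite -mean_indic// -RintegralZl//; last exact/bounded_rv_integrable/bounded_rv_indic.
apply: le_Rintegral => //.
- exact/bounded_rv_integrable/bounded_rvZ/bounded_rv_indic.
- exact/bounded_rv_integrable/bounded_rv_sqr.
move=> w _; rewrite indicE; case: (boolP (w \in A)) => [|_]; last first.
  by rewrite mulr0 sqr_ge0.
rewrite inE mulr1 => -[k kn tk].
rewrite -[leRHS]real_normK ?num_real//.
have [h|[[_ /(_ k kn)]|[_]]] := stoppedP t n w.
- by rewrite ler_pXn2r// ?nnegrE ltW.
- by rewrite leNgt tk.
- by rewrite ltNge ltW.
Qed.

End MaximalInequality.

Section AlmostSure.
Context d (T : measurableType d) (R : realType) (P : probability T R).

Lemma prob_ge0 A : 0 <= fine (P A).
Proof. exact: fine_ge0. Qed.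

Lemma prob_le A B : measurable A -> measurable B -> A `<=` B ->
  fine (P A) <= fine (P B).
Proof.
move=> mA mB AB; apply: fine_le; rewrite ?fin_num_measure//.
by apply: le_measure; rewrite ?inE.
Qed.

Lemma prob_EFin A : measurable A -> (fine (P A))%:E = P A.
Proof. by move=> mA; rewrite fineK// fin_num_measure. Qed.

Lemma negligible_small (A : set T) :
  (forall e : R, 0 < e -> exists B, [/\ measurable B, A `<=` B & fine (P B) <= e]) ->
  P.-negligible A.
Proof.
move=> h.
have /choice[B hB] : forall k : nat, exists B, [/\ measurable B, A `<=` B &
    fine (P B) <= k.+1%:R^-1].
  by move=> k; apply: h; rewrite invr_gt0.
exists (\bigcap_k B k); split.
- by apply: bigcapT_measurable => k; have [] := hB k.
- have mB : measurable (\bigcap_k B k).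
    by apply: bigcapT_measurable => k; have [] := hB k.
  rewrite -prob_EFin//; congr EFin; apply/eqP; rewrite eq_le prob_ge0 andbT.
  apply/ler_addgt0Pr => e e0; rewrite add0r.
  have [k ke] : exists k : nat, k.+1%:R^-1 <= e.
    exists (Num.truncn e^-1); rewrite invf_ple ?posrE//.
    by rewrite ltW// truncnS_gt.
  have [mBk _ Bk] := hB k; apply: le_trans ke; apply: le_trans Bk.
  by apply: prob_le => //; exact: bigcap_inf.
- by move=> w Aw k _; have [_ + _] := hB k; apply.
Qed.

Lemma prob_bigcup_le (A : nat -> set T) (c : R) :
  (forall n, measurable (A n)) -> (forall n, A n `<=` A n.+1) ->
  (forall n, fine (P (A n)) <= c) -> fine (P (\bigcup_n A n)) <= c.
Proof.
move=> mA incA Ac; have mU : measurable (\bigcup_n A n) by exact: bigcupT_measurable.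
rewrite -lee_fin prob_EFin//.
have ndA : nondecreasing_seq A.
  by apply/nondecreasing_seqP => n; apply/subsetPset; exact: incA.
have cvgA := nondecreasing_cvg_mu (mu := P) mA mU ndA.
rewrite -(cvg_lim _ cvgA)//; apply: lime_le.
  by apply/cvg_ex; eexists; exact: cvgA.
by apply: nearW => n /=; rewrite -prob_EFin// lee_fin.
Qed.

End AlmostSure.

Lemma nneg_series_tail (R : realType) (v : nat -> R) (C : R) :
  (forall i, 0 <= v i) -> (forall n, \sum_(0 <= i < n) v i <= C) ->
  forall e : R, 0 < e -> exists N, forall n, \sum_(N <= i < n) v i <= e.
Proof.
move=> v0 vC e e0; pose S n := \sum_(0 <= i < n) v i.
have ndS : nondecreasing_seq S.
  by apply/nondecreasing_seqP => n; rewrite /S big_nat_recr//= lerDl.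
have cS : cvgn S.
  by apply: nondecreasing_is_cvgn => //; exists C => _ [n _ <-]; exact: vC.
have Sle n : S n <= limn S by exact: nondecreasing_cvgn_le.
have [N _ hN] : \forall n \near \oo, `|limn S - S n| < e.
  by move/cvgrPdist_lt : cS => /(_ e e0).
exists N => n; have [Nn|/ltnW nN] := leqP N n; last by rewrite big_geq// ltW.
have -> : \sum_(N <= i < n) v i = S n - S N.
  by rewrite /S (big_cat_nat (leq0n N) Nn)/= addrAC subrr add0r.
have := hN _ (leqnn N) => /(le_lt_trans (ler_norm _)); have := Sle n; lra.
Qed.

Section RandomSeries.
Context d (T : measurableType d) (R : realType) (P : probability T R).
Variable X : nat -> T -> R.
Hypothesis mX : forall i, measurable_fun [set: T] (X i).
Hypothesis indepX : forall (J : {fset nat}) (B : nat -> set R),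
  (forall j, j \in J -> measurable (B j)) ->
  P (\bigcap_(j in [set` J]) (X j @^-1` B j)) =
  (\prod_(j <- J) P (X j @^-1` B j))%E.
Variable g : nat -> R -> R.
Hypothesis mg : forall i, measurable_fun [set: R] (g i).
Hypothesis bY : forall i, bounded_rv (fun w => g i (X i w)).
Hypothesis Y0 : forall i, \int[P]_w g i (X i w) = 0.

(** Setting the summands before [N] to 0, instead of reindexing, produces the partial sums of the
    block while keeping the same [X] and its independence. *)
Lemma kolmogorov_maximal_tail (t : R) N n : 0 < t ->
  measurable [set w | exists2 k, (N <= k <= n)%N & t < `|psum X g k w - psum X g N w|] /\
  t ^+ 2 * fine (P [set w | exists2 k, (N <= k <= n)%N &
                      t < `|psum X g k w - psum X g N w|]) <=
  \sum_(N <= i < n) \int[P]_w (g i (X i w) ^+ 2).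
Proof.
move=> t0; pose g' i := if (i < N)%N then fun=> 0 : R else g i.
have mg' i : measurable_fun [set: R] (g' i).
  by rewrite /g'; case: ifP => // _; exact: measurable_cst.
have bY' i : bounded_rv (fun w => g' i (X i w)).
  by rewrite /g'; case: ifP => // _; exact: bounded_rv_cst.
have Y0' i : \int[P]_w g' i (X i w) = 0.
  by rewrite /g'; case: ifP => // _; rewrite mean_cst.
have psum_lt k w : (k <= N)%N -> psum X g' k w = 0.
  move=> kN; rewrite /psum big_nat big1// => i /andP[_ ik].
  by rewrite /g' (leq_trans ik kN).
have psum_ge k w : (N <= k)%N -> psum X g' k w = psum X g k w - psum X g N w.
  move=> Nk; rewrite /psum !(big_cat_nat (leq0n N) Nk)//= [X in _ = X]addrAC subrr add0r.
  rewrite -[X in X + _]/(psum X g' N w) psum_lt// add0r.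
  rewrite !big_nat; apply: eq_bigr => i /andP[Ni _].
  by rewrite /g' ltnNge Ni.
have := kolmogorov_maximal mX indepX mg' bY' Y0' n t0.
have -> : [set w | exists2 k, (k <= n)%N & t < `|psum X g' k w|] =
    [set w | exists2 k, (N <= k <= n)%N & t < `|psum X g k w - psum X g N w|].
  apply/seteqP; split=> w /= [k].
    move=> kn; have [kN|/ltnW Nk] := leqP k N.
      by rewrite psum_lt// normr0 ltNge ltW.
    by rewrite psum_ge// => tk; exists k; rewrite ?Nk.
  by move=> /andP[Nk kn]; rewrite -psum_ge// => tk; exists k.
move=> [mA PA]; split=> //; apply: (le_trans PA).
have [Nn|/ltnW nN] := leqP N n; last first.
  rewrite [leRHS]big_geq// big_nat big1// => i /andP[_ ik].
  rewrite /g' (leq_trans ik nN); under eq_Rintegral do rewrite expr0n.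
  by rewrite mean_cst.
rewrite (big_cat_nat (n := N))//= big_nat big1 ?add0r; last first.
  move=> i /andP[_ ik]; rewrite /g' ik; under eq_Rintegral do rewrite expr0n.
  by rewrite mean_cst.
rewrite !big_nat; apply: ler_sum => i /andP[Ni _].
by rewrite /g' ltnNge Ni.
Qed.

(** The Cauchy form of Kolmogorov's convergence criterion: no limit variable has to be constructed,
    and [kronecker_log] takes exactly this form. *)
Lemma kolmogorov_series (C : R) :
  (forall n, \sum_(0 <= i < n) \int[P]_w (g i (X i w) ^+ 2) <= C) ->
  \forall w \ae P, forall e, 0 < e -> exists N, forall n, (N <= n)%N ->
    `|psum X g n w - psum X g N w| <= e.
Proof.
move=> vC.
have v0 i : 0 <= \int[P]_w (g i (X i w) ^+ 2).
  by apply: Rintegral_ge0 => w _; exact: sqr_ge0.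
pose Q (t : R) w := exists N, forall n, (N <= n)%N ->
    `|psum X g n w - psum X g N w| <= t.
suff H : \forall w \ae P, forall j : nat, Q j.+1%:R^-1 w.
  apply: filterS H => w Qw e e0.
  have [N hN] := Qw (Num.truncn e^-1).
  exists N => n /hN /le_trans; apply.
  by rewrite invf_ple ?posrE// ltW// truncnS_gt.
apply: ae_foralln => j; set t := _^-1.
have t0 : 0 < t by rewrite invr_gt0.
apply: negligible_small => e e0.
(* The factor [t ^+ 2] compensates the division in the maximal inequality and leaves an exceptional
   probability of at most [e]. *)
have [N hN] := nneg_series_tail v0 vC (mulr_gt0 (exprn_gt0 2 t0) e0).
pose A n := [set w | exists2 k, (N <= k <= n)%N & t < `|psum X g k w - psum X g N w|].
exists (\bigcup_n A n); split.
- by apply: bigcupT_measurable => n; have [] := kolmogorov_maximal_tail N n t0.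
- move=> w /= /forallNP/(_ N)/existsNP[n /not_implyP[Nn /negP]].
  by rewrite -ltNge => tn; exists n => //; exists n => //; rewrite Nn leqnn.
- apply: prob_bigcup_le.
  + by move=> n; have [] := kolmogorov_maximal_tail N n t0.
  + by move=> n w [k /andP[Nk kn] tk]; exists k => //; rewrite Nk ltnW// ltnS.
  + move=> n; have [_ h] := kolmogorov_maximal_tail N n t0.
    by rewrite -(ler_pM2l (exprn_gt0 2 t0)) (le_trans h).
Qed.

End RandomSeries.

(** * A second-moment lower bound for the probability of a union *)

Section SecondMoment.
Context d (T : measurableType d) (R : realType) (P : probability T R).

(* For any real t and count N, [1_{N > 0} >= 2 t N - t^2 N^2]; the bound comes
   from integrating this with [t = 1 / (2 (s + 1))]. *)
Lemma second_moment_union (r : seq nat) (E G : nat -> set T) (A : set T) :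
  uniq r -> (forall i, measurable (E i)) -> (forall i, measurable (G i)) ->
  measurable A ->
  (forall i j, i != j -> P (E i `&` E j) = (P (E i) * P (E j))%E) ->
  (forall i, i \in r -> P (E i `&` G i) = (P (E i) * P (G i))%E) ->
  (forall i, i \in r -> 1 <= 2 * fine (P (G i))) ->
  (forall i, i \in r -> E i `&` G i `<=` A) ->
  let s := \sum_(i <- r) fine (P (E i)) in s <= 4 * (s + 1) * fine (P A).
Proof.
move=> ur mE mG mA EE EG G2 EGA; set s := \sum_(i <- r) _; cbv zeta.
have s0 : 0 <= s by apply: sumr_ge0 => i _; exact: prob_ge0.
have s10 : 0 < s + 1 by rewrite ltr_wpDl.
pose t := (2 * (s + 1))^-1.
have t0 : 0 < t by rewrite invr_gt0 mulr_gt0.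
have mEG i : measurable (E i `&` G i) by exact: measurableI.
pose N w : R := \sum_(i <- r) \1_(E i `&` G i) w.
have bN : bounded_rv N by apply: bounded_rv_sum => i; exact: bounded_rv_indic.
have NE : \int[P]_w N w = \sum_(i <- r) fine (P (E i `&` G i)).
  rewrite mean_sum; last by move=> i; exact: bounded_rv_indic.
  by apply: eq_bigr => i _; rewrite mean_indic.
have pEG i : i \in r -> fine (P (E i)) <= 2 * fine (P (E i `&` G i)).
  move=> ir; rewrite EG// fineM ?fin_num_measure// mulrCA.
  by rewrite ler_peMr ?prob_ge0// G2.
have N1 : s <= 2 * \int[P]_w N w.
  rewrite NE mulr_sumr /s !big_seq; apply: ler_sum => i ir; exact: pEG.
have N2 : \int[P]_w (N w ^+ 2) <= s ^+ 2 + s.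
  have -> : \int[P]_w (N w ^+ 2) =
     \sum_(i <- r) \sum_(j <- r) fine (P ((E i `&` G i) `&` (E j `&` G j))).
    under eq_Rintegral do rewrite expr2 /N mulr_suml.
    rewrite mean_sum; last first.
      move=> i; apply: bounded_rvM; first exact: bounded_rv_indic.
      by apply: bounded_rv_sum => j; exact: bounded_rv_indic.
    apply: eq_bigr => i _.
    under eq_Rintegral do rewrite mulr_sumr.
    rewrite mean_sum; last first.
      by move=> j; apply: bounded_rvM; exact: bounded_rv_indic.
    apply: eq_bigr => j _; rewrite -mean_indic; last exact: measurableI.
    by apply: eq_Rintegral => w _; rewrite [X in _ = X w](indicI R (E i `&` G i)).
  (* Off the diagonal only the independence of the [E i] enters; the [G i] may depend on one another
     arbitrarily. The diagonal adds one [P (E i)]. *)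
  have le1 i j : fine (P ((E i `&` G i) `&` (E j `&` G j))) <=
      fine (P (E i)) * fine (P (E j)) + (if i == j then fine (P (E i)) else 0).
    have mI := measurableI _ _ (mEG i) (mEG j).
    case: eqVneq => [ij|ij].
      apply: (@le_trans _ _ (fine (P (E i)))).
        by apply: prob_le => // w [[]].
      by rewrite lerDr mulr_ge0// prob_ge0.
    rewrite addr0 -fineM ?fin_num_measure// -EE//.
    by apply: prob_le => //; [exact: measurableI|move=> w [[? _] []]].
  apply: (@le_trans _ _ (\sum_(i <- r) (fine (P (E i)) * s + fine (P (E i))))).
    rewrite !big_seq; apply: ler_sum => i ir.
    apply: (le_trans (ler_sum _ (fun j _ => le1 i j))).
    rewrite big_split/= -mulr_sumr lerD2l.
    rewrite (bigD1_seq i)//= eqxx big1 ?addr0// => j.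
    by rewrite eq_sym => /negbTE ->.
  by rewrite big_split/= -mulr_suml -expr2.
(* On [A] this is [0 <= (1 - t * N w) ^+ 2]; off [A] no index has both its events at [w], so
   [N w = 0]. *)
have key w : 2 * t * N w - t ^+ 2 * N w ^+ 2 <= \1_A w.
  case: (boolP (w \in A)) => wA; rewrite indicE ?wA ?(negbTE wA).
    by rewrite -subr_ge0 (_ : true%:R = 1 :> R)//; have := sqr_ge0 (1 - t * N w); congr (0 <= _); ring.
  have -> : N w = 0; last by rewrite mulr0 expr0n mulr0 subrr.
  rewrite /N big_seq big1// => i ir; rewrite indicE memNset// => /(EGA i ir).
  by move: wA; rewrite notin_setE.
have : \int[P]_w (2 * t * N w - t ^+ 2 * N w ^+ 2) <= \int[P]_w (\1_A w : R).
  apply: le_Rintegral => //.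
  - apply/bounded_rv_integrable/bounded_rvB; apply: bounded_rvZ => //.
    exact: bounded_rv_sqr.
  - exact/bounded_rv_integrable/bounded_rv_indic.
rewrite mean_indic// RintegralB//; last 2 first.
- exact/bounded_rv_integrable/bounded_rvZ.
- exact/bounded_rv_integrable/bounded_rvZ/bounded_rv_sqr.
rewrite !RintegralZl//; last 2 first.
- exact/bounded_rv_integrable/bounded_rv_sqr.
- exact: bounded_rv_integrable.
move=> h.
have h2 : t * s - t ^+ 2 * (s ^+ 2 + s) <= fine (P A).
  apply: le_trans h; apply: lerB; last by rewrite ler_wpM2l// sqr_ge0.
  by rewrite [2 * t]mulrC -mulrA ler_wpM2l// ltW.
(* The choice of [t] makes the lower bound equal to [s / (4 * (s + 1))]. *)
have E4 : 4 * (s + 1) * (t * s - t ^+ 2 * (s ^+ 2 + s)) = s.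
  by rewrite /t; field; rewrite gt_eqF.
by rewrite -[leLHS]E4 ler_wpM2l// mulr_ge0// ltW.
Qed.

End SecondMoment.

(** * Pathwise consequences of logarithmic smallness *)

Section Pathwise.
Context (R : realType).
Variable s : nat -> R.
Let c i := s i / i.+1%:R.
Let T n := \sum_(0 <= i < n.+1) s i / i.+1%:R.
Hypothesis Tsmall : log_small T.

Lemma phi_lt (x y : R) : 0 <= x -> x < y -> phi x < phi y.
Proof.
move=> x0 xy; rewrite /phi.
have x1 : 0 < x + 1 by rewrite ltr_wpDl.
have y1 : 0 < y + 1 by rewrite (lt_trans x1)// ltrD2r.
apply: (@le_lt_trans _ _ ((x + 1) * ln (y + 1))).
  by rewrite ler_pM2l// ler_ln ?posrE// lerD2r ltW.
by rewrite ltr_pM2r ?ltrD2r// ln_gt0// ltrDr (le_lt_trans x0).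
Qed.

Lemma phi_ge0 (x : R) : 0 <= x -> 0 <= phi x.
Proof. by move=> x0; rewrite /phi mulr_ge0 ?ln_ge0 ?addr_ge0// lerDr. Qed.

Lemma phi_gt0 (x : R) : 0 < x -> 0 < phi x.
Proof.
by move=> x0; rewrite (le_lt_trans _ (phi_lt (lexx 0) x0))// phi_ge0.
Qed.

(** Multiplying the terms of [T] back by the nondecreasing weight [i.+1] costs a factor [2 * n.+1],
    which turns o(ln x) into o(phi x). *)
Lemma weighted_sum_near (e : R) : 0 < e ->
  \forall x \near +oo, forall n, n%:R <= x ->
    `|\sum_(0 <= i < n.+1) s i| <= e * phi x.
Proof.
move=> e0; have h := log_small_near Tsmall (divr_gt0 e0 (ltr0n _ 2)).
near=> x => n nx.
have x1 : 1 <= x by near: x; exact: nbhs_pinfty_ge.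
have x0 : 0 < x by exact: lt_le_trans x1.
have hx : forall n, n%:R <= x -> `|T n| <= e / 2 * ln x by near: x.
have -> : \sum_(0 <= i < n.+1) s i = \sum_(0 <= i < n.+1) i.+1%:R * c i.
  by apply: eq_bigr => i _; rewrite /c mulrC divfK.
apply: (@le_trans _ _ (2 * (e / 2 * ln x) * n.+1%:R)).
  apply: (@abel_bound _ (fun i => i.+1%:R) c) => [i//|i|k kn].
    by rewrite ler_nat.
  by apply: hx; rewrite (le_trans _ nx)// ler_nat.
have -> : 2 * (e / 2 * ln x) * n.+1%:R = e * (n.+1%:R * ln x) by field.
rewrite ler_wpM2l ?(ltW e0)// /phi ler_pM ?ln_ge0//.
  by rewrite -natr1 lerD2r.
by rewrite ler_ln ?posrE// ?lerDl// addr_gt0.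
Unshelve. all: by end_near. Qed.

Lemma log_small_ellx : summable_ellx s 0.
Proof.
apply/cvgr0Pnorm_le => e e0; near=> x.
have x1 : 1 < x by near: x; exact: nbhs_pinfty_gt.
have x0 : 0 < x by exact: lt_trans x1.
have hx : forall n, n%:R <= x -> `|T n| <= e * ln x.
  by near: x; exact: log_small_near.
have x0' := ltW x0; have lx := ln_gt0 x1.
rewrite fsum_le// normrM normfV (gtr0_norm lx).
by rewrite ler_pdivrMl// mulrC hx// truncn_le.
Unshelve. all: by end_near. Qed.

Lemma log_small_calLx lambda : 1 < lambda -> summable_calLx lambda s 0.
Proof.
move=> l1; rewrite /summable_calLx mulr0.
apply/cvgr0Pnorm_le => e e0; near=> x.
have x1 : 1 < x by near: x; exact: nbhs_pinfty_gt.
have x0 : 0 < x by exact: lt_trans x1.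
have hx : forall n, n%:R <= x -> `|T n| <= e / 2 * ln x.
  by near: x; apply: log_small_near => //; rewrite divr_gt0.
have ax : x `^ lambda^-1 <= x.
  rewrite -[leRHS]powRr1; last exact: ltW.
  rewrite ler_powR; [by []|exact: ltW|].
  by rewrite invf_le1 ?ltW// (lt_trans _ l1).
have x0' := ltW x0; have lx := ln_gt0 x1.
rewrite fsum_itv ?powR_ge0// normrM normfV (gtr0_norm lx).
rewrite ler_pdivrMl//.
have -> : ln x * e = e / 2 * ln x + e / 2 * ln x by field.
rewrite (le_trans (ler_normB _ _))// lerD// hx// ?truncn_le//.
by rewrite (le_trans _ ax)// truncn_le// powR_ge0.
Unshelve. all: by end_near. Qed.

(** One statement for the full sums, [a = 0], and for the blocks starting at
    [phi_inv (beta^-1 * phi x)]: a block is a difference of two initial sums, both controlled at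
    level [x]. *)
Lemma weighted_sum_itv (a : R -> R) :
  (\forall x \near +oo, 0 <= a x <= x) ->
  (phi x)^-1 * (\sum_(i \in [set i : nat | a x < i%:R <= x]) s i)
    @[x --> +oo%R] --> (0 : R).
Proof.
move=> ha; apply/cvgr0Pnorm_le => e e0; near=> x.
have x1 : 1 < x by near: x; exact: nbhs_pinfty_gt.
have x0 : 0 < x by exact: lt_trans x1.
have hx : forall n, n%:R <= x -> `|\sum_(0 <= i < n.+1) s i| <= e / 2 * phi x.
  by near: x; apply: weighted_sum_near => //; rewrite divr_gt0.
have /andP[a0 ax] : 0 <= a x <= x by near: x.
have p0 := phi_gt0 x0.
rewrite fsum_itv// normrM normfV (gtr0_norm p0) ler_pdivrMl//.
have -> : phi x * e = e / 2 * phi x + e / 2 * phi x by field.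
rewrite (le_trans (ler_normB _ _))// lerD// hx// ?truncn_le//.
by rewrite (le_trans _ ax)// truncn_le.
Unshelve. all: by end_near. Qed.

Lemma phi_inv_itv (beta x : R) : 1 < beta -> 0 <= x ->
  0 <= phi_inv (beta^-1 * phi x) <= x.
Proof.
move=> b1 x0; have b0 : 0 < beta by exact: lt_trans b1.
have p0 := phi_ge0 x0.
have [q0 qE] : 0 <= phi_inv (beta^-1 * phi x) /\
    phi (phi_inv (beta^-1 * phi x)) = beta^-1 * phi x.
  by apply: phi_invP; rewrite mulr_ge0// invr_ge0 ltW.
rewrite q0/= leNgt; apply/negP => /(phi_lt x0); rewrite qE ltNge => /negP; apply.
by rewrite ler_piMl// invf_le1// ltW.
Qed.

Lemma cvg_pinfty_nat (f : R -> R) (g : nat -> R) (l : R) :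
  f x @[x --> +oo%R] --> l -> (forall n, f n%:R = g n) -> g n @[n --> \oo] --> l.
Proof.
move=> fl fg; rewrite (_ : g = f \o (fun n => n%:R)); last by apply/funext => n /=.
exact: (cvg_comp _ _ (@cvgr_idn R) fl).
Qed.

End Pathwise.

(** * Riesz means on the logarithmic scale *)

Section Riesz.
Context (R : realType).
Implicit Types (a s : nat -> R).

Lemma ln_lt_truncn (x : R) k : (ln k.+1%:R < x) -> (k < Num.truncn (expR x))%N.
Proof.
move=> h; rewrite truncn_gt_nat -[leLHS]lnK ?posrE// ler_expR; exact: ltW.
Qed.

(** The k-th term is switched on at [ln k.+1] and contributes over the remaining length
    [x - ln k.+1]; terms with [k.+1 > expR x] are never on. *)
Lemma riesz_integral a (x : R) : 0 <= x ->
  \int[lebesgue_measure]_(y in `[0, x])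
     (\sum_(k \in [set k : nat | (ln k.+1%:R < y)%R]) a k) =
  \sum_(0 <= k < Num.truncn (expR x)) (x - ln k.+1%:R) * a k.
Proof.
move=> x0; set N := Num.truncn _.
pose f k (y : R) : R := a k * \1_`]ln k.+1%:R, +oo[ y.
transitivity (\int[lebesgue_measure]_(y in `[0, x]) (\sum_(0 <= k < N) f k y)).
  apply: eq_Rintegral => y; rewrite inE/= in_itv/= => /andP[y0 yx].
  rewrite (@fsbigE _ _ _ _ _ [seq k <- index_iota 0 N | ln k.+1%:R < y])/=.
  - rewrite big_filter_cond/= [RHS]big_mkcond [LHS]big_mkcond.
    apply: eq_bigr => k _; rewrite /f indicE.
    case: ifPn.
      move=> /andP[h _]; rewrite (_ : (_ \in _) = true) ?mulr1//.
      by apply/mem_set; rewrite /= in_itv/= andbT.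
    move=> h; rewrite (_ : (_ \in _) = false) ?mulr0//.
    apply/negbTE; rewrite notin_setE/= in_itv/= andbT; apply: contraNnot h => h.
    by rewrite h/=; exact/mem_set.
  - by rewrite filter_uniq// iota_uniq.
  - by move=> k /=; rewrite mem_filter => /andP[].
  - move=> k /= ky; rewrite mem_filter ky/= mem_index_iota/= => /negP[].
    by apply: ln_lt_truncn; exact: lt_le_trans yx.
have mf k : measurable_fun [set: R] (f k).
  by apply: measurable_funM => //; exact: measurable_indic.
have muI (l : R) : l <= x -> fine (@lebesgue_measure R [set` `]l, x]%R]) = x - l.
  move=> lx; rewrite lebesgue_measure_itv/= lte_fin.
  case: ltP => // xl; rewrite -?EFinB//=.
  by apply/esym/eqP; rewrite subr_eq0 eq_le xl lx.
pose I : set R := `[0, x]%classic.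
have mu0x : (@lebesgue_measure R I < +oo)%E.
  by rewrite lebesgue_measure_itv/=; case: ifP; rewrite ltry.
have intf k : lebesgue_measure.-integrable `[0, x] (EFin \o f k).
  apply: measurable_bounded_integrable => //.
  - by apply: measurable_funTS; exact: mf.
  - exists `|a k|; split; [exact: num_real|move=> y ay z _].
    apply: (le_trans _ (ltW ay)); rewrite /f normrM indicE.
    by case: (_ \in _); rewrite ?normr1 ?normr0 ?mulr1 ?mulr0.
(* Integrability and value go through one induction, because additivity of the real integral needs
   the partial sum to be integrable. *)
have key n : lebesgue_measure.-integrable `[0, x]
      (EFin \o (fun y => \sum_(0 <= k < n) f k y)) /\
   ((forall k, (k < n)%N -> ln k.+1%:R <= x) ->
    \int[lebesgue_measure]_(y in `[0, x]) (\sum_(0 <= k < n) f k y) =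
   \sum_(0 <= k < n) (x - ln k.+1%:R) * a k).
  elim: n => [|n [IH1 IH2]].
    split.
      under [X in EFin \o X]eq_fun do rewrite big_geq//.
      exact: integrable0.
    move=> _; under eq_Rintegral do rewrite big_geq//.
    by rewrite Rintegral_cst// mul0r big_geq.
  split.
    have := integrableD _ IH1 (intf n) => /(_ (measurable_itv _)).
    apply: eq_integrable => // y _ /=.
    by rewrite big_nat_recr//= EFinD.
  move=> nx.
  under eq_Rintegral do rewrite big_nat_recr//=.
  rewrite RintegralD// IH2; last by move=> k kn; apply: nx; rewrite ltnW.
  rewrite big_nat_recr//=; congr (_ + _).
  rewrite /f RintegralZl//; last first.
    apply: measurable_bounded_integrable => //.
    exists 1; split; [exact: num_real|move=> y ay z _].
      apply: (le_trans _ (ltW ay)); rewrite indicE.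
      by case: (_ \in _); rewrite ?normr1 ?normr0.
  rewrite mulrC; congr (_ * _).
  rewrite /Rintegral integral_indic//.
  have l0 : 0 <= ln n.+1%:R :> R by rewrite ln_ge0// ler1n.
  have lx := nx n (leqnn _).
  rewrite (_ : _ `&` _ = `]ln n.+1%:R, x]%classic); last first.
    apply/seteqP; split=> y /=; rewrite !in_itv/= ?andbT.
      by move=> [-> /andP[_ ->]].
    by move=> /andP[h1 h2]; rewrite h1 h2 (le_trans l0 (ltW h1)).
  exact: muI.
have [_ ->//] := key N.
move=> k; rewrite /N truncn_gt_nat => h.
by rewrite -[leRHS]expRK ler_ln ?posrE ?expR_gt0.
Qed.

(** Passing from the coefficients [a] to their partial sums [s] replaces the weights by increments
    of [ln], which are close to the logarithmic weights [1 / k.+1]. *)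
Lemma riesz_sum s a (x : R) n : (forall n, s n = \sum_(0 <= k < n.+1) a k) ->
  \sum_(0 <= k < n.+1) (x - ln k.+1%:R) * a k =
  \sum_(0 <= k < n) (ln k.+2%:R - ln k.+1%:R) * s k + (x - ln n.+1%:R) * s n.
Proof.
move=> sa; rewrite (summation_by_parts (fun k => x - ln k.+1%:R)) -sa addrC.
congr (_ + _); rewrite -sumrN; apply: eq_bigr => k _.
by rewrite -sa; ring.
Qed.

(** Concavity of [ln]: with [x = k.+2 / k.+1] and [y = k.+3 / k.+2], the number [y] is the mean of
    [x] and 1 with weights [k.+1] and 1. The proof adds the tangent bounds at [y]. *)
Lemma ln_increment_nondecreasing k :
  k.+1%:R * (ln k.+2%:R - ln k.+1%:R) <= k.+2%:R * (ln k.+3%:R - ln k.+2%:R) :> R.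
Proof.
have p (n : nat) : 0 < n.+1%:R :> R by rewrite ltr0n.
have E n : ln n.+2%:R - ln n.+1%:R = ln (n.+2%:R / n.+1%:R) :> R.
  by rewrite ln_div ?posrE.
rewrite !E; set x : R := k.+2%:R / k.+1%:R; set y : R := k.+3%:R / k.+2%:R.
have x0 : 0 < x by rewrite divr_gt0.
have y0 : 0 < y by rewrite divr_gt0.
have h z : 0 < z -> ln z <= ln y + (z / y - 1).
  move=> z0; have zy : 0 < z / y by rewrite divr_gt0.
  have := @le_ln1Dx R (z / y - 1).
  rewrite (_ : 1 + (z / y - 1) = z / y); last by ring.
  rewrite ln_div ?posrE// ltrBrDr addNr => /(_ zy); lra.
have h1 := h x x0; have h2 := h 1 ltr01; rewrite ln1 in h2.
have : k.+1%:R * ln x + 0 <= k.+1%:R * (ln y + (x / y - 1)) + (ln y + (1 / y - 1)).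
  by rewrite lerD// ler_pM2l.
have -> : k.+1%:R * (ln y + (x / y - 1)) + (ln y + (1 / y - 1)) = k.+2%:R * ln y.
  rewrite /x /y -(natr1 k.+2) -(natr1 k.+1) -(natr1 k); field.
  by rewrite !(natr1, gt_eqF)//; rewrite natr1 natr1 gt_eqF.
by rewrite addr0.
Qed.

End Riesz.

Section LogSmallMeans.
Context (R : realType).
Variable s : nat -> R.
Let c i := s i / i.+1%:R.
Let T n := \sum_(0 <= i < n.+1) s i / i.+1%:R.
Hypothesis Tsmall : log_small T.

Lemma summand_bound n (M : R) : (forall k, (k <= n)%N -> `|T k| <= M) ->
  `|c n| <= 2 * M.
Proof.
move=> TM; have TMn := TM n (leqnn n).
have M0 : 0 <= M by exact: le_trans TMn.
case: n => [|n] in TM TMn *.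
  by move: TMn; rewrite /T big_nat1 -/(c 0%N) => /le_trans; apply; lra.
have -> : c n.+1 = T n.+1 - T n by rewrite /T big_nat_recr//= addrAC subrr add0r.
by rewrite (le_trans (ler_normB _ _))// mulr2n mulrDl mul1r lerD// TM.
Qed.

Lemma log_small_Rlog : summable_Rlog s 0.
Proof.
pose a k := if k is k'.+1 then s k - s k' else s 0%N.
have sa n : s n = \sum_(0 <= k < n.+1) a k.
  elim: n => [|n IH]; first by rewrite big_nat1.
  by rewrite big_nat_recr//= -IH addrC subrK.
exists a; split=> //.
apply/cvgr0Pnorm_le => e e0; near=> x.
have x1 : 1 <= x by near: x; exact: nbhs_pinfty_ge.
have x0 : 0 < x by exact: lt_le_trans x1.
(* The quarter is used four times: Abel summation and the correction of the last term each cost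
   [2 * (e / 4 * x)]. *)
have hx : forall n, n%:R <= expR x -> `|T n| <= e / 4 * ln (expR x).
  near: x.
  have : \forall y \near +oo, forall n, n%:R <= y -> `|T n| <= e / 4 * ln y.
    by apply: log_small_near => //; rewrite divr_gt0.
  move=> [A [Ar hA]]; exists A; split=> // y Ay; apply: hA.
  by apply: lt_le_trans (expR_ge1Dx y); rewrite ltr_wpDl.
rewrite normrM normfV (gtr0_norm x0) ler_pdivrMl// riesz_integral ?(ltW x0)//.
have : (0 < Num.truncn (expR x))%N by rewrite truncn_gt0 -expR0 ler_expR ltW.
have := truncn_itv (ltW (expR_gt0 x)).
case: (Num.truncn (expR x)) => // n /andP[n1 n2] _.
rewrite (riesz_sum _ _ sa).
have ln1 : ln n.+1%:R <= x by rewrite -[leRHS]expRK ler_ln ?posrE ?expR_gt0.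
have ln2 : x <= ln n.+2%:R.
  by rewrite -[leLHS]expRK ler_ln ?posrE ?expR_gt0// ltW.
pose w k : R := k.+1%:R * (ln k.+2%:R - ln k.+1%:R).
have wE k : (ln k.+2%:R - ln k.+1%:R) * s k = w k * c k.
  by rewrite /w /c; field.
have w0 k : 0 <= w k.
  by rewrite /w mulr_ge0// subr_ge0 ler_ln ?posrE// ler_nat.
have w1 k : w k <= 1.
  rewrite /w mulrC -ler_pdivlMr// -ln_div ?posrE// div1r.
  rewrite -[X in ln (X / _)]natr1 mulrDl divff// mul1r.
  by apply: le_ln1Dx; rewrite (@lt_le_trans _ _ 0)// ?ltrN10// invr_ge0.
(* The last interval, from [ln n.+1] to [x], may be incomplete. Its weight is completed to [w n] so
   that [abel_bound] applies, and the discrepancy, at most 1 in modulus, multiplies the single term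
   [c n]. *)
have -> : \sum_(0 <= k < n) (ln k.+2%:R - ln k.+1%:R) * s k + (x - ln n.+1%:R) * s n =
   \sum_(0 <= k < n.+1) w k * c k + (n.+1%:R * (x - ln n.+1%:R) - w n) * c n.
  rewrite (eq_bigr _ (fun k _ => wE k)) [in RHS]big_nat_recr//= /c; field.
  by rewrite addrC natr1.
rewrite expRK in hx.
have TM k : (k <= n)%N -> `|T k| <= e / 4 * x.
  by move=> kn; apply: hx; rewrite (le_trans _ n1)// ler_nat ltnW.
have M0 : 0 <= e / 4 * x by exact: le_trans (TM n _).
have h1 : `|\sum_(0 <= k < n.+1) w k * c k| <= 2 * (e / 4 * x).
  apply: (le_trans (abel_bound w0 (@ln_increment_nondecreasing R) TM)).
  by rewrite ler_piMr// mulr_ge0.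
have h2 := summand_bound TM.
have h3 : `|n.+1%:R * (x - ln n.+1%:R) - w n| <= 1.
  have : 0 <= n.+1%:R * (x - ln n.+1%:R) by rewrite mulr_ge0// subr_ge0.
  have : n.+1%:R * (x - ln n.+1%:R) <= w n by rewrite /w ler_pM2l// lerD2r.
  have := w0 n; have := w1 n; rewrite ler_norml; lra.
apply: (le_trans (ler_normD _ _)); rewrite normrM.
have : `|n.+1%:R * (x - ln n.+1%:R) - w n| * `|c n| <= 1 * (2 * (e / 4 * x)).
  by rewrite ler_pM.
by move: h1; rewrite mul1r; lra.
Unshelve. all: by end_near. Qed.

Lemma geometric_linear_bound (x : R) n : 0 < x -> x < 1 ->
  \sum_(0 <= i < n) i.+1%:R * x ^+ i.+1 <= x / (1 - x) ^+ 2.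
Proof.
move=> x0 x1; have x10 : 0 < 1 - x by rewrite subr_gt0.
rewrite ler_pdivlMr ?exprn_gt0//.
have -> : (\sum_(0 <= i < n) i.+1%:R * x ^+ i.+1) * (1 - x) ^+ 2 =
    x * (1 - x ^+ n - n%:R * x ^+ n * (1 - x)).
  elim: n => [|n IH]; first by rewrite big_geq// expr0; ring.
  by rewrite big_nat_recr//= mulrDl IH -(natr1 n) !exprS; ring.
rewrite ler_piMr ?(ltW x0)//.
have : 0 <= x ^+ n by rewrite exprn_ge0// ltW.
have : 0 <= n%:R * x ^+ n * (1 - x).
  by rewrite !mulr_ge0 ?exprn_ge0// ltW.
lra.
Qed.

(** Summation by parts against [x ^+ i.+1] averages the [T i] with geometric weights, which
    concentrate at [i] of order [1 / (1 - x)], where [ln i.+1] is about [- ln (1 - x)]. *)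
Lemma log_small_abel_bound (e K x : R) n : 0 < e -> 0 <= K -> 0 < x -> x < 1 ->
  (forall n, `|T n| <= e * ln n.+1%:R + K) ->
  `|\sum_(0 <= i < n.+1) c i * x ^+ i.+1| <= e * - ln (1 - x) + K + 2 * e.
Proof.
move=> e0 K0 x0 x1 TK; have x10 : 0 < 1 - x by rewrite subr_gt0.
pose M := (1 - x)^-1; have M0 : 0 < M by rewrite invr_gt0.
have lnME : - ln (1 - x) = ln M by rewrite /M lnV ?posrE.
have lnM0 : 0 <= ln M by rewrite ln_ge0// invf_ge1// gerBl ltW.
(* The bound [ln y <= y] at [y = i.+1 * (1 - x)] majorizes [ln i.+1] by [ln M] plus a term linear in
   [i], whose geometric average is explicit. *)
pose g i := e * (ln M + i.+1%:R * (1 - x)) + K.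
have Tg i : `|T i| <= g i.
  apply: le_trans (TK i) _; rewrite /g lerD2r ler_pM2l//.
  have y0 : 0 < i.+1%:R * (1 - x) by rewrite mulr_gt0.
  have := ltW (ln_sublinear y0); rewrite lnM ?posrE// -lnME; lra.
under eq_bigr do rewrite mulrC.
rewrite (summation_by_parts (fun i => x ^+ i.+1)) -/(T n).
(* Summation by parts back onto [g]: passing from [m] to [m.+1] adds [x ^+ m.+2] times the constant
   increment [e * (1 - x)] of [g]. *)
have D m : x ^+ m.+1 * g m + (1 - x) * (\sum_(0 <= i < m) x ^+ i.+1 * g i) <=
    g 0%N + e * (1 - x ^+ m).
  have xm k : 0 < x ^+ k by rewrite exprn_gt0.
  elim: m => [|m IH].
    rewrite big_geq// expr1 expr0 subrr !mulr0 !addr0.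
    by rewrite ler_piMl ?(ltW x1)// (le_trans _ (Tg 0%N)).
  rewrite big_nat_recr//= mulrDr.
  rewrite [leLHS](_ : _ = (x ^+ m.+1 * g m +
      (1 - x) * (\sum_(0 <= i < m) x ^+ i.+1 * g i)) +
    x ^+ 2 * (e * (1 - x) * x ^+ m)); last first.
    by rewrite /g -(natr1 m.+1) !exprS; ring.
  apply: (@le_trans _ _ (g 0%N + e * (1 - x ^+ m) + e * (1 - x) * x ^+ m)).
    apply: lerD => //; rewrite ler_piMl//.
      by rewrite !mulr_ge0// ltW.
    by rewrite exprn_ile1// ltW.
  by rewrite exprS le_eqVlt; apply/orP; left; apply/eqP; ring.
apply: (@le_trans _ _ (x ^+ n.+1 * g n + (1 - x) * (\sum_(0 <= i < n) x ^+ i.+1 * g i))).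
  apply: (le_trans (ler_normB _ _)); apply: lerD.
    by rewrite normrM ger0_norm ?exprn_ge0 ?(ltW x0)// ler_wpM2l// exprn_ge0// ltW.
  rewrite mulr_sumr; apply: (le_trans (ler_norm_sum _ _ _)).
  apply: ler_sum => i _; rewrite normrM.
  rewrite (_ : x ^+ i.+2 - x ^+ i.+1 = - ((1 - x) * x ^+ i.+1)); last first.
    by rewrite [in LHS]exprS; ring.
  have p0 : 0 <= (1 - x) * x ^+ i.+1 by rewrite mulr_ge0 ?exprn_ge0 ?(ltW x0) ?(ltW x10).
  by rewrite normrN (ger0_norm p0) mulrA ler_wpM2l//; exact: Tg.
apply: (le_trans (D n)); rewrite /g mul1r.
have : e * (1 - x ^+ n) <= e by rewrite ler_piMr ?(ltW e0)// gerBl exprn_ge0// ltW.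
have : e * (1 - x) <= e by rewrite ler_piMr ?(ltW e0)// gerBl ltW.
by rewrite lnME mulrDr; lra.
Qed.

(** Taking [e = 1] in [log_small] shows that the terms [c i] grow at most linearly, so a series of
    type [i.+1 * x ^+ i.+1] dominates. *)
Lemma log_small_cvg_series (x : R) : 0 < x -> x < 1 ->
  cvgn [series s i / i.+1%:R * x ^+ i.+1]_i.
Proof.
move=> x0 x1; have [K TK] := Tsmall ltr01.
pose K' : R := `|K|; have K0 : 0 <= K' by exact: normr_ge0.
have xk k : 0 <= x ^+ k by rewrite exprn_ge0// ltW.
have cC i : `|c i| <= 2 * (1 + K') * i.+1%:R.
  rewrite -mulrA; apply: summand_bound => k ki.
  apply: le_trans (TK k) _; rewrite mul1r mulrDl mul1r; apply: lerD.
    by rewrite (le_trans (ltW (ln_sublinear _)))// ler_nat.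
  by rewrite (le_trans (ler_norm K))// /K' ler_peMr// ler1n.
apply: normed_cvg; apply: (@series_le_cvg _ _ (fun i => 2 * (1 + K') * (i.+1%:R * x ^+ i.+1))).
- by move=> i /=; rewrite normr_ge0.
- by move=> i; rewrite !mulr_ge0// addr_ge0.
- move=> i /=; rewrite normrM (ger0_norm (exprn_ge0 _ (ltW x0))) mulrA.
  by apply: ler_wpM2r; [exact: xk|exact: cC].
- apply: nondecreasing_is_cvgn.
    apply/nondecreasing_seqP => n; rewrite /series/= big_nat_recr//= lerDl.
    by rewrite !mulr_ge0// addr_ge0.
  exists (2 * (1 + K') * (x / (1 - x) ^+ 2)) => _ [n _ <-].
  rewrite /series/= -mulr_sumr ler_wpM2l// ?geometric_linear_bound//.
  by rewrite mulr_ge0// addr_ge0.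
Qed.

Lemma log_small_L : summable_L s 0.
Proof.
split=> [x /andP[x0 x1]|]; first exact: log_small_cvg_series.
apply/cvgr0Pnorm_le => e e0.
have [K0 TK0] := Tsmall (divr_gt0 e0 (ltr0n _ 2)).
pose K : R := `|K0|.
have TK n : `|T n| <= e / 2 * ln n.+1%:R + K.
  by rewrite (le_trans (TK0 n))// lerD2l ler_norm.
(* Once [L <= - ln (1 - x)], half of the allowed bound absorbs the constant [K + e] left by
   [log_small_abel_bound]. *)
pose L : R := (K + e) / (e / 2).
have L0 : 0 < L by apply: divr_gt0; [rewrite ltr_wpDl// /K normr_ge0|rewrite divr_gt0].
near=> x.
have x1 : x < 1 by near: x; exact: nbhs_left_lt.
have x0 : 0 < x by near: x; exact: nbhs_left_gt.
have xL : 1 - expR (- L) < x.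
  by near: x; apply: nbhs_left_gt; rewrite gtrBl expR_gt0.
have x10 : 0 < 1 - x by rewrite subr_gt0.
have lL : L <= - ln (1 - x).
  rewrite lerNr -[leRHS]expRK ler_ln ?posrE ?expR_gt0//; lra.
have l0 : 0 < - ln (1 - x) by exact: lt_le_trans lL.
rewrite normrM normfV (gtr0_norm l0) ler_pdivrMl//.
have cx := log_small_cvg_series x0 x1.
apply: (@le_trans _ _ (e / 2 * - ln (1 - x) + K + 2 * (e / 2))).
  have cn : `|[series s i / i.+1%:R * x ^+ i.+1]_i n| @[n --> \oo] -->
      `|limn [series s i / i.+1%:R * x ^+ i.+1]_i| by exact: cvg_norm.
  rewrite -(cvg_lim _ cn)//.
  apply: limr_le; first by apply/cvg_ex; eexists; exact: cn.
  exists 1%N => // -[//|n] _ /=.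
  apply: log_small_abel_bound => //; [exact: divr_gt0|exact: normr_ge0].
have : L * (e / 2) <= - ln (1 - x) * (e / 2) by rewrite ler_wpM2r// divr_ge0// ltW.
rewrite /L divfK; last by rewrite gt_eqF// divr_gt0.
lra.
Unshelve. all: by end_near. Qed.

End LogSmallMeans.

(** * Moments and tails through the Lambert function *)

Section LambertTail.
Context (R : realType).
Implicit Types t x y C : R.

Definition expW t : R := expR (lambertW t).

Lemma expW_ge1 t : 0 <= t -> 1 <= expW t.
Proof. by move=> t0; rewrite -expR0 ler_expR; have [] := lambertWP t0. Qed.

Lemma expWE t : 0 <= t -> expW t * ln (expW t) = t.
Proof. by move=> t0; rewrite /expW expRK mulrC; have [] := lambertWP t0. Qed.

Lemma mul_ln_lt x y : 1 <= x -> x < y -> x * ln x < y * ln y.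
Proof.
move=> x1 xy; have := @phi_lt R (x - 1) (y - 1).
by rewrite /phi !subrK; apply; rewrite ?subr_ge0// ltrD2r.
Qed.

Lemma expW_gt t y : 0 <= t -> 1 <= y -> (y < expW t) = (y * ln y < t).
Proof.
move=> t0 y1; apply/idP/idP => [h|]; first by rewrite -[ltRHS](expWE t0) mul_ln_lt.
apply: contraTT; rewrite -!leNgt le_eqVlt => /predU1P[<-|h].
  by rewrite expWE.
by rewrite -[leLHS](expWE t0) ltW// mul_ln_lt// expW_ge1.
Qed.

Lemma expW_gt_phi t y : 0 <= t -> 0 <= y -> (y + 1 < expW t) = (phi y < t).
Proof. by move=> t0 y0; rewrite expW_gt// lerDr. Qed.

Lemma expW_le x y : 0 <= x -> x <= y -> expW x <= expW y.
Proof.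
move=> x0 xy; have y0 := le_trans x0 xy.
rewrite leNgt; apply/negP; rewrite expW_gt ?expW_ge1// expWE//.
by rewrite ltNge xy.
Qed.

(** With [u = expW t] and [t = u * ln u], the claim is [ln u <= max (ln t) 1]; and if [ln u > 1]
    then [t >= u]. *)
Lemma ratio_le_expW t : 0 <= t -> t / Num.max (ln t) 1 <= expW t.
Proof.
move=> t0; have u1 := expW_ge1 t0; have u0 := lt_le_trans ltr01 u1.
have m0 : 0 < Num.max (ln t) 1 by rewrite lt_max ltr01 orbT.
rewrite ler_pdivrMr// -[leLHS](expWE t0) ler_pM2l// le_max.
have [h|h] := leP (ln (expW t)) 1; first by rewrite orbT.
rewrite orbF ler_ln ?posrE//; last first.
  by rewrite -[ltRHS](expWE t0) mulr_gt0// (lt_trans _ h).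
by rewrite -[leRHS](expWE t0) ler_peMr ?(ltW u0)// ltW.
Qed.

(** With [u = expW t]: if [ln u > 1] then [ln t = ln u + ln (ln u) <= 2 * ln u], and otherwise
    [u <= expR 1]. *)
Lemma expW_le_ratio t : 0 <= t -> expW t <= 2 * (t / Num.max (ln t) 1) + expR 1.
Proof.
move=> t0; have u1 := expW_ge1 t0; have u0 := lt_le_trans ltr01 u1.
have m0 : 0 < Num.max (ln t) 1 by rewrite lt_max ltr01 orbT.
have r0 : 0 <= t / Num.max (ln t) 1 by rewrite divr_ge0// ltW.
have [h|h] := leP (ln (expW t)) 1.
  have : expW t <= expR 1 by rewrite -[leLHS]lnK ?posrE// ler_expR.
  lra.
have l0 : 0 < ln (expW t) by rewrite (lt_trans _ h).
suff : expW t <= 2 * (t / Num.max (ln t) 1) by have := expR_gt0 (1 : R); lra.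
rewrite mulrA ler_pdivlMr//.
have : Num.max (ln t) 1 <= 2 * ln (expW t).
  rewrite ge_max; apply/andP; split; last lra.
  rewrite -[X in ln X <= _](expWE t0) lnM ?posrE//.
  have := ln_sublinear l0; lra.
move=> hm; rewrite -[X in _ <= 2 * X](expWE t0) mulrCA.
by apply: ler_wpM2l; [exact: ltW|].
Qed.

Lemma ratio_plus_le t : 0 <= t ->
  t / (1 + ln_plus t) <= t / Num.max (ln t) 1.
Proof.
move=> t0; rewrite ler_wpM2l// lef_pV2 ?posrE//.
- rewrite /ln_plus ge_max lerDl le_max lexx orbT andbT.
  by rewrite (@le_trans _ _ (Num.max (ln t) 0)) ?le_max ?lexx// lerDr.
- by rewrite ltr_wpDr// /ln_plus le_max lexx orbT.
- by rewrite lt_max ltr01 orbT.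
Qed.

Lemma ratio_le_plus t : 0 <= t ->
  t / Num.max (ln t) 1 <= 2 * (t / (1 + ln_plus t)).
Proof.
move=> t0; have l0 : 0 <= ln_plus t by rewrite /ln_plus le_max lexx orbT.
have p0 : 0 < 1 + ln_plus t by rewrite ltr_wpDr.
have m0 : 0 < Num.max (ln t) 1 by rewrite lt_max ltr01 orbT.
rewrite ler_pdivrMr// (_ : 2 * _ * _ = t * (2 * Num.max (ln t) 1) / (1 + ln_plus t)).
  rewrite ler_pdivlMr// ler_wpM2l//.
  have h1 : 1 <= Num.max (ln t) 1 by rewrite le_max lexx orbT.
  have h2 : ln_plus t <= Num.max (ln t) 1.
    by rewrite /ln_plus ge_max !le_max lexx/= ler01 orbT.
  lra.
by rewrite !mulrA; ring.
Qed.

Lemma ratio_plus_scale C t : 1 <= C -> 0 <= t ->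
  (C * t) / (1 + ln_plus (C * t)) <= C * (t / (1 + ln_plus t)).
Proof.
move=> C1 t0; have C0 : 0 < C := lt_le_trans ltr01 C1.
have l0 x : 0 <= ln_plus x by rewrite /ln_plus le_max lexx orbT.
rewrite -mulrA ler_pM2l// ler_wpM2l// lef_pV2 ?posrE ?ltr_wpDr// lerD2l.
rewrite /ln_plus ge_max [X in _ && X]le_max lexx orbT andbT le_max.
have [->|tn0] := eqVneq t 0; first by rewrite mulr0 lexx.
have tp : 0 < t by rewrite lt_neqAle eq_sym tn0.
by apply/orP; left; rewrite ler_ln ?posrE ?mulr_gt0// ler_peMl// ltW.
Qed.

(** The comparison passes to the ratio with [ln_plus], where a larger argument only increases the
    denominator, and back. It makes the moment condition invariant under scaling, so one constant in
    the tail series is as good as another. *)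
Lemma expW_scale C t : 1 <= C -> 0 <= t ->
  expW (C * t) <= 4 * C * expW t + expR 1.
Proof.
move=> C1 t0; have C0 : 0 < C := lt_le_trans ltr01 C1.
have Ct0 : 0 <= C * t by rewrite mulr_ge0// ltW.
have := expW_le_ratio Ct0; have := ratio_le_plus Ct0.
have := ratio_plus_scale C1 t0.
have : C * (t / (1 + ln_plus t)) <= C * expW t.
  by rewrite ler_pM2l// (le_trans (ratio_plus_le t0))// ratio_le_expW.
lra.
Qed.

Lemma measurable_expW_norm d (T : measurableType d) (f : T -> R) :
  measurable_fun [set: T] f -> measurable_fun [set: T] (fun w => expW `|f w|).
Proof.
(* Extended by 0 to negative arguments, [expW] is nondecreasing on the whole line and hence
   measurable. *)
move=> mf; pose g x := if 0 <= x then expW x else 0.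
have -> : (fun w => expW `|f w|) = g \o (fun w => `|f w|).
  by apply/funext => w; rewrite /g/= normr_ge0.
apply: measurableT_comp; last exact: measurableT_comp.
apply: nondecreasing_measurable => // x y xy; rewrite /g.
case: ifPn => x0; first by rewrite (le_trans x0 xy) expW_le.
by case: ifP => // y0; rewrite (le_trans _ (expW_ge1 y0)).
Qed.

End LambertTail.

Section LambertMoment.
Context d (T : measurableType d) (R : realType) (P : probability T R).
Implicit Types f g Z : T -> R.

Lemma integral_lty_le f g (a b : R) :
  measurable_fun [set: T] f -> measurable_fun [set: T] g ->
  (forall w, 0 <= f w) -> (forall w, 0 <= g w) -> 0 <= a -> 0 <= b ->
  (forall w, f w <= a * g w + b) ->
  (\int[P]_w (g w)%:E < +oo)%E -> (\int[P]_w (f w)%:E < +oo)%E.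
Proof.
move=> mf mg f0 g0 a0 b0 fg ig.
apply: (@le_lt_trans _ _ (\int[P]_w (a%:E * (g w)%:E + b%:E))%E).
  apply: ge0_le_integral => //.
  - by move=> w _; rewrite lee_fin.
  - exact/measurable_EFinP.
  - under eq_fun do rewrite -EFinM -EFinD.
    by apply/measurable_EFinP/measurable_funD => //; exact: measurable_funM.
  - by move=> w _; rewrite -EFinM -EFinD lee_fin.
rewrite ge0_integralD//; last 2 first.
- by move=> w _; rewrite -EFinM lee_fin mulr_ge0.
- by under eq_fun do rewrite -EFinM; apply/measurable_EFinP; exact: measurable_funM.
rewrite ge0_integralZl//; last 2 first.
- exact/measurable_EFinP.
- by move=> w _; rewrite lee_fin.
rewrite integral_cst// lte_add_pinfty//.
  by rewrite lte_mul_pinfty.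
by rewrite lte_mul_pinfty// ltey_eq fin_num_measure.
Qed.

Lemma moment_scale Z (C : R) : measurable_fun [set: T] Z -> 0 < C ->
  (\int[P]_w (expW `|Z w|)%:E < +oo)%E -> (\int[P]_w (expW `|C * Z w|)%:E < +oo)%E.
Proof.
move=> mZ C0; set D := Num.max C 1.
have D1 : 1 <= D by rewrite le_max lexx orbT.
have CD : C <= D by rewrite le_max lexx.
apply: (@integral_lty_le _ _ (4 * D) (expR 1)).
- by apply: measurable_expW_norm; exact: measurable_funM.
- exact: measurable_expW_norm.
- by move=> w; exact: expR_ge0.
- by move=> w; exact: expR_ge0.
- by rewrite mulr_ge0// (le_trans _ D1).
- exact: expR_ge0.
- move=> w; apply: le_trans (expW_scale D1 (normr_ge0 (Z w))).
  by rewrite expW_le// normrM ler_wpM2r// gtr0_norm.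
Qed.

(** Integrates a count: the [i] with [phi i < |Z|] are those with [i.+1 < expW |Z|], and there are
    at most [expW |Z|] of them. *)
Lemma moment_tail Z : measurable_fun [set: T] Z ->
  (\int[P]_w (expW `|Z w|)%:E < +oo)%E ->
  exists C : R, forall n, \sum_(0 <= i < n) fine (P [set w | phi i%:R < `|Z w|]) <= C.
Proof.
move=> mZ iZ; have mN : measurable_fun [set: T] (fun w => `|Z w|).
  exact: measurableT_comp.
have mA i : measurable [set w | phi i%:R < `|Z w|] by exact: measurable_gt.
have mW := measurable_expW_norm mZ.
have iF : (\int[P]_w (expW `|Z w|)%:E \is a fin_num)%E.
  rewrite ge0_fin_numE//; apply: integral_ge0 => w _; rewrite lee_fin; exact: expR_ge0.
exists (fine (\int[P]_w (expW `|Z w|)%:E)) => n.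
have -> : \sum_(0 <= i < n) fine (P [set w | phi i%:R < `|Z w|]) =
   \int[P]_w (\sum_(0 <= i < n) \1_[set w | phi i%:R < `|Z w|] w).
  rewrite mean_sum; last by move=> i; exact: bounded_rv_indic.
  by apply: eq_bigr => i _; rewrite mean_indic.
have bS : bounded_rv (fun w => \sum_(0 <= i < n) (\1_[set w | phi i%:R < `|Z w|] w : R)).
  by apply: bounded_rv_sum => i; exact: bounded_rv_indic.
apply: fine_le => //; first exact: (integrable_fin_num _ (bounded_rv_integrable P bS)).
apply: ge0_le_integral => //.
- by move=> w _; rewrite lee_fin sumr_ge0.
- by apply/measurable_EFinP; have [] := bS.
- exact/measurable_EFinP.
- move=> w _; rewrite lee_fin; pose t : R := `|Z w|; rewrite -/t.
  have t0 : 0 <= t by exact: normr_ge0.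
  have E i : \1_[set w | phi i%:R < `|Z w|] w = (i.+1%:R < expW t)%R%:R :> R.
    rewrite indicE -natr1 expW_gt_phi//.
    by case: (boolP (phi _ < t)) => h; [rewrite mem_set|rewrite memNset//; exact/negP].
  under eq_bigr do rewrite E.
  elim: n {bS} => [|n IH]; first by rewrite big_geq// expR_ge0.
  rewrite big_nat_recr//=; case: ltP => h; last by rewrite addr0.
  apply: (@le_trans _ _ (n%:R + 1)); last by rewrite natr1 ltW.
  rewrite lerD2r; elim: n {IH h} => [|n IH]; first by rewrite big_geq.
  by rewrite big_nat_recr//= -[leRHS]natr1 lerD// ?lern1 ?leq_b1// ler_nat leq_b1.
Qed.

Lemma tail_moment Z (C : R) : measurable_fun [set: T] Z ->
  (forall n, \sum_(0 <= i < n) fine (P [set w | phi i%:R < `|Z w|]) <= C) ->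
  (\int[P]_w (expW `|Z w|)%:E < +oo)%E.
Proof.
move=> mZ hC; have mN : measurable_fun [set: T] (fun w => `|Z w|).
  exact: measurableT_comp.
have mA i : measurable [set w | phi i%:R < `|Z w|] by exact: measurable_gt.
have mW := measurable_expW_norm mZ.
pose A i := [set w | phi i%:R < `|Z w|].
pose S (w : T) : \bar R := (\sum_(0 <= i <oo) (\1_(A i) w)%:E)%E.
have mS : measurable_fun [set: T] S.
  apply: ge0_emeasurable_sum => [i w _ _|i _]; first by rewrite lee_fin.
  by apply/measurable_EFinP/measurable_indic; exact: mA.
(* The loss of 2 is rounding: [expW t] is below its integer part plus 1, and the count of
   [i.+1 < expW t] is at least the integer part minus 1. *)
apply: (@le_lt_trans _ _ (\int[P]_w (S w + 2%:E))%E).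
  apply: ge0_le_integral => //.
  - by move=> w _; rewrite lee_fin expR_ge0.
  - exact/measurable_EFinP.
  - exact: emeasurable_funD.
  - move=> w _; pose t : R := `|Z w|; rewrite -/t; have t0 : 0 <= t by exact: normr_ge0.
    have u1 := expW_ge1 t0.
    have := @nneseries_lim_ge R
      (fun i => (\1_(A i) w)%:E) xpredT 0%N
      (Num.truncn (expW t)).-1 => /(_ (fun _ _ _ => _)) h.
    apply: (@le_trans _ _ (((Num.truncn (expW t)).-1)%:R%:E + 2%:E)%E).
      rewrite -EFinD lee_fin; have := truncnS_gt (expW t).
      have : (0 < Num.truncn (expW t))%N by rewrite truncn_gt0.
      case: (Num.truncn _) => // n _; rewrite -(natr1 n.+1) -(natr1 n)/=; lra.
    rewrite leeD2r//; apply: le_trans (h _); last by move=> *; rewrite lee_fin.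
    rewrite sumEFin lee_fin big_nat.
    rewrite (eq_bigr (fun=> 1)).
      by rewrite -big_nat big_const_nat subn0 iter_addr_0.
    move=> i /andP[_ iN]; rewrite indicE mem_set//; rewrite /A /=.
    rewrite -expW_gt_phi// natr1.
    apply: (@lt_le_trans _ _ (Num.truncn (expW t))%:R).
      by rewrite ltr_nat; move: iN; case: (Num.truncn _).
    by have /andP[] := truncn_itv (le_trans ler01 u1).
rewrite ge0_integralD//; last first.
  by move=> w _; apply: nneseries_ge0.
rewrite integral_cst// lte_add_pinfty//; last first.
  by rewrite lte_mul_pinfty// ltey_eq fin_num_measure.
rewrite integral_nneseries//; last first.
  by move=> i; apply/measurable_EFinP/measurable_indic; exact: mA.
apply: (@le_lt_trans _ _ C%:E); last exact: ltry.
apply: lime_le; first by apply: is_cvg_nneseries => i _ _; apply: integral_ge0.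
apply: nearW => n; apply: le_trans (_ : _ <= (\sum_(0 <= i < n) fine (P [set w | phi i%:R < `|Z w|]))%:E)%E _.
  rewrite -sumEFin; apply: lee_sum => i _.
  rewrite integral_indic//; last exact: mA.
  by rewrite setIT prob_EFin//; exact: mA.
by rewrite lee_fin.
Qed.

End LambertMoment.

(** * Truncation and the almost sure logarithmic law *)

Section Truncation.
Context (R : realType).
Implicit Types x y c t u : R.

Definition trunc c x : R := if `|x| <= c then x else 0.

Lemma measurable_trunc c : measurable_fun [set: R] (trunc c).
Proof.
by apply: measurable_fun_ifT => //; exact: measurable_fun_ler.
Qed.

Lemma trunc_le c x : 0 <= c -> `|trunc c x| <= c.
Proof. by move=> c0; rewrite /trunc; case: ifP => // _; rewrite normr0. Qed.

(** With [u = expW t] the cutoff condition reads [u <= i.+2]; then [t = u * ln u <= u * ln i.+2]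
    cancels the logarithm and the term is at most [(u / i.+1) ^+ 2]. The inverse squares from there
    on sum to order [1 / u]. *)
Lemma truncated_series_bound t n : 0 <= t ->
  \sum_(0 <= i < n) (if t <= phi i.+1%:R then t ^+ 2 else 0) /
     (i.+1%:R * ln i.+2%:R) ^+ 2 <= 6 * expW t.
Proof.
move=> t0; set u := expW t; have u1 : 1 <= u by exact: expW_ge1.
have u0 : 0 < u by exact: lt_le_trans u1.
(* The constant 6 puts the inverse square of [i.+1] below 6 times [i.+2^-1 - i.+3^-1], with equality
   at [i = 0]; the majorant telescopes. *)
have le1 i : (if t <= phi i.+1%:R then t ^+ 2 else 0) / (i.+1%:R * ln i.+2%:R) ^+ 2 <=
    (if u <= i.+2%:R then 6 * u ^+ 2 * (i.+2%:R^-1 - i.+3%:R^-1) else 0).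
  rewrite -(natr1 i.+1) [t <= _]leNgt -expW_gt_phi// -leNgt -/u.
  case: ifP => ui; last by rewrite mul0r.
  have ln2 : 0 < ln (i.+1%:R + 1) :> R by rewrite ln_gt0// ltrDr.
  have lu : ln u <= ln (i.+1%:R + 1).
    by rewrite ler_ln ?posrE ?addr_gt0.
  have lu0 : 0 <= ln u by rewrite ln_ge0.
  rewrite -[X in X ^+ 2 / _](expWE t0) -/u.
  apply: (@le_trans _ _ ((u * ln (i.+1%:R + 1)) ^+ 2 / (i.+1%:R * ln (i.+1%:R + 1)) ^+ 2)).
    rewrite ler_wpM2r ?invr_ge0 ?sqr_ge0// ler_pXn2r ?nnegrE ?mulr_ge0 ?(ltW u0) ?(ltW ln2)//.
    by rewrite ler_pM2l.
  have -> : (u * ln (i.+1%:R + 1)) ^+ 2 / (i.+1%:R * ln (i.+1%:R + 1)) ^+ 2 =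
      u ^+ 2 * (i.+1%:R ^+ 2)^-1.
    rewrite !exprMn invfM mulrACA divff ?mulr1// expf_neq0//.
    by rewrite gt_eqF.
  rewrite [leRHS](_ : _ = u ^+ 2 * (6 * ((i.+1%:R + 1)^-1 - i.+3%:R^-1))); last by ring.
  rewrite ler_pM2l ?exprn_gt0//.
  rewrite -(natr1 i.+2) -(natr1 i.+1) -(natr1 i).
  have i0 : 0 <= i%:R :> R by exact: ler0n.
  have -> : 6 * ((i%:R + 1 + 1)^-1 - (i%:R + 1 + 1 + 1)^-1) =
     6 / ((i%:R + 1 + 1) * (i%:R + 1 + 1 + 1)) :> R.
    by field; rewrite !gt_eqF//; lra.
  rewrite ler_pdivlMr; last by rewrite mulr_gt0//; lra.
  rewrite ler_pdivrMl; last by rewrite exprn_gt0//; lra.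
  by rewrite expr2; nra.
apply: (le_trans (ler_sum _ (fun i _ => le1 i))).
suff H : \sum_(0 <= i < n) (if u <= i.+2%:R then 6 * u ^+ 2 * (i.+2%:R^-1 - i.+3%:R^-1) else 0) <=
    (if u <= n.+2%:R then 6 * u ^+ 2 * (u^-1 - n.+2%:R^-1) else 0).
  apply: (le_trans H); case: ifP => _; last by rewrite mulr_ge0// ltW.
  rewrite mulrBr (_ : 6 * u ^+ 2 / u = 6 * u); last by field; rewrite gt_eqF.
  by rewrite gerBl mulr_ge0// mulr_ge0// sqr_ge0.
have q0 : 0 <= 6 * u ^+ 2 by rewrite mulr_ge0// sqr_ge0.
elim: n => [|n IH].
  rewrite big_geq//; case: ifP => // u2.
  by rewrite mulr_ge0// subr_ge0 lef_pV2 ?posrE.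
rewrite big_nat_recr//=; case: ifP IH => un IH.
  have -> : u <= n.+3%:R by rewrite (le_trans un)// ler_nat.
  apply: (le_trans (lerD IH (lexx _))).
  by rewrite -mulrDr addrA subrK.
rewrite addr0 (le_trans IH)//; case: ifP => // u3.
by rewrite mulr_ge0// subr_ge0 lef_pV2 ?posrE.
Qed.

(** Kronecker's lemma with weights [ln i.+2]. The first [N] terms only affect the additive constant;
    past [N] the partial sums move by at most [e / 2], which Abel summation doubles. *)
Lemma kronecker_log (xi : nat -> R) :
  (forall e : R, 0 < e -> exists N, forall n, (N <= n)%N ->
     `|\sum_(0 <= i < n) xi i - \sum_(0 <= i < N) xi i| <= e) ->
  log_small (fun n => \sum_(0 <= i < n.+1) ln i.+2%:R * xi i).
Proof.
move=> h e e0; have [N hN] := h (e / 2) (divr_gt0 e0 (ltr0n _ 2)).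
pose b i : R := ln i.+2%:R.
have b0 i : 0 <= b i by rewrite /b ln_ge0// ler1n.
have bS i : b i <= b i.+1 by rewrite /b ler_ln ?posrE// ler_nat.
pose c i := if (i < N)%N then 0 else xi i.
pose K := \sum_(0 <= i < N) `|b i * xi i|.
exists (K + e * ln 2) => n.
have -> : \sum_(0 <= i < n.+1) ln i.+2%:R * xi i =
   \sum_(0 <= i < n.+1) (if (i < N)%N then b i * xi i else 0) +
   \sum_(0 <= i < n.+1) b i * c i.
  rewrite -big_split/=; apply: eq_bigr => i _; rewrite /c /b.
  by case: ifP; rewrite ?mulr0 ?addr0 ?add0r.
have K1 : `|\sum_(0 <= i < n.+1) (if (i < N)%N then b i * xi i else 0)| <= K.
  apply: (le_trans (ler_norm_sum _ _ _)).
  have -> : K = \sum_(0 <= i < N) (if (i < N)%N then `|b i * xi i| else 0).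
    by rewrite /K !big_nat; apply: eq_bigr => i /andP[_ ->].
  have -> : \sum_(0 <= i < n.+1) `|if (i < N)%N then b i * xi i else 0| =
     \sum_(0 <= i < n.+1) (if (i < N)%N then `|b i * xi i| else 0).
    by apply: eq_bigr => i _; case: ifP; rewrite ?normr0.
  have p0 i : 0 <= (if (i < N)%N then `|b i * xi i| else 0) by case: ifP.
  have [nN|Nn] := leqP n.+1 N.
    by rewrite [leRHS](big_cat_nat (leq0n n.+1) nN)/= lerDl sumr_ge0.
  rewrite (big_cat_nat (leq0n N) (ltnW Nn))/= [X in _ + X](_ : _ = 0) ?addr0//.
  by rewrite big_nat big1// => i /andP[Ni _]; rewrite ltnNge Ni.
have cE k : \sum_(0 <= i < k) c i =
    if (k <= N)%N then 0 else \sum_(0 <= i < k) xi i - \sum_(0 <= i < N) xi i.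
  case: leqP => kN.
    by rewrite big_nat big1// => i /andP[_ ik]; rewrite /c (leq_trans ik kN).
  rewrite !(big_cat_nat (leq0n N) (ltnW kN))/= [RHS]addrAC subrr add0r.
  rewrite big_nat big1 ?add0r; last by move=> i /andP[_ ik]; rewrite /c ik.
  by rewrite !big_nat; apply: eq_bigr => i /andP[Ni _]; rewrite /c ltnNge Ni.
have K2 : `|\sum_(0 <= i < n.+1) b i * c i| <= 2 * (e / 2) * b n.
  apply: abel_bound => // k _; rewrite cE; case: ifPn => kN.
    by rewrite normr0 divr_ge0// ltW.
  by apply: hN; rewrite ltnW// ltnNge.
have K3 : b n <= ln 2 + ln n.+1%:R.
  rewrite /b -lnM ?posrE// ler_ln ?posrE ?mulr_gt0// -natrM ler_nat; lia.
apply: (le_trans (ler_normD _ _)).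
have : e * b n <= e * (ln 2 + ln n.+1%:R) by rewrite ler_pM2l.
move: K1 K2; rewrite mulrCA divff// mulr1 mulrDr; lra.
Qed.

Lemma log_small_eventually (s s' : nat -> R) N :
  (forall n, (N <= n)%N -> s n = s' n) ->
  log_small (fun n => \sum_(0 <= i < n.+1) s' i / i.+1%:R) ->
  log_small (fun n => \sum_(0 <= i < n.+1) s i / i.+1%:R).
Proof.
move=> ss h e e0; have [K hK] := h e e0.
pose D i := (s i - s' i) / i.+1%:R.
exists (K + \sum_(0 <= i < N) `|D i|) => n.
have -> : \sum_(0 <= i < n.+1) s i / i.+1%:R =
   \sum_(0 <= i < n.+1) s' i / i.+1%:R + \sum_(0 <= i < n.+1) D i.
  by rewrite -big_split/=; apply: eq_bigr => i _; rewrite /D -mulrDl addrC subrK.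
apply: (le_trans (ler_normD _ _)); rewrite addrA lerD//.
apply: (le_trans (ler_norm_sum _ _ _)).
have [nN|Nn] := leqP n.+1 N.
  by rewrite [leRHS](big_cat_nat (leq0n n.+1) nN)/= lerDl sumr_ge0.
rewrite (big_cat_nat (leq0n N) (ltnW Nn))/= [X in _ + X](_ : _ = 0) ?addr0//.
by rewrite big_nat big1// => i /andP[Ni _]; rewrite /D ss// subrr mul0r normr0.
Qed.

End Truncation.

Lemma borel_cantelli1 d (T : measurableType d) (R : realType) (P : probability T R)
    (A : nat -> set T) (C : R) : (forall n, measurable (A n)) ->
  (forall n, \sum_(0 <= i < n) fine (P (A i)) <= C) ->
  \forall w \ae P, exists N, forall n, (N <= n)%N -> ~ A n w.
Proof.
move=> mA hC.
have : P (lim_sup_set A) = 0.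
  apply: lim_sup_set_cvg0 => //; apply: (@le_lt_trans _ _ C%:E); last exact: ltry.
  apply: lime_le; first by apply: is_cvg_nneseries.
  apply: nearW => n.
  apply: (@le_trans _ _ (\sum_(0 <= i < n) fine (P (A i)))%:E); last by rewrite lee_fin.
  by rewrite -sumEFin; apply: lee_sum => i _; rewrite prob_EFin.
move=> P0; exists (lim_sup_set A); split=> //.
  apply: bigcapT_measurable => n; exact: bigcup_measurable.
move=> w /= /forallNP h n _.
have /existsNP[k /not_implyP[nk /contrapT Ak]] := h n.
by exists k.
Qed.

Section IdenticallyDistributed.
Context d (T : measurableType d) (R : realType) (P : probability T R).
Variable X : nat -> T -> R.
Hypothesis mX : forall i, measurable_fun [set: T] (X i).
Hypothesis idX : forall i B, measurable B -> P (X i @^-1` B) = P (X 0%N @^-1` B).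

Lemma bounded_rv_comp (g : R -> R) (M : R) i : measurable_fun [set: R] g ->
  (forall x, `|g x| <= M) -> bounded_rv (fun w => g (X i w)).
Proof.
by move=> mg gM; split; [exact: measurableT_comp|exists M => w].
Qed.

Lemma mean_id (g : R -> R) (M : R) i : measurable_fun [set: R] g ->
  (forall x, `|g x| <= M) ->
  \int[P]_w g (X i w) = \int[P]_w g (X 0%N w).
Proof.
move=> mg gM.
pose F j : {mfun T >-> R} :=
  MeasurableFun.Pack (MeasurableFun.Class (isMeasurableFun.Build _ _ _ _ _ (mX j))).
have E j : (\int[P]_w (g (X j w))%:E = \int[distribution P (F j)]_x (g x)%:E)%E.
  rewrite integral_distribution//; first exact/measurable_EFinP.
  by apply: bounded_rv_integrable; exact: bounded_rv_comp gM.
rewrite /Rintegral !E; congr fine; apply: eq_measure_integral => A mA _.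
exact: idX.
Qed.

Lemma prob_gt_id (c : R) i :
  P [set w | c < `|X i w|] = P [set w | c < `|X 0%N w|].
Proof.
by apply: (idX i (B := [set x | c < `|x|])); apply: measurable_gt; exact: normr_measurable.
Qed.

Lemma bounded_rv_trunc c i : 0 <= c -> bounded_rv (fun w => trunc c (X i w)).
Proof.
move=> c0; apply: (@bounded_rv_comp _ c); first exact: measurable_trunc.
by move=> x; exact: trunc_le.
Qed.

Lemma variance_le (U : T -> R) : bounded_rv U ->
  \int[P]_w ((U w - \int[P]_v U v) ^+ 2) <= \int[P]_w (U w ^+ 2).
Proof.
move=> bU; set m := \int[P]_v U v.
have -> : \int[P]_w ((U w - m) ^+ 2) = \int[P]_w (U w ^+ 2) - m ^+ 2.
  transitivity (\int[P]_w (U w ^+ 2 + (m ^+ 2 - 2 * m * U w))).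
    by apply: eq_Rintegral => w _; ring.
  have bU2 := bounded_rv_sqr bU.
  have bm : bounded_rv (fun _ : T => m ^+ 2) by exact: bounded_rv_cst.
  have b2 := bounded_rvZ (2 * m) bU.
  rewrite RintegralD//; [|exact: (bounded_rv_integrable P bU2)|
    exact: (bounded_rv_integrable P (bounded_rvB bm b2))].
  rewrite RintegralB//; [|exact: (bounded_rv_integrable P bm)|
    exact: (bounded_rv_integrable P b2)].
  rewrite mean_cst RintegralZl//; last exact: bounded_rv_integrable.
  by rewrite -/m; ring.
by rewrite gerBl sqr_ge0.
Qed.

Hypothesis iX : (\int[P]_w (expW `|X 0%N w|)%:E < +oo)%E.

Definition tmean (y : R) := \int[P]_w trunc (phi (y + 1)) (X 0%N w).

Lemma truncated_moment_bound : exists2 C : R, 0 <= C & forall n,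
  \sum_(0 <= i < n) (\int[P]_w (trunc (phi i.+1%:R) (X 0%N w) ^+ 2)) /
    (i.+1%:R * ln i.+2%:R) ^+ 2 <= C.
Proof.
have i0 : (0 <= \int[P]_w (expW `|X 0%N w|)%:E)%E.
  by apply: integral_ge0 => w _; rewrite lee_fin; exact: expR_ge0.
have iF : (\int[P]_w (expW `|X 0%N w|)%:E \is a fin_num)%E by rewrite ge0_fin_numE.
have mW := measurable_expW_norm (mX 0).
have bt i : bounded_rv (fun w => trunc (phi i.+1%:R) (X 0%N w)).
  by apply: bounded_rv_trunc; rewrite phi_ge0.
exists (6 * fine (\int[P]_w (expW `|X 0%N w|)%:E)) => [|n].
  by rewrite mulr_ge0// fine_ge0.
pose f i w := ((i.+1%:R * ln i.+2%:R) ^+ 2)^-1 * trunc (phi i.+1%:R) (X 0%N w) ^+ 2 : R.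
have bf i : bounded_rv (f i) by apply: bounded_rvZ; exact: bounded_rv_sqr.
have -> : \sum_(0 <= i < n) (\int[P]_w (trunc (phi i.+1%:R) (X 0%N w) ^+ 2)) /
    (i.+1%:R * ln i.+2%:R) ^+ 2 = \int[P]_w (\sum_(0 <= i < n) f i w).
  rewrite mean_sum//; apply: eq_bigr => i _; rewrite mulrC /f RintegralZl//.
  exact/bounded_rv_integrable/bounded_rv_sqr.
have bS := bounded_rv_sum (index_iota 0 n) bf.
rewrite (_ : 6 = fine (6%:E))// -fineM//; apply: fine_le.
- exact: (integrable_fin_num _ (bounded_rv_integrable P bS)).
- by rewrite fin_numM.
rewrite -ge0_integralZl//; last 2 first.
- exact/measurable_EFinP.
- by move=> w _; rewrite lee_fin expR_ge0.
apply: ge0_le_integral => //.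
- move=> w _; rewrite lee_fin sumr_ge0// => i _.
  by rewrite /f mulr_ge0 ?invr_ge0 ?sqr_ge0.
- by apply/measurable_EFinP; have [] := bS.
- by under eq_fun do rewrite -EFinM; apply/measurable_EFinP; exact: measurable_funM.
- move=> w _; rewrite -EFinM lee_fin.
  apply: le_trans (truncated_series_bound n (normr_ge0 (X 0%N w))).
  rewrite le_eqVlt; apply/orP; left; apply/eqP; apply: eq_bigr => i _.
  rewrite /f mulrC /trunc; case: ifP => _; last by rewrite expr0n.
  by rewrite real_normK ?num_real.
Qed.

Hypothesis indepX : forall (J : {fset nat}) (B : nat -> set R),
  (forall j, j \in J -> measurable (B j)) ->
  P (\bigcap_(j in [set` J]) (X j @^-1` B j)) =
  (\prod_(j <- J) P (X j @^-1` B j))%E.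

Lemma truncation_ae : \forall w \ae P, exists N, forall n, (N <= n)%N ->
  trunc (phi n.+1%:R) (X n w) = X n w.
Proof.
have [C hC] := moment_tail (mX 0) iX.
pose A n := [set w | phi n.+1%:R < `|X n w|].
have mA n : measurable (A n).
  by apply: measurable_gt; exact: measurableT_comp.
have : forall n, \sum_(0 <= i < n) fine (P (A i)) <= C.
  move=> n; apply: le_trans (hC n); apply: ler_sum => i _.
  rewrite /A prob_gt_id; apply: prob_le.
  - by apply: measurable_gt; exact: measurableT_comp.
  - by apply: measurable_gt; exact: measurableT_comp.
  - by move=> w /=; apply: lt_trans; rewrite phi_lt// ltr_nat.
move/(borel_cantelli1 mA); apply: filterS => w [N hN]; exists N => n /hN h.
by rewrite /trunc leNgt; case: ltP => //; move=> ?; exfalso; exact: h.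
Qed.

Lemma centered_log_small : \forall w \ae P,
  log_small (fun n => \sum_(0 <= i < n.+1)
    (if i == 0%N then 0 else X i w - tmean i%:R) / i.+1%:R).
Proof.
pose b i : R := i.+1%:R * ln i.+2%:R.
have b0 i : 0 < b i by rewrite mulr_gt0// ln_gt0// ltr1n.
(* The weight [i.+1 * ln i.+2] makes the variances summable; Kronecker's lemma then removes the
   logarithm only and leaves the weight [1 / i.+1] of the logarithmic means. *)
pose g i x := (b i)^-1 * (trunc (phi i.+1%:R) x - tmean i%:R).
have p0 i : 0 <= phi (i.+1%:R : R) by rewrite phi_ge0.
have bt i j : bounded_rv (fun w => trunc (phi i.+1%:R) (X j w)).
  exact: bounded_rv_trunc.
have mg i : measurable_fun [set: R] (g i).
  apply: measurable_funM => //; apply: measurable_funB => //.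
  exact: measurable_trunc.
have bY i : bounded_rv (fun w => g i (X i w)).
  by apply/bounded_rvZ/bounded_rvB => //; exact: bounded_rv_cst.
have mtr i j : \int[P]_w trunc (phi i.+1%:R) (X j w) = tmean i%:R.
  rewrite (@mean_id _ (phi i.+1%:R)) ?/tmean ?natr1//.
    exact: measurable_trunc.
  by move=> x; exact: trunc_le.
have Y0 i : \int[P]_w g i (X i w) = 0.
  rewrite /g RintegralZl//; last first.
    by apply/bounded_rv_integrable/bounded_rvB => //; exact: bounded_rv_cst.
  rewrite RintegralB ?mean_cst ?mtr ?subrr ?mulr0//.
  - exact: bounded_rv_integrable.
  - exact/bounded_rv_integrable/bounded_rv_cst.
have [C C0 hC] := truncated_moment_bound.
have vC n : \sum_(0 <= i < n) \int[P]_w (g i (X i w) ^+ 2) <= C.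
  apply: le_trans (hC n); apply: ler_sum => i _.
  under eq_Rintegral do rewrite /g exprMn.
  rewrite RintegralZl//; last first.
    apply/bounded_rv_integrable/bounded_rv_sqr/bounded_rvB => //.
    exact: bounded_rv_cst.
  rewrite mulrC exprVn ler_pM2r ?invr_gt0 ?exprn_gt0//.
  rewrite -(mtr i i); apply: (le_trans (variance_le (bt i i))).
  rewrite le_eqVlt; apply/orP; left; apply/eqP.
  apply: (@mean_id (fun x => trunc (phi i.+1%:R) x ^+ 2) (phi i.+1%:R ^+ 2)).
    by apply: measurable_funX; exact: measurable_trunc.
  by move=> x; rewrite normrX ler_pXn2r ?nnegrE// trunc_le.
have := kolmogorov_series mX indepX mg bY Y0 vC.
apply: filterS2 truncation_ae => w [N hN] hw.
have := kronecker_log hw.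
have : (fun n => \sum_(0 <= i < n.+1) ln i.+2%:R * g i (X i w)) =
   (fun n => \sum_(0 <= i < n.+1) (trunc (phi i.+1%:R) (X i w) - tmean i%:R) / i.+1%:R).
  apply/funext => n; apply: eq_bigr => i _; rewrite /g /b.
  have l0 : ln i.+2%:R != 0 :> R by rewrite gt_eqF// ln_gt0// ltr1n.
  have k0 : i.+1%:R != 0 :> R by rewrite pnatr_eq0.
  by move: (ln _) (i.+1%:R) l0 k0 => l k l0 k0; field; rewrite ?l0 ?k0.
(* Starting at [N.+1] rather than [N] skips the index 0, where the centered sequence is 0 by
   convention. *)
move=> ->; apply: (@log_small_eventually _ _ _ N.+1) => n Nn.
by case: n Nn => // n Nn /=; rewrite hN// ltnW.
Qed.

End IdenticallyDistributed.

(** * Ratio limit and complete convergence *)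

Section Asymptotics.
Context (R : realType).

Lemma ln_nat_unbounded (c : R) : exists n0, forall n, (n0 <= n)%N -> c <= ln n.+2%:R.
Proof.
exists (Num.truncn (expR c)) => n; rewrite truncn_le_nat => h.
by rewrite -[leLHS]expRK ler_ln ?posrE ?expR_gt0// ltW// (lt_trans h)// ltr_nat.
Qed.

(** Once [n >= 3 / c ^+ 2] one has [n.+2 <= (c * n + 1) ^+ 2], so rescaling the argument loses only
    a factor 2 in the logarithm; the linear factor loses [min c 1]. *)
Lemma phi_lower_bound (c : R) : 0 < c -> exists2 c1 : R, 0 < c1 &
  exists n0, forall n, (n0 <= n)%N ->
    c1 * (n.+1%:R * ln n.+2%:R) <= phi (c * n%:R).
Proof.
move=> c0; pose q := Num.min c 1.
have q0 : 0 < q by rewrite lt_min c0 ltr01.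
exists (q / 2); first by rewrite divr_gt0.
exists (Num.truncn (3 / c ^+ 2)).+1 => n nn.
have n0 : (0 < n)%N by exact: leq_ltn_trans nn.
have cn : 3 / c ^+ 2 <= n%:R.
  by rewrite (le_trans (ltW (truncnS_gt _)))// ler_nat.
have y0 : 0 < c * n%:R + 1 by rewrite ltr_wpDl// mulr_ge0// ltW.
have sq : n.+2%:R <= (c * n%:R + 1) ^+ 2.
  rewrite ler_pdivrMr ?exprn_gt0// in cn.
  have : n%:R * 3 <= n%:R * (n%:R * c ^+ 2) by rewrite ler_wpM2l.
  have : 1 <= n%:R :> R by rewrite ler1n.
  rewrite -(natr1 n.+1) -(natr1 n).
  have -> : (c * n%:R + 1) ^+ 2 = n%:R * (n%:R * c ^+ 2) + 2 * (c * n%:R) + 1 by ring.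
  have : 0 <= c * n%:R by rewrite mulr_ge0// ltW.
  lra.
have h1 : ln n.+2%:R <= 2 * ln (c * n%:R + 1).
  by rewrite mulr2n mulrDl mul1r -lnM ?posrE// -expr2 ler_ln ?posrE ?exprn_gt0.
have h2 : q * n.+1%:R <= c * n%:R + 1.
  rewrite -natr1 mulrDr mulr1 lerD// ?ge_min ?lexx ?orbT//.
  by rewrite ler_wpM2r// ge_min lexx.
have l0 : 0 <= ln n.+2%:R :> R by rewrite ln_ge0// ler1n.
rewrite /phi (_ : q / 2 * _ = q * n.+1%:R * (ln n.+2%:R / 2)); last by ring.
rewrite ler_pM// ?mulr_ge0 ?divr_ge0 ?(ltW q0)//.
by rewrite ler_pdivrMr// mulrC.
Qed.

Lemma nneseries_lty (a : nat -> \bar R) (b : nat -> R) (C : R) n0 :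
  (forall n, (0 <= a n)%E) -> (forall n, (0 < n)%N -> (a n <= 1%:E)%E) ->
  (forall n, 0 <= b n) -> (forall n, (n0 <= n)%N -> (a n <= (b n)%:E)%E) ->
  (forall n, \sum_(0 <= i < n) b i <= C) ->
  (\sum_(1 <= n <oo) a n < +oo)%E.
Proof.
move=> a0 a1 b0 ab bC.
apply: (@le_lt_trans _ _ (C + n0%:R)%:E); last exact: ltry.
apply: lime_le; first by apply: is_cvg_nneseries.
apply: nearW => n.
apply: (@le_trans _ _ (\sum_(1 <= i < n) (b i + (i < n0)%N%:R)%:E)%E).
  rewrite big_nat [leRHS]big_nat; apply: lee_sum => i /andP[i1 _].
  have [h|h] := ltnP i n0; last by rewrite addr0 ab.
  by rewrite (le_trans (a1 i i1))// lee_fin lerDr.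
rewrite sumEFin lee_fin.
apply: (@le_trans _ _ (\sum_(0 <= i < n) (b i + (i < n0)%N%:R))).
  case: n => [|n]; first by rewrite !big_geq.
  by rewrite [leRHS]big_nat_recl// big_add1 lerDr addr_ge0.
rewrite big_split/= lerD//.
elim: n => [|n IH]; first by rewrite big_geq.
rewrite -natr_sum ler_nat.
have : (\sum_(0 <= i < n.+1) (i < n0) = minn n.+1 n0)%N.
  elim: n.+1 => [|k IHk]; first by rewrite big_geq// min0n.
  by rewrite big_nat_recr//= IHk; case: (ltnP k n0) => h; lia.
by move=> ->; exact: geq_minr.
Qed.

Lemma lt_bigmax_nat (f : nat -> R) (c : R) n : 0 <= c ->
  (c < \big[Num.max/0]_(1 <= k < n.+1) f k) <->
  exists2 k, (1 <= k <= n)%N & c < f k.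
Proof.
move=> c0; split=> [|[k kn ck]]; last first.
  apply: (lt_le_trans ck); apply: (@le_bigmax_seq _ _ _ _ _ k xpredT f) => //.
  by rewrite mem_index_iota ltnS.
rewrite ltNge => /negP; apply: contra_notP => h.
rewrite big_nat; apply: bigmax_le => // k; rewrite ltnS => kn.
by rewrite leNgt; apply/negP => ck; apply: h; exists k.
Qed.

Lemma prob_exists_le d (T : measurableType d) (P : probability T R)
    (A : nat -> set T) n : (forall i, measurable (A i)) ->
  measurable [set w | exists2 i, (1 <= i <= n)%N & A i w] /\
  fine (P [set w | exists2 i, (1 <= i <= n)%N & A i w]) <=
  \sum_(1 <= i < n.+1) fine (P (A i)).
Proof.
move=> mA; elim: n => [|n [mU IH]].
  rewrite (_ : [set w | _] = set0).
    by rewrite measure0 big_geq.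
  rewrite -subset0 => w [i /andP[i1]].
  by rewrite leqn0 => /eqP i0; rewrite i0 in i1.
rewrite (_ : [set w | exists2 i, (1 <= i <= n.+1)%N & A i w] =
  [set w | exists2 i, (1 <= i <= n)%N & A i w] `|` A n.+1); last first.
  apply/seteqP; split=> w.
    move=> [i /andP[i1]]; rewrite leq_eqVlt => /predU1P[->|ni] Aw; first by right.
    by left; exists i => //; rewrite i1.
  move=> [[i /andP[i1 ni] Aw]|Aw]; first by exists i => //; rewrite i1/= ltnW.
  by exists n.+1 => //; rewrite leqnn.
split; first exact: measurableU.
rewrite big_nat_recr//= (le_trans _ (lerD IH (lexx _)))//.
rewrite -fineD ?fin_num_measure//; apply: fine_le.
- by rewrite fin_num_measure//; exact: measurableU.
- by rewrite fin_numD !fin_num_measure.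
exact: measureU2.
Qed.

End Asymptotics.

Section MomentConsequences.
Context d (T : measurableType d) (R : realType) (P : probability T R).
Variable X : nat -> T -> R.
Hypothesis mX : forall i, measurable_fun [set: T] (X i).
Hypothesis idX : forall i B, measurable B -> P (X i @^-1` B) = P (X 0%N @^-1` B).
Hypothesis iX : (\int[P]_w (expW `|X 0%N w|)%:E < +oo)%E.

Lemma moment_ratio_ae :
  \forall w \ae P, X n w / (n%:R * ln n%:R) @[n --> \oo] --> (0 : R).
Proof.
(* [phi n] is the denominator [n.+1 * ln n.+1] of index [n.+1], whence the shift. The factor [j.+1]
   stands for an arbitrarily large multiple, allowed by [moment_scale]. *)
have H : \forall w \ae P, forall j : nat, exists N, forall n, (N <= n)%N ->
    ~ phi n%:R < `|j.+1%:R * X n.+1 w|.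
  apply: ae_foralln => j.
  have mZ i : measurable_fun [set: T] (fun w => j.+1%:R * X i w).
    exact: measurable_funM.
  have [C hC] := moment_tail (mZ 0%N) (moment_scale (mX 0%N) (ltr0Sn R j) iX).
  apply: (@borel_cantelli1 _ _ _ _ (fun n => [set w | phi n%:R < `|j.+1%:R * X n.+1 w|]) C).
    by move=> n; apply: measurable_gt; exact: measurableT_comp.
  move=> n; apply: le_trans (hC n); apply: ler_sum => i _.
  rewrite (_ : P [set w | phi i%:R < `|j.+1%:R * X i.+1 w|] =
     P [set w | phi i%:R < `|j.+1%:R * X 0%N w|])//.
  apply: (idX i.+1 (B := [set x | phi i%:R < `|j.+1%:R * x|])).
  apply: measurable_gt; apply: measurableT_comp; first exact: normr_measurable.
  exact: mulrl_measurable.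
apply: filterS H => w hw; apply/cvgr0Pnorm_le => e e0.
have [N hN] := hw (Num.truncn e^-1).
exists N.+2 => // -[//|n] /=; rewrite ltnS => Nn; have {}hN := hN n (ltnW Nn).
have n0 : (0 < n)%N by exact: leq_ltn_trans Nn.
have l0 : 0 < ln n.+1%:R :> R by rewrite ln_gt0// ltr1n.
have p0 : 0 < n.+1%:R * ln n.+1%:R :> R by rewrite mulr_gt0.
rewrite normrM normfV (gtr0_norm p0) ler_pdivrMr//.
move/negP : hN; rewrite -leNgt normrM ger0_norm// /phi natr1 => h.
have j1 : e^-1 <= (Num.truncn e^-1).+1%:R by rewrite ltW// truncnS_gt.
rewrite -[leLHS](mulKf (lt0r_neq0 e0)) mulrCA ler_pM2l//.
by rewrite (le_trans _ h)// ler_wpM2r.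
Qed.

(** The cutoff is [phi y], whereas [tmean] at [y] cuts at [phi (y + 1)]; hence the shift in
    [tmean_le]. *)
Definition abs_tmean (y : R) := \int[P]_w `|trunc (phi y) (X 0%N w)|.

Lemma tail_integral_small (e : R) : 0 < e -> exists k : nat,
  (\int[P]_w (expW `|X 0%N w| * \1_[set v | k%:R < `|X 0%N v|] w)%:E <= e%:E)%E.
Proof.
move=> e0.
have mA k : measurable [set v | (k%:R : R) < `|X 0%N v|].
  by apply: measurable_gt; exact: measurableT_comp.
have mW := measurable_expW_norm (mX 0%N).
have iW : P.-integrable [set: T] (fun w => (expW `|X 0%N w|)%:E).
  apply/integrableP; split; first exact/measurable_EFinP.
  apply: le_lt_trans iX; apply: ge0_le_integral => //.
  - by apply/measurableT_comp => //; exact/measurable_EFinP.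
  - exact/measurable_EFinP.
  - by move=> w _; rewrite gee0_abs// lee_fin expR_ge0.
have := @dominated_cvg _ T R P setT measurableT
  (fun k w => (expW `|X 0%N w| * \1_[set v | k%:R < `|X 0%N v|] w)%:E) (cst 0%E)
  (fun w => (expW `|X 0%N w|)%:E).
rewrite integral0 => h.
have {}h : (\int[P]_w (expW `|X 0%N w| * \1_[set v | k%:R < `|X 0%N v|] w)%:E)%E
    @[k --> \oo] --> 0%E.
  apply: h => //.
  - move=> k; apply/measurable_EFinP; exact: measurable_funM.
  - move=> w _; apply: cvg_near_cst; exists (Num.truncn `|X 0%N w|).+1 => // k /= kX.
    rewrite indicE memNset ?mulr0//= => h1.
    have : `|X 0%N w| < k%:R by rewrite (lt_le_trans (truncnS_gt _))// ler_nat.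
    by move/lt_trans => /(_ _ h1); rewrite ltxx.
  - move=> k w _; rewrite gee0_abs; last by rewrite lee_fin mulr_ge0// expR_ge0.
    by rewrite lee_fin indicE ler_piMr ?expR_ge0//; case: (_ \in _).
apply: contrapT => /forallNP H.
have : (e%:E <= 0)%E.
  apply: (cvge_ge _ h); apply: nearW => k; rewrite leNgt; apply/negP => hk.
  by apply: (H k); exact: ltW.
by rewrite lee_fin leNgt e0.
Qed.

(** On [|X| <= phi y] one has [expW |X| <= y + 1], hence [|X| <= expW |X| * ln (y + 1)]. Where
    [|X| <= k] the constant [k] suffices, and beyond [k] the mean of [expW |X|] is at most [e]. *)
Lemma abs_tmean_log_small (e : R) : 0 < e -> exists K : R, forall y, 0 <= y ->
  abs_tmean y <= e * ln (y + 1) + K.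
Proof.
move=> e0; have [k hk] := tail_integral_small e0.
exists k%:R => y y0; have y1 : 0 < y + 1 by rewrite ltr_wpDl.
have p0 := phi_ge0 y0; have l0 : 0 <= ln (y + 1) by rewrite ln_ge0// lerDr.
have bt := bounded_rv_trunc mX 0 p0.
have mA : measurable [set v | (k%:R : R) < `|X 0%N v|].
  by apply: measurable_gt; exact: measurableT_comp.
have mW := measurable_expW_norm (mX 0%N).
pose f w := expW `|X 0%N w| * \1_[set v | k%:R < `|X 0%N v|] w : R.
have mf : measurable_fun [set: T] f.
  exact: measurable_funM.
have f0 w : 0 <= f w by rewrite /f mulr_ge0// expR_ge0.
have bta : bounded_rv (fun w => `|trunc (phi y) (X 0%N w)|).
  split; first by apply: measurableT_comp => //; have [] := bt.
  by exists (phi y) => w; rewrite normr_id trunc_le.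
rewrite -lee_fin /abs_tmean /Rintegral fineK; last first.
  exact: (integrable_fin_num _ (bounded_rv_integrable P bta)).
apply: (@le_trans _ _ (\int[P]_w ((ln (y + 1))%:E * (f w)%:E + k%:R%:E))%E).
  apply: ge0_le_integral => //.
  - by apply/measurable_EFinP; have [] := bta.
  - under eq_fun do rewrite -EFinM -EFinD.
    by apply/measurable_EFinP/measurable_funD => //; exact: measurable_funM.
  move=> w _; rewrite -EFinM -EFinD lee_fin /trunc /f.
  have k0 : 0 <= k%:R :> R by [].
  have L0 : 0 <= ln (y + 1) * (expW `|X 0%N w| * \1_[set v | k%:R < `|X 0%N v|] w).
    by rewrite !mulr_ge0// expR_ge0.
  case: ifP => hy; last by rewrite normr0 addr_ge0.
  have [hk1|hk1] := leP `|X 0%N w| k%:R; first by rewrite (le_trans hk1)// lerDr.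
  rewrite indicE mem_set//= mulr1.
  apply: (@le_trans _ _ (ln (y + 1) * expW `|X 0%N w|)); last by rewrite lerDl.
  have u1 := expW_ge1 (normr_ge0 (X 0%N w)).
  rewrite -[leLHS](expWE (normr_ge0 (X 0%N w))) mulrC ler_wpM2r ?expR_ge0//.
  rewrite ler_ln ?posrE//; last exact: lt_le_trans u1.
  by rewrite leNgt expW_gt_phi// -leNgt.
rewrite ge0_integralD//; last 2 first.
- by move=> w _; rewrite -EFinM lee_fin mulr_ge0.
- by under eq_fun do rewrite -EFinM; apply/measurable_EFinP; exact: measurable_funM.
rewrite ge0_integralZl//; last 2 first.
- exact/measurable_EFinP.
- by move=> w _; rewrite lee_fin.
rewrite EFinD; apply: leeD.
  by rewrite mulrC EFinM lee_wpmul2l// lee_fin.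
by rewrite integral_cst// [X in (_ * X)%E](probability_setT P) mule1.
Qed.

Lemma tmean_le (y : R) : 0 <= y -> `|tmean P X y| <= abs_tmean (y + 1).
Proof.
move=> y0; rewrite /tmean /abs_tmean; apply: le_normr_Rintegral => //.
by apply/bounded_rv_integrable/(bounded_rv_trunc mX); rewrite phi_ge0// addr_ge0.
Qed.

Lemma abs_tmean_near (D e : R) : 1 <= D -> 0 < e -> exists n0, forall n, (n0 <= n)%N ->
  forall y, 0 <= y -> y <= D * n.+1%:R -> abs_tmean y <= e * ln n.+2%:R.
Proof.
move=> D1 e0; have [K hK] := abs_tmean_log_small (divr_gt0 e0 (ltr0n _ 2)).
have [n0 hn] := ln_nat_unbounded ((K + e / 2 * ln D) / (e / 2)).
exists n0 => n /hn h y y0 yD; apply: (le_trans (hK y y0)).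
have D0 : 0 < D by exact: lt_le_trans D1.
have : ln (y + 1) <= ln D + ln n.+2%:R.
  rewrite -lnM ?posrE// ler_ln ?posrE ?mulr_gt0 ?ltr_wpDl//.
  by rewrite -(natr1 n.+1) mulrDr mulr1 lerD.
move=> hl; have : e / 2 * ln (y + 1) <= e / 2 * (ln D + ln n.+2%:R).
  by rewrite ler_pM2l// divr_gt0.
move: h; rewrite ler_pdivrMr ?divr_gt0// mulrDr; lra.
Qed.

End MomentConsequences.

Section CompleteConvergence.
Context d (T : measurableType d) (R : realType) (P : probability T R).
Variable X : nat -> T -> R.
Hypothesis mX : forall i, measurable_fun [set: T] (X i).
Hypothesis idX : forall i B, measurable B -> P (X i @^-1` B) = P (X 0%N @^-1` B).
Hypothesis indepX : forall (J : {fset nat}) (B : nat -> set R),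
  (forall j, j \in J -> measurable (B j)) ->
  P (\bigcap_(j in [set` J]) (X j @^-1` B j)) =
  (\prod_(j <- J) P (X j @^-1` B j))%E.

Lemma measurable_centered_sum (m : nat -> R) k :
  measurable_fun [set: T] (fun w => \sum_(1 <= i < k.+1) (X i w - m i)).
Proof.
elim: k => [|k IH].
  by under eq_fun do rewrite big_geq//; exact: measurable_cst.
under eq_fun do rewrite big_nat_recr//=.
by apply: measurable_funD => //; apply: measurable_funB.
Qed.

Lemma measurable_max_sum (m : nat -> R) (c : R) n : 0 <= c ->
  measurable [set w | c < \big[Num.max/0]_(1 <= k < n.+1)
                        `|\sum_(1 <= i < k.+1) (X i w - m i)|].
Proof.
move=> c0; rewrite (_ : [set w | _] = [set w | exists2 k, (1 <= k <= n)%N &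
    c < `|\sum_(1 <= i < k.+1) (X i w - m i)|]); last first.
  by apply/seteqP; split=> w /(lt_bigmax_nat _ _ c0).
have [] // := prob_exists_le P n
  (A := fun k => [set w | c < `|\sum_(1 <= i < k.+1) (X i w - m i)|]).
by move=> k; apply/measurable_gt/measurableT_comp => //; exact: measurable_centered_sum.
Qed.

Hypothesis iX : (\int[P]_w (expW `|X 0%N w|)%:E < +oo)%E.

(** Chebyshev's inequality, read off from the maximal inequality at its last index. The cutoff of
    the second moment is raised to [phi n.+1] to match [truncated_moment_bound]. *)
Lemma truncated_sum_deviation (n : nat) (t : R) : 0 < t ->
  let V := [set w | t < `|\sum_(1 <= i < n.+1)
             (`|trunc (phi n%:R) (X i w)| - abs_tmean P X n%:R)|] in
  measurable V /\
  t ^+ 2 * fine (P V) <= n%:R * \int[P]_w (trunc (phi n.+1%:R) (X 0%N w) ^+ 2).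
Proof.
move=> t0 V; have p0 k : 0 <= phi (k%:R : R) by rewrite phi_ge0.
have mta k : measurable_fun [set: R] (fun x => `|trunc (phi k%:R) x|).
  by apply: measurableT_comp => //; exact: measurable_trunc.
have bta k x : Num.norm `|trunc (phi k%:R) x| <= phi (k%:R : R).
  by rewrite normr_id trunc_le.
have bt i k : bounded_rv (fun w => `|trunc (phi k%:R) (X i w)|).
  exact: (bounded_rv_comp mX i (mta k) (bta k)).
pose g i (x : R) := if (0 < i <= n)%N then `|trunc (phi n%:R) x| - abs_tmean P X n%:R else 0.
have mg i : measurable_fun [set: R] (g i).
  rewrite /g; case: (0 < i <= n)%N; last exact: measurable_cst.
  exact: measurable_funB.
have bY i : bounded_rv (fun w => g i (X i w)).
  rewrite /g; case: (0 < i <= n)%N; last exact: bounded_rv_cst.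
  by apply: bounded_rvB => //; exact: bounded_rv_cst.
have mtabs i : \int[P]_w `|trunc (phi n%:R) (X i w)| = abs_tmean P X n%:R.
  exact: (mean_id mX idX i (mta n) (bta n)).
have Y0 i : \int[P]_w g i (X i w) = 0.
  rewrite /g; case: (0 < i <= n)%N; last by rewrite mean_cst.
  rewrite RintegralB ?mean_cst ?mtabs ?subrr//.
  - exact: bounded_rv_integrable.
  - exact/bounded_rv_integrable/bounded_rv_cst.
have psumE w : psum X g n.+1 w =
    \sum_(1 <= i < n.+1) (`|trunc (phi n%:R) (X i w)| - abs_tmean P X n%:R).
  rewrite /psum big_ltn//= add0r !big_nat; apply: eq_bigr => i /andP[i0 ni].
  by rewrite /g i0 -ltnS ni.
have mV : measurable V.
  have -> : V = [set w | t < `|psum X g n.+1 w|].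
    by apply/seteqP; split=> w; rewrite /V/= psumE.
  apply/measurable_gt/measurableT_comp => //.
  by have [] := bounded_rv_sum (index_iota 0 n.+1) bY.
split=> //.
have [mA hA] := kolmogorov_maximal mX indepX mg bY Y0 n.+1 t0.
apply: (@le_trans _ _ (\sum_(0 <= i < n.+1) \int[P]_w (g i (X i w) ^+ 2))).
  apply: le_trans hA; rewrite ler_wpM2l ?sqr_ge0//; apply: prob_le => // w Vw.
  by exists n.+1 => //; rewrite psumE.
rewrite big_ltn//= {1}/g/=; under eq_Rintegral do rewrite expr0n.
rewrite mean_cst add0r.
rewrite (_ : n%:R * _ = \sum_(1 <= i < n.+1) \int[P]_w (trunc (phi n.+1%:R) (X 0%N w) ^+ 2)).
  rewrite !big_nat; apply: ler_sum => i /andP[i0 ni].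
  rewrite /g i0 -ltnS ni/= -(mtabs i); apply: (le_trans (variance_le P (bt i n))).
  have b2 x : Num.norm (`|trunc (phi n%:R) x| ^+ 2) <= phi (n%:R : R) ^+ 2.
    by rewrite normrX ler_pXn2r ?nnegrE.
  have m2 : measurable_fun [set: R] (fun x => `|trunc (phi n%:R) x| ^+ 2).
    exact: measurable_funX.
  rewrite (mean_id mX idX i m2 b2); apply: le_Rintegral => //.
  - exact/bounded_rv_integrable/bounded_rv_sqr.
  - by apply/bounded_rv_integrable/bounded_rv_sqr/(bounded_rv_trunc mX).
  move=> w _; rewrite real_normK ?num_real// /trunc.
  case: ifP => h; last by rewrite expr0n/= sqr_ge0.
  by rewrite (le_trans h) // ltW// phi_lt// ltr_nat.
by rewrite big_const_nat iter_addr_0 subn1/= mulr_natl.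
Qed.

Lemma complete_convergence (eps gam : R) : 0 < eps -> 1 < gam ->
  (\sum_(1 <= n <oo) (n%:R^-1)%:E *
    P [set w | (phi (n%:R / (gam - 1)) * eps <
             \big[Num.max/0]_(1 <= k < n.+1)
               `|\sum_(1 <= i < k.+1)
                   (X i w - tmean P X (i%:R + n%:R / (gam - 1)))|)%R] < +oo)%E.
Proof.
move=> eps0 gam1; pose c := (gam - 1)^-1.
have c0 : 0 < c by rewrite invr_gt0 subr_gt0.
have [c1 c10 [n1 hn1]] := phi_lower_bound c0.
have D1 : 1 <= c + 1 by lra.
(* Budget: the threshold is at least [eps * c1 * h n]. The centering terms and the truncated
   absolute means take a quarter each, and the half [th * h n] remains for the deviation. *)
have e0 : 0 < eps * c1 / 4 by rewrite divr_gt0// mulr_gt0.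
(* The factor [c + 1] covers every cutoff that occurs: [i + c * n + 1 <= (c + 1) * n.+1] for
   [i <= n]. *)
have [n2 hn2] := abs_tmean_near mX iX D1 e0.
pose th := eps * c1 / 2; have th0 : 0 < th by rewrite divr_gt0// mulr_gt0.
pose h (n : nat) : R := n.+1%:R * ln n.+2%:R.
have h0 n : 0 < h n by rewrite mulr_gt0// ln_gt0// ltr1n.
pose p (n : nat) : R := fine (P [set w | phi n%:R < `|X 0%N w|]).
pose v (n : nat) : R := \int[P]_w (trunc (phi n.+1%:R) (X 0%N w) ^+ 2).
have v0 n : 0 <= v n by apply: Rintegral_ge0 => w _; exact: sqr_ge0.
have [C1 hC1] := moment_tail (mX 0%N) iX.
have [C2 C20 hC2] := truncated_moment_bound mX iX.
have pyn n : 0 <= phi (n%:R / (gam - 1)) * eps.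
  by rewrite mulr_ge0 ?(ltW eps0)// phi_ge0// divr_ge0// subr_ge0 ltW.
pose bad n := [set w | (phi (n%:R / (gam - 1)) * eps <
             \big[Num.max/0]_(1 <= k < n.+1)
               `|\sum_(1 <= i < k.+1)
                   (X i w - tmean P X (i%:R + n%:R / (gam - 1)))|)%R].
have mbad n : measurable (bad n).
  exact: (measurable_max_sum (fun i => tmean P X (i%:R + n%:R / (gam - 1))) n (pyn n)).
have mU i n : measurable [set w | phi n%:R < `|X i w|].
  by apply: measurable_gt; exact: measurableT_comp.
(* The weight [1 / n] cancels the [n] of the union bound and the [n] of the variance of the sum,
   leaving the tail and the weighted second moment, both with bounded partial sums. *)
apply: (@nneseries_lty _ _ (fun n => p n + (th ^+ 2)^-1 * (v n / h n ^+ 2))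
  (C1 + (th ^+ 2)^-1 * C2) (maxn n1 n2).+1).
- by move=> n; rewrite mule_ge0// lee_fin invr_ge0.
- move=> n n0; rewrite -[leRHS]mule1; apply: lee_pmul => //.
  + by rewrite lee_fin invf_le1 ?ltr0n// ler1n.
  + exact: (probability_le1 P (mbad n)).
- by move=> n; rewrite addr_ge0 ?prob_ge0// mulr_ge0// ?invr_ge0 ?sqr_ge0// divr_ge0// sqr_ge0.
- move=> n nn.
  have /andP[nn1 nn2] : (n1 <= n)%N && (n2 <= n)%N.
    by move/ltnW: nn; rewrite geq_max.
  have n0 : (0 < n)%N by exact: leq_ltn_trans nn.
  rewrite -/(bad n) -prob_EFin// -EFinM lee_fin mulrC ler_pdivrMr ?ltr0n//.
  have t0 : 0 < th * h n by rewrite mulr_gt0.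
  have [mV hV] := truncated_sum_deviation n t0.
  set V := [set w | _] in mV hV.
  have [mE hE] := prob_exists_le P n (A := fun i => [set w | phi n%:R < `|X i w|])
    (fun i => mU i n).
  set E := [set w | _] in mE hE.
  (* Off [E] truncation changes no variable, and every partial sum is dominated by the sum of
     [|X i| + a] over all [i <= n], a bound that does not depend on [k]. *)
  have badUV : bad n `<=` E `|` V.
    move=> w badw; have [Ew|nEw] := pselect (E w); first by left.
    right; rewrite /V/=.
    have Xle i : (1 <= i <= n)%N -> `|X i w| <= phi n%:R.
      by move=> hi; rewrite leNgt; apply/negP => hX; apply: nEw; exists i.
    have [k /andP[k1 kn] hk] := (lt_bigmax_nat _ _ (pyn n)).1 badw.
    pose a : R := eps * c1 / 4 * ln n.+2%:R.
    have tab y : 0 <= y -> y <= (c + 1) * n.+1%:R -> abs_tmean P X y <= a by exact: hn2.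
    have ml i : (1 <= i <= n)%N -> `|tmean P X (i%:R + n%:R / (gam - 1))| <= a.
      move=> /andP[i1 ni]; have y0 : 0 <= i%:R + n%:R / (gam - 1).
        by rewrite addr_ge0// divr_ge0// subr_ge0 ltW.
      apply: (le_trans (tmean_le P mX y0)); apply: tab; first by rewrite addr_ge0.
      rewrite -/c mulrDl mul1r -(natr1 n) mulrDr.
      have : i%:R <= n%:R :> R by rewrite ler_nat.
      lra.
    have sum1 : `|\sum_(1 <= i < k.+1) (X i w - tmean P X (i%:R + n%:R / (gam - 1)))| <=
        \sum_(1 <= i < n.+1) (`|X i w| + a).
      apply: (le_trans (ler_norm_sum _ _ _)).
      apply: (@le_trans _ _ (\sum_(1 <= i < k.+1) (`|X i w| + a))).
        rewrite !big_nat; apply: ler_sum => i /andP[i1 ik].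
        rewrite (le_trans (ler_normB _ _))// lerD2l ml// i1/=.
        by rewrite (leq_trans _ kn)// -ltnS.
      rewrite [leRHS](big_cat_nat (n := k.+1))//= lerDl sumr_ge0// => i _.
      by rewrite addr_ge0// mulr_ge0 ?(ltW e0)// ln_ge0// ler1n.
    have tabn : abs_tmean P X n%:R <= a.
      by apply: tab => //; rewrite -(natr1 n) mulrDr mulr1 mulrDl mul1r; have := ler0n R n; nra.
    have sum2 : \sum_(1 <= i < n.+1) (`|X i w| + a) =
        \sum_(1 <= i < n.+1) (`|trunc (phi n%:R) (X i w)| - abs_tmean P X n%:R) +
        n%:R * (a + abs_tmean P X n%:R).
      have -> : n%:R * (a + abs_tmean P X n%:R) = \sum_(1 <= i < n.+1) (a + abs_tmean P X n%:R).
        by rewrite big_const_nat iter_addr_0 subn1/= mulr_natl.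
      rewrite -big_split/= !big_nat; apply: eq_bigr => i hi.
      rewrite /trunc Xle//; ring.
    have hphi := hn1 n nn1; rewrite -/(h n) mulrC -/c in hphi.
    have na : n%:R * a <= eps * c1 / 4 * h n.
      rewrite /a /h mulrCA ler_pM2l// ler_wpM2r ?ln_ge0 ?ler1n//.
      by rewrite ler_nat.
    have : eps * (c1 * h n) <= eps * phi (n%:R / (gam - 1)).
      by rewrite ler_pM2l// mulrC [_ / _]mulrC.
    have : n%:R * abs_tmean P X n%:R <= n%:R * a by rewrite ler_wpM2l.
    have := ler_norm (\sum_(1 <= i < n.+1) (`|trunc (phi n%:R) (X i w)| - abs_tmean P X n%:R)).
    move: hk sum1; rewrite sum2 mulrDr /th; lra.
  have Pbad : fine (P (bad n)) <= fine (P E) + fine (P V).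
    apply: (@le_trans _ _ (fine (P (E `|` V)))).
      by apply: prob_le => //; exact: measurableU.
    rewrite -fineD ?fin_num_measure//; apply: fine_le.
    + by rewrite fin_num_measure//; exact: measurableU.
    + by rewrite fin_numD !fin_num_measure.
    + exact: measureU2.
  apply: (le_trans Pbad); rewrite mulrDl; apply: lerD.
    apply: (le_trans hE); rewrite big_nat (eq_bigr (fun=> p n)); last first.
      by move=> i _; rewrite prob_gt_id.
    by rewrite -big_nat big_const_nat iter_addr_0 subn1/= mulr_natr.
  rewrite -(ler_pM2l (exprn_gt0 2 t0)); apply: (le_trans hV).
  rewrite exprMn -/(v n) [leRHS](_ : _ = n%:R * v n)//.
  by field; rewrite !gt_eqF.
- move=> n; rewrite big_split/= -mulr_sumr; apply: lerD => //.
  by rewrite ler_wpM2l ?invr_ge0 ?sqr_ge0//; exact: hC2.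
Qed.

End CompleteConvergence.

(** * Converses *)

Section SingleTerm.
Context d (T : measurableType d) (R : realType) (P : probability T R).
Variable X : nat -> T -> R.
Hypothesis mX : forall i, measurable_fun [set: T] (X i).
Hypothesis idX : forall i B, measurable B -> P (X i @^-1` B) = P (X 0%N @^-1` B).
Hypothesis indepX : forall (J : {fset nat}) (B : nat -> set R),
  (forall j, j \in J -> measurable (B j)) ->
  P (\bigcap_(j in [set` J]) (X j @^-1` B j)) =
  (\prod_(j <- J) P (X j @^-1` B j))%E.

(** The index list is explicit so that [rem] can delete a single index; [b] collects all
    deterministic terms. *)
Definition lincomb (r : seq nat) (a : nat -> R) (b : R) (w : T) : R :=
  \sum_(i <- r) a i * X i w + b.

Lemma adapted_lincomb (J : {fset nat}) (r : seq nat) a b :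
  {subset r <= J} -> adapted X J (lincomb r a b).
Proof.
rewrite /lincomb /adapted => rJ; apply: measurable_funD => //.
elim: r rJ => [|i r IH] rJ.
  by under eq_fun do rewrite big_nil; exact: measurable_cst.
under eq_fun do rewrite big_cons.
apply: measurable_funD; last by apply: IH => j jr; apply: rJ; rewrite inE jr orbT.
apply: measurable_funM => //.
by apply: adapted_coord; apply: rJ; rewrite inE eqxx.
Qed.

Lemma measurable_lincomb r a b : measurable_fun [set: T] (lincomb r a b).
Proof.
apply: (adapted_measurable mX (J := [fset i in r]%fset)).
by apply: adapted_lincomb => i ir; rewrite !inE.
Qed.

Lemma lincomb_rem r a b n w : uniq r -> n \in r ->
  lincomb r a b w = lincomb (rem n r) a b w + a n * X n w.
Proof.
by move=> ur nr; rewrite /lincomb (big_rem n nr)/=; ring.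
Qed.

(** The level 3t here and the level 2t of [small_rest] differ by [t], so that both events together
    force the total above [t]. *)
Definition big_term (t : R) (a : nat -> R) n := [set w | 3 * t < `|a n * X n w|].
Definition small_rest (t : R) r a b n := [set w | `|lincomb (rem n r) a b w| <= 2 * t].

Lemma measurable_abs_coef (c k : R) n : measurable [set w | c < `|k * X n w|].
Proof.
apply: measurable_gt; apply: measurableT_comp => //.
exact: measurable_funM.
Qed.

Lemma small_restE t r a b n :
  small_rest t r a b n = ~` [set w | 2 * t < `|lincomb (rem n r) a b w|].
Proof. by apply/seteqP; split=> w; rewrite /small_rest/= leNgt => /negP. Qed.

Lemma measurable_small_rest t r a b n : measurable (small_rest t r a b n).
Proof.
rewrite small_restE; apply: measurableC; apply: measurable_gt.
by apply: measurableT_comp => //; exact: measurable_lincomb.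
Qed.

Lemma big_term_sub t r a b n : uniq r -> n \in r ->
  big_term t a n `&` small_rest t r a b n `<=` [set w | t < `|lincomb r a b w|].
Proof.
move=> ur nr w []; rewrite /big_term /small_rest/= (lincomb_rem a b w ur nr).
set x := lincomb _ _ _ _; set y := a n * X n w => h1 h2.
have := ler_normB (x + y) x; rewrite addrAC subrr add0r; lra.
Qed.

Lemma coef_set_measurable (c k : R) : measurable [set x : R | c < `|k * x|].
Proof.
apply: measurable_gt; apply: measurableT_comp; first exact: normr_measurable.
exact: mulrl_measurable.
Qed.

Lemma big_term_indep t r a b n : uniq r -> n \in r ->
  P (big_term t a n `&` small_rest t r a b n) =
  (P (big_term t a n) * P (small_rest t r a b n))%E.
Proof.
move=> ur nr; rewrite setIC muleC.
apply: (@independent_cylinders _ _ _ _ X mX indepX [fset i in rem n r]%fset n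
  (small_rest t r a b n) [set x | 3 * t < `|a n * x|]).
- by rewrite !inE mem_rem_uniq// !inE eqxx.
- have -> : small_rest t r a b n =
      lincomb (rem n r) a b @^-1` [set x | `|x| <= 2 * t] by [].
  apply: adapted_preimage; first by apply: adapted_lincomb => i ir; rewrite !inE.
  rewrite (_ : [set x | _] = ~` [set x : R | 2 * t < `|x|]).
    by apply/measurableC/measurable_gt; exact: normr_measurable.
  by apply/seteqP; split=> x /=; rewrite leNgt => /negP.
- exact: coef_set_measurable.
Qed.

Lemma big_term_pairwise t (a : nat -> nat -> R) i j : i != j ->
  P (big_term t (a i) i `&` big_term t (a j) j) =
  (P (big_term t (a i) i) * P (big_term t (a j) j))%E.
Proof.
move=> ij.
apply: (@independent_cylinders _ _ _ _ X mX indepX [fset i]%fset j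
  (big_term t (a i) i) [set x | 3 * t < `|a j j * x|]).
- by rewrite !inE eq_sym.
- apply: sub_sigma_algebra; exists (fun=> [set x | 3 * t < `|a i i * x|]).
    by move=> _; exact: coef_set_measurable.
  apply/seteqP; split=> w.
    by move=> h k /=; rewrite inE => /eqP ->.
  by move=> /(_ i); apply; rewrite /= inE.
- exact: coef_set_measurable.
Qed.

(** The rest is the total minus its n-th term, so it exceeds 2t only where one of these exceeds
    [t]. *)
Lemma small_rest_prob t r a b n : uniq r -> n \in r ->
  fine (P [set w | t < `|lincomb r a b w|]) +
  fine (P [set w | t < `|a n * X n w|]) <= 2^-1 ->
  1 <= 2 * fine (P (small_rest t r a b n)).
Proof.
move=> ur nr h; pose B := [set w | 2 * t < `|lincomb (rem n r) a b w|].
have mL r' : measurable_fun [set: T] (fun w => `|lincomb r' a b w|).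
  by apply: measurableT_comp => //; exact: measurable_lincomb.
have mB : measurable B by exact: measurable_gt.
have mZ : measurable [set w | t < `|lincomb r a b w|] by exact: measurable_gt.
have mE := measurable_abs_coef t (a n) n.
have PB : fine (P B) <= 2^-1.
  apply: le_trans h.
  rewrite -fineD ?fin_num_measure//.
  apply: (@le_trans _ _ (fine (P ([set w | t < `|lincomb r a b w|] `|`
      [set w | t < `|a n * X n w|])))).
    apply: prob_le => //; first exact: measurableU.
    move=> w; rewrite /B/= => hB; apply: contrapT => /not_orP[/negP + /negP].
    rewrite -!leNgt (lincomb_rem a b w ur nr); move: hB.
    set x := lincomb _ _ _ _; set y := a n * X n w => h1 h2 h3.
    have := ler_normB (x + y) y; rewrite addrK; lra.
  apply: fine_le; last exact: measureU2.
  - by rewrite fin_num_measure//; exact: measurableU.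
  - by rewrite fin_numD !fin_num_measure.
rewrite small_restE -/B probability_setC// fineB ?fin_num_measure//=.
lra.
Qed.

End SingleTerm.

Section AlmostSureConverse.
Context d (T : measurableType d) (R : realType) (P : probability T R).

Lemma lim_sup_set_small (F : nat -> set T) (e : R) :
  (forall n, measurable (F n)) -> P (lim_sup_set F) = 0%E -> 0 < e ->
  exists N, fine (P (\bigcup_(k >= N) F k)) <= e.
Proof.
move=> mF F0 e0; have mU N : measurable (\bigcup_(k >= N) F k).
  exact: bigcup_measurable.
have h : P (\bigcup_(k >= n) F k) @[n --> \oo] --> 0%E.
  rewrite -F0; apply: (lim_sup_set_cvg P F mF).
  by rewrite ltey_eq fin_num_measure.
apply: contrapT => /forallNP H.
have : (e%:E <= 0)%E.
  apply: (cvge_ge _ h); apply: nearW => k; rewrite leNgt; apply/negP => hk.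
  by apply: (H k); rewrite -lee_fin prob_EFin// ltW.
by rewrite lee_fin leNgt e0.
Qed.

Lemma ae_cvg_small (Z : nat -> T -> R) (t e : R) :
  (forall n, measurable_fun [set: T] (Z n)) ->
  (\forall w \ae P, Z n w @[n --> \oo] --> (0 : R)) -> 0 < t -> 0 < e ->
  exists N, fine (P (\bigcup_(k >= N) [set w | t < `|Z k w|])) <= e.
Proof.
move=> mZ [A [mA A0 hA]] t0 e0.
have mF n : measurable [set w | t < `|Z n w|].
  by apply: measurable_gt; exact: measurableT_comp.
apply: lim_sup_set_small => //.
apply: (@subset_measure0 _ _ _ P _ A) => //.
  by apply: bigcapT_measurable => n; exact: bigcup_measurable.
move=> w hw; apply: hA => /= /cvgr0Pnorm_le /(_ t t0) [N _ hN].
have [k /= Nk] := hw N I.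
by rewrite ltNge => /negP; apply; exact: hN.
Qed.

Lemma prob_gt_nat_small (f : T -> R) (e : R) : measurable_fun [set: T] f -> 0 < e ->
  exists N : nat, fine (P [set w | N%:R < `|f w|]) <= e.
Proof.
move=> mf e0; pose F (n : nat) := [set w | n%:R < `|f w|].
have mF n : measurable (F n) by apply: measurable_gt; exact: measurableT_comp.
have F0 : P (lim_sup_set F) = 0%E.
  rewrite (_ : lim_sup_set F = set0) ?measure0//.
  rewrite -subset0 => w /(_ (Num.truncn `|f w|).+1 I)[k /= fk].
  rewrite /F/= ltNge => /negP; apply.
  by rewrite ltW// (lt_le_trans (truncnS_gt _))// ler_nat.
have [N hN] := lim_sup_set_small mF F0 e0.
exists N; apply: le_trans hN; apply: prob_le.
- exact: (mF N).
- exact: bigcup_measurable.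
by move=> w Fw; exists N => //=.
Qed.

Variable X : nat -> T -> R.
Hypothesis mX : forall i, measurable_fun [set: T] (X i).
Hypothesis idX : forall i B, measurable B -> P (X i @^-1` B) = P (X 0%N @^-1` B).
Hypothesis indepX : forall (J : {fset nat}) (B : nat -> set R),
  (forall j, j \in J -> measurable (B j)) ->
  P (\bigcap_(j in [set` J]) (X j @^-1` B j)) =
  (\prod_(j <- J) P (X j @^-1` B j))%E.

Lemma tails_moment (K C : R) (N : nat) : 0 < K ->
  (forall n, \sum_(N <= i < n) fine (P [set w | phi i%:R < `|K * X 0%N w|]) <= C) ->
  (\int[P]_w (expW `|X 0%N w|)%:E < +oo)%E.
Proof.
move=> K0 h; have mK : measurable_fun [set: T] (fun w => K * X 0%N w).
  exact: measurable_funM.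
have mA i : measurable [set w | phi i%:R < `|K * X 0%N w|].
  by apply: measurable_gt; exact: measurableT_comp.
have C0 : 0 <= C by rewrite (le_trans _ (h 0%N))// big_geq.
have iK : (\int[P]_w (expW `|K * X 0%N w|)%:E < +oo)%E.
  apply: (@tail_moment _ _ _ _ _ (N%:R + C)) => // n.
  have N1 m : \sum_(0 <= i < m) fine (P [set w | phi i%:R < `|K * X 0%N w|]) <= m%:R.
    elim: m => [|m IH]; first by rewrite big_geq.
    rewrite big_nat_recr//= -natr1 lerD// -lee_fin prob_EFin//.
    exact: probability_le1.
  have [nN|Nn] := leqP n N.
    by rewrite (le_trans (N1 n))// (@le_trans _ _ N%:R) ?ler_nat// lerDl.
  by rewrite (big_cat_nat (leq0n N) (ltnW Nn))/= lerD.
have Ki : 0 < K^-1 by rewrite invr_gt0.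
have := moment_scale mK Ki iK.
by under eq_integral do rewrite mulKf ?gt_eqF//.
Qed.

(** The common converse. The row length [M n] is free beyond [n], since later terms are independent
    of the n-th one just as earlier ones are. Almost sure convergence makes the union [A] of the
    late events [1 < |Z j|] rare, and the second-moment bound inside [A] keeps the total probability
    of large diagonal terms bounded. *)
Lemma ae_cvg_lincomb_moment (M : nat -> nat) (a : nat -> nat -> R) (b : nat -> R)
    (c C : R) (n0 : nat) : 0 < c ->
  (forall n, (n0 <= n)%N -> (n < M n)%N) ->
  (forall n, (n0 <= n)%N -> c <= `|a n n| * phi n%:R <= C) ->
  (\forall w \ae P, lincomb X (index_iota 0 (M n)) (a n) (b n) w @[n --> \oo] --> (0 : R)) ->
  (\int[P]_w (expW `|X 0%N w|)%:E < +oo)%E.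
Proof.
move=> c0 nM hc hZ; pose r n := index_iota 0 (M n).
pose Z n := lincomb X (r n) (a n) (b n).
have mZ n : measurable_fun [set: T] (Z n) by exact: measurable_lincomb.
(* With [P A <= 1/16] the bound [s <= 4 * (s + 1) * P A] gives [s <= 1]; moreover
   [1/16 + 1/4 <= 1/2], as [small_rest_prob] requires. *)
have q16 : 0 < 16^-1 :> R by rewrite invr_gt0.
have q4 : 0 < 4^-1 :> R by rewrite invr_gt0.
have [N1 hN1] := ae_cvg_small mZ hZ ltr01 q16.
have [k hk] := prob_gt_nat_small (mX 0%N) q4.
have ur n : uniq (r n) by exact: iota_uniq.
(* The last two entries ensure [0 < phi n] and [C * k <= phi n]; by the latter, the n-th term
   exceeds 1 only where the variable exceeds [k] in modulus. *)
pose N := maxn (maxn N1 n0) (maxn 1 (Num.truncn (expR (C * k%:R)))).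
pose A := \bigcup_(j >= N1) [set w | 1 < `|Z j w|].
have mZ1 j : measurable [set w | 1 < `|Z j w|].
  by apply: measurable_gt; exact: measurableT_comp.
have mA : measurable A by exact: bigcup_measurable.
pose E n := big_term X 1 (a n) n.
pose G n := small_rest X 1 (r n) (a n) (b n) n.
have mE n : measurable (E n) by exact: measurable_abs_coef.
have mG n : measurable (G n) by exact: measurable_small_rest.
have nr n : (N <= n)%N -> n \in r n.
  move=> Nn; rewrite mem_index_iota/= nM//.
  by rewrite (leq_trans _ Nn)// /N leq_max leq_max leqnn orbT.
have hcn n : (N <= n)%N -> c <= `|a n n| * phi n%:R <= C.
  by move=> Nn; apply: hc; rewrite (leq_trans _ Nn)// /N !leq_max leqnn orbT.
have phi0 n : (N <= n)%N -> 0 < phi (n%:R : R).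
  move=> Nn; rewrite phi_gt0// ltr0n (leq_trans _ Nn)// /N !leq_max leqnn.
  by rewrite orbT.
have phiN n : (N <= n)%N -> C * k%:R <= phi (n%:R : R).
  move=> Nn; have h : (Num.truncn (expR (C * k%:R)) <= n)%N.
    by rewrite (leq_trans _ Nn)// /N !leq_max leqnn !orbT.
  rewrite truncn_le_nat in h; rewrite /phi natr1.
  have h1 : C * k%:R <= ln n.+1%:R.
    by rewrite -[leLHS]expRK ler_ln ?posrE ?expR_gt0// ltW.
  rewrite (le_trans h1)// ler_peMl ?ln_ge0 ?ler1n//.
have single n : (N <= n)%N -> fine (P [set w | 1 < `|a n n * X n w|]) <= 4^-1.
  move=> Nn; apply: le_trans hk.
  have -> : P [set w | 1 < `|a n n * X n w|] = P [set w | 1 < `|a n n * X 0%N w|].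
    apply: (idX n (B := [set x | 1 < `|a n n * x|])).
    exact: coef_set_measurable.
  apply: prob_le.
  - exact: measurable_abs_coef.
  - by apply: measurable_gt; exact: measurableT_comp.
  move=> w /=; rewrite normrM => h.
  have /andP[_ hC] := hcn n Nn.
  have p0 := phi0 n Nn; rewrite ltNge; apply/negP => Xk.
  have C0 : 0 <= C by rewrite (le_trans _ hC)// mulr_ge0// ltW.
  have h1 : `|a n n| * `|X 0%N w| * phi n%:R <= C * k%:R.
    by rewrite mulrAC ler_pM// mulr_ge0// ltW.
  have h2 : phi n%:R < `|a n n| * `|X 0%N w| * phi n%:R.
    by rewrite ltr_pMl.
  by have := lt_le_trans h2 (le_trans h1 (phiN n Nn)); rewrite ltxx.
have Zsmall n : (N <= n)%N -> fine (P [set w | 1 < `|Z n w|]) <= 16^-1.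
  move=> Nn; apply: (@le_trans _ _ (fine (P A))); last exact: hN1.
  apply: prob_le => // w Zw; exists n => //=.
  by rewrite (leq_trans _ Nn)// /N !leq_max leqnn.
have G2 n : (N <= n)%N -> 1 <= 2 * fine (P (G n)).
  move=> Nn; apply: small_rest_prob => //; first exact: nr.
  have := single n Nn; have := Zsmall n Nn; rewrite -/(Z n); lra.
(* The 3 is the level of [big_term] at [t = 1]: [c <= |a i i| * phi i] and [phi i < c / 3 * |X|]
   give [3 < |a i i * X|]. *)
apply: (@tails_moment (c / 3) 1 N); first by rewrite divr_gt0.
move=> m; pose q := index_iota N m.
have qN i : i \in q -> (N <= i)%N by rewrite mem_index_iota => /andP[].
have := @second_moment_union _ _ _ P q E G A (iota_uniq _ _) mE mG mA
  (fun i j => @big_term_pairwise _ _ _ _ _ mX indepX 1 a i j).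
have EG i : i \in q -> P (E i `&` G i) = (P (E i) * P (G i))%E.
  by move=> /qN Ni; apply: big_term_indep => //; exact: nr.
have GG i : i \in q -> 1 <= 2 * fine (P (G i)) by move=> /qN; exact: G2.
have EGA i : i \in q -> E i `&` G i `<=` A.
  move=> /qN Ni w hw; exists i => /=.
    by rewrite (leq_trans _ Ni)// /N !leq_max leqnn.
  exact: (big_term_sub (ur i) (nr i Ni) hw).
move=> /(_ EG GG EGA); cbv zeta; set s := \sum_(i <- q) _ => hs.
have s0 : 0 <= s by apply: sumr_ge0 => i _; exact: prob_ge0.
have PA : fine (P A) <= 16^-1 by exact: hN1.
apply: (@le_trans _ _ s); last first.
  have : 4 * (s + 1) * fine (P A) <= 4 * (s + 1) * 16^-1.
    by rewrite ler_wpM2l// mulr_ge0// addr_ge0.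
  lra.
rewrite /s /q !big_nat; apply: ler_sum => i /andP[Ni _].
have -> : P (E i) = P [set w | 3 * 1 < `|a i i * X 0%N w|].
  apply: (idX i (B := [set x | 3 * 1 < `|a i i * x|])).
  exact: coef_set_measurable.
apply: prob_le.
- exact: measurable_abs_coef.
- exact: measurable_abs_coef.
have c3 : 0 <= c / 3 by rewrite divr_ge0// ltW.
move=> w /=; rewrite (normrM (c / 3)) (normrM (a i i)) mulr1 (ger0_norm c3) => h.
have /andP[ca _] := hcn i Ni; have p0 := phi0 i Ni.
have h1 : c * `|X 0%N w| <= `|a i i| * phi i%:R * `|X 0%N w| by rewrite ler_wpM2r.
rewrite -(ltr_pM2r p0); lra.
Qed.

End AlmostSureConverse.

(** The minimum [f] is nonincreasing from index 1 on, and its sum past some [N] is at most 1/4. For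
    [i >= 2 * N + 2] at least half of the indices up to [i] lie in that tail, so [i * f i <= 1/2]
    and the minimum must be [p i]. *)
Lemma min_inv_summable (R : realType) (p : nat -> R) (C : R) :
  (forall n, 0 <= p n) -> (forall n, p n.+1 <= p n) ->
  (forall n, \sum_(0 <= i < n) Num.min i%:R^-1 (p i) <= C) ->
  exists N, forall n, \sum_(N <= i < n) p i <= C.
Proof.
move=> p0 pS hC; pose f i := Num.min i%:R^-1 (p i).
have f0 i : 0 <= f i by rewrite le_min invr_ge0 ler0n p0.
have ndp : nonincreasing_seq p by apply/nonincreasing_seqP.
have fle i n : (0 < i)%N -> (i <= n)%N -> f n <= f i.
  move=> i0 ni; rewrite /f le_min !ge_min ndp// orbT andbT.
  by rewrite lef_pV2 ?posrE ?ltr0n ?(leq_trans i0)// ler_nat ni.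
have q4 : 0 < 4^-1 :> R by rewrite invr_gt0.
have [N hN] := nneg_series_tail f0 hC q4.
exists (N + N).+2 => n.
have pf i : ((N + N).+2 <= i)%N -> p i = f i.
  move=> Ni; have i0 : 0 < i%:R :> R by rewrite ltr0n; lia.
  have h : (i - N.+1)%:R * f i <= 4^-1.
    apply: le_trans (hN i); apply: (@le_trans _ _ (\sum_(N.+1 <= j < i) f i)).
      by rewrite big_const_nat iter_addr_0 mulr_natl.
    apply: (@le_trans _ _ (\sum_(N.+1 <= j < i) f j)).
      by rewrite !big_nat; apply: ler_sum => j /andP[Nj ji]; rewrite fle//; lia.
    rewrite [leRHS]big_ltn; last lia.
    by rewrite lerDr.
  have h2 : i%:R <= 2 * (i - N.+1)%:R :> R by rewrite -natrM ler_nat; lia.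
  have : i%:R * f i <= 2^-1.
    have : i%:R * f i <= 2 * (i - N.+1)%:R * f i by rewrite ler_wpM2r.
    lra.
  rewrite -ler_pdivlMl// => h3; apply/eqP; rewrite eq_sym /f minEge.
  case: ifP => // h4; exfalso; move: h3; rewrite /f minEge h4.
  rewrite -[leLHS]mulr1 ler_pM2l ?invr_gt0//; lra.
apply: le_trans (hC n); apply: (@le_trans _ _ (\sum_((N + N).+2 <= i < n) f i)).
  by rewrite !big_nat; apply: ler_sum => i /andP[/pf -> _].
have [h|h] := leqP n (N + N).+2; first by rewrite big_geq//; apply: sumr_ge0 => i _; exact: f0.
rewrite [leRHS](big_cat_nat (leq0n (N + N).+2) (ltnW h))/= lerDr.
by apply: sumr_ge0 => i _; exact: f0.
Qed.

Section CompleteConvergenceMoment.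
Context d (T : measurableType d) (R : realType) (P : probability T R).
Variable X : nat -> T -> R.
Hypothesis mX : forall i, measurable_fun [set: T] (X i).
Hypothesis idX : forall i B, measurable B -> P (X i @^-1` B) = P (X 0%N @^-1` B).
Hypothesis indepX : forall (J : {fset nat}) (B : nat -> set R),
  (forall j, j \in J -> measurable (B j)) ->
  P (\bigcap_(j in [set` J]) (X j @^-1` B j)) =
  (\prod_(j <- J) P (X j @^-1` B j))%E.

(** If the deviation probability [Q] exceeds 1/8, then [1 / n <= 8 * Q / n]. Otherwise, with
    [s = n * p], the second-moment bound [s <= 4 * (s + 1) * Q] first gives [s <= 1] and then
    [s <= 8 * Q]. *)
Lemma sum_exceeds_single (t : R) (n : nat) (b : R) :
  0 <= t -> (0 < n)%N -> fine (P [set w | t < `|X 0%N w|]) <= 4^-1 ->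
  Num.min n%:R^-1 (fine (P [set w | 3 * t < `|X 0%N w|])) <=
  8 * (n%:R^-1 * fine (P [set w | t < `|lincomb X (index_iota 1 n.+1) (fun=> 1) b w|])).
Proof.
move=> t0 n0 ht; set Q := fine (P [set w | t < `|lincomb _ _ _ _ w|]).
set p := fine (P [set w | 3 * t < `|X 0%N w|]).
have nn0 : 0 < n%:R :> R by rewrite ltr0n.
have [hQ|hQ] := ltP 8^-1 Q.
  rewrite ge_min; apply/orP; left; rewrite mulrCA ler_peMr ?invr_ge0//; lra.
rewrite ge_min; apply/orP; right.
pose r := index_iota 1 n.+1.
have ur : uniq r by exact: iota_uniq.
pose E i := big_term X t (fun=> 1) i.
pose G i := small_rest X t r (fun=> 1) b i.
have mE i : measurable (E i) by exact: measurable_abs_coef.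
have mG i : measurable (G i) by exact: measurable_small_rest.
pose A := [set w | t < `|lincomb X r (fun=> 1) b w|].
have mA : measurable A.
  by apply: measurable_gt; apply: measurableT_comp => //; exact: measurable_lincomb.
have PE i : P (E i) = P [set w | 3 * t < `|X 0%N w|].
  rewrite -(prob_gt_id idX _ i) /E /big_term.
  by under eq_set do rewrite mul1r.
have EG i : i \in r -> P (E i `&` G i) = (P (E i) * P (G i))%E.
  by move=> ir; exact: big_term_indep.
have GG i : i \in r -> 1 <= 2 * fine (P (G i)).
  move=> ir; apply: small_rest_prob => //.
  have -> : P [set w | t < `|1 * X i w|] = P [set w | t < `|X 0%N w|].
    by under eq_set do rewrite mul1r; rewrite (prob_gt_id idX).
  by rewrite -/Q; lra.
have EGA i : i \in r -> E i `&` G i `<=` A.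
  by move=> ir; exact: big_term_sub.
have := @second_moment_union _ _ _ P r E G A ur mE mG mA
  (fun i j => @big_term_pairwise _ _ _ _ _ mX indepX t (fun _ _ => 1) i j) EG GG EGA.
rewrite (_ : \sum_(i <- r) fine (P (E i)) = n%:R * p).
  cbv zeta => h; rewrite -(ler_pM2l nn0).
  have p0 : 0 <= p by exact: prob_ge0.
  have np0 : 0 <= n%:R * p by rewrite mulr_ge0.
  have -> : n%:R * (8 * (n%:R^-1 * Q)) = 8 * Q by field; rewrite gt_eqF.
  have Q0 : 0 <= Q by exact: prob_ge0.
  rewrite -/Q in h.
  have s1 : n%:R * p <= 1.
    have : 4 * (n%:R * p + 1) * Q <= 4 * (n%:R * p + 1) * 8^-1.
      by rewrite ler_wpM2l// mulr_ge0// addr_ge0.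
    lra.
  have : 4 * (n%:R * p + 1) * Q <= 8 * Q by rewrite ler_wpM2r//; lra.
  lra.
rewrite (eq_bigr (fun=> p)); last by move=> i _; rewrite PE.
by rewrite big_const_nat iter_addr_0 subn1/= mulr_natl.
Qed.

(** From [n1] on [P (phi n < |X 0|) <= 1/4], as [sum_exceeds_single] demands; the earlier terms add
    at most [n1]. The factor 3 in the tail is undone by [tails_moment] at scale [3^-1]. *)
Lemma complete_convergence_moment (b : nat -> nat -> R) :
  (\sum_(1 <= n <oo) (n%:R^-1)%:E *
    P [set w | (phi n%:R < `|\sum_(1 <= i < n.+1) (X i w - b n i)|)%R] < +oo)%E ->
  (\int[P]_w (expW `|X 0%N w|)%:E < +oo)%E.
Proof.
move=> h; pose B n := - \sum_(1 <= i < n.+1) b n i.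
pose Q n := fine (P [set w | phi n%:R < `|lincomb X (index_iota 1 n.+1) (fun=> 1) (B n) w|]).
have SE n w : \sum_(1 <= i < n.+1) (X i w - b n i) =
    lincomb X (index_iota 1 n.+1) (fun=> 1) (B n) w.
  by rewrite big_split/= sumrN /lincomb; under [in RHS]eq_bigr do rewrite mul1r.
have mQ n : measurable [set w | phi n%:R < `|lincomb X (index_iota 1 n.+1) (fun=> 1) (B n) w|].
  by apply: measurable_gt; apply: measurableT_comp => //; exact: measurable_lincomb.
have Q0 n : 0 <= n%:R^-1 * Q n by rewrite mulr_ge0 ?invr_ge0 ?prob_ge0.
have hE n : ((n%:R^-1)%:E *
    P [set w | (phi n%:R < `|\sum_(1 <= i < n.+1) (X i w - b n i)|)%R])%E =
    (n%:R^-1 * Q n)%:E.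
  by under eq_set do rewrite SE; rewrite EFinM /Q prob_EFin.
rewrite (eq_eseriesr (fun n _ => hE n)) in h.
have hfin : (\sum_(1 <= n <oo) (n%:R^-1 * Q n)%:E \is a fin_num)%E.
  by rewrite ge0_fin_numE//; apply: nneseries_ge0 => n _ _; rewrite lee_fin.
pose C := fine (\sum_(1 <= n <oo) (n%:R^-1 * Q n)%:E)%E.
have hC m : \sum_(1 <= n < m) n%:R^-1 * Q n <= C.
  rewrite -lee_fin /C fineK// -sumEFin.
  by apply: nneseries_lim_ge => n _ _; rewrite lee_fin.
have q4 : 0 < 4^-1 :> R by rewrite invr_gt0.
have [k hk] := prob_gt_nat_small P (mX 0%N) q4.
pose n1 := (Num.truncn (expR (k%:R : R))).+1.
have phik n : (n1 <= n)%N -> k%:R <= phi n%:R :> R.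
  move=> nn; have : (Num.truncn (expR (k%:R : R)) <= n)%N := ltnW nn.
  rewrite truncn_le_nat /phi natr1 => h1.
  have h2 : k%:R <= ln n.+1%:R :> R.
    by rewrite -[leLHS]expRK ler_ln ?posrE ?expR_gt0// ltW.
  by rewrite (le_trans h2)// ler_peMl ?ln_ge0 ?ler1n.
have mX0 c : measurable [set w | c < `|X 0%N w|].
  by apply: measurable_gt; exact: measurableT_comp.
pose p n := fine (P [set w | 3 * phi n%:R < `|X 0%N w|]).
have p0 n : 0 <= p n by exact: prob_ge0.
have pS n : p n.+1 <= p n.
  apply: prob_le => // w /=; apply: le_lt_trans; rewrite ler_pM2l//.
  by rewrite ltW// phi_lt// ltr_nat.
have fle n : (n1 <= n)%N -> Num.min n%:R^-1 (p n) <= 8 * (n%:R^-1 * Q n).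
  move=> nn; apply: sum_exceeds_single.
  - by rewrite phi_ge0.
  - by rewrite (leq_trans _ nn).
  - apply: le_trans hk; apply: prob_le => // w /=.
    by apply: le_lt_trans; exact: phik.
have f1 i : Num.min i%:R^-1 (p i) <= 1.
  rewrite ge_min; case: i => [|i]; first by rewrite invr0 ler01.
  by rewrite invf_le1 ?ltr0n// ler1n.
have f0 i : 0 <= Num.min i%:R^-1 (p i) by rewrite le_min invr_ge0 ler0n p0.
have fC n : \sum_(0 <= i < n) Num.min i%:R^-1 (p i) <= n1%:R + 8 * C.
  have C0 : 0 <= C by rewrite (le_trans _ (hC 0%N))// big_geq.
  have N1 m : \sum_(0 <= i < m) Num.min i%:R^-1 (p i) <= m%:R.
    elim: m => [|m IH]; first by rewrite big_geq.
    by rewrite big_nat_recr//= -natr1 lerD.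
  have [nN|Nn] := leqP n n1.
    by rewrite (le_trans (N1 n))// (@le_trans _ _ n1%:R) ?ler_nat// lerDl mulr_ge0.
  rewrite (big_cat_nat (leq0n n1) (ltnW Nn))/= lerD//.
  apply: (@le_trans _ _ (\sum_(n1 <= i < n) 8 * (i%:R^-1 * Q i))).
    by rewrite !big_nat; apply: ler_sum => i /andP[/fle].
  rewrite -mulr_sumr ler_pM2l//; apply: le_trans (hC n).
  rewrite [leRHS](big_cat_nat (n := n1))//=; last exact: ltnW.
  by rewrite lerDr; apply: sumr_ge0 => i _; exact: Q0.
have [N hN] := min_inv_summable p0 pS fC.
apply: (@tails_moment _ _ _ P X mX 3^-1 (n1%:R + 8 * C) N); first by rewrite invr_gt0.
move=> n; apply: le_trans (hN n); apply: ler_sum => i _.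
apply: prob_le => //.
  by apply: measurable_gt; apply: measurableT_comp => //; exact: measurable_funM.
move=> w /=; rewrite normrM gtr0_norm ?invr_gt0// => hw; lra.
Qed.

End CompleteConvergenceMoment.

Lemma eq_cvgn (R : realType) (f g : nat -> R) (l : R) :
  (forall n, f n = g n) -> f n @[n --> \oo] --> l -> g n @[n --> \oo] --> l.
Proof. by move=> /funext ->. Qed.

Lemma ln_succ_le (R : realType) (n : nat) : (1 < n)%N -> ln n.+1%:R <= 2 * ln n%:R :> R.
Proof.
move=> n1; rewrite mulr2n mulrDl mul1r -lnM ?posrE ?ltr0n; [|lia|lia].
rewrite ler_ln ?posrE -?natrM ?ltr0n ?ler_nat//; nia.
Qed.

(** * From the means of the centered sequence to the moment condition *)

Section CenteredMeans.
Context d (T : measurableType d) (R : realType) (P : probability T R).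
Variable X : nat -> T -> R.
Hypothesis mX : forall i, measurable_fun [set: T] (X i).
Hypothesis idX : forall i B, measurable B -> P (X i @^-1` B) = P (X 0%N @^-1` B).
Hypothesis indepX : forall (J : {fset nat}) (B : nat -> set R),
  (forall j, j \in J -> measurable (B j)) ->
  P (\bigcap_(j in [set` J]) (X j @^-1` B j)) =
  (\prod_(j <- J) P (X j @^-1` B j))%E.
Variable mu : nat -> R.
Let s w i := if i == 0%N then 0 else X i w - mu i.
Let moment := (\int[P]_w (expW `|X 0%N w|)%:E < +oo)%E.

(** The coefficient of index 0 is set to 0 because the centered sequence starts with 0 instead of a
    random variable. *)
Lemma centered_lincomb (a : nat -> R) M w :
  \sum_(0 <= i < M) a i * s w i =
  lincomb X (index_iota 0 M) (fun i => if i == 0%N then 0 else a i)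
    (- \sum_(0 <= i < M) (if i == 0%N then 0 else a i * mu i)) w.
Proof.
rewrite /lincomb -sumrN -big_split/=; apply: eq_bigr => i _; rewrite /s.
by case: eqP => _; rewrite ?mulr0 ?mul0r ?subr0// mulrBr.
Qed.

Lemma ae_cvg_weighted_moment (M : nat -> nat) (a : nat -> nat -> R) (c C : R) (n0 : nat) :
  0 < c -> (0 < n0)%N -> (forall n, (n0 <= n)%N -> (n < M n)%N) ->
  (forall n, (n0 <= n)%N -> c <= `|a n n| * phi n%:R <= C) ->
  (\forall w \ae P, (\sum_(0 <= i < M n) a n i * s w i) @[n --> \oo] --> (0 : R)) ->
  moment.
Proof.
move=> c0 n00 nM hc h.
apply: (ae_cvg_lincomb_moment mX idX indepX (M := M)
  (a := fun n i => if i == 0%N then 0 else a n i)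
  (b := fun n => - \sum_(0 <= i < M n) (if i == 0%N then 0 else a n i * mu i)) c0 nM (C := C)).
  by move=> n nn; rewrite gtn_eqF ?hc// (leq_trans n00).
apply: filterS h => w; apply: eq_cvgn => n.
exact: centered_lincomb.
Qed.

Lemma ratio_moment :
  (\forall w \ae P, X n w / (n%:R * ln n%:R) @[n --> \oo] --> (0 : R)) -> moment.
Proof.
(* A linear combination with one nonzero coefficient. For [n >= 2], [phi n] lies between [n * ln n]
   and [2 * n] times [2 * ln n], whence the constants 1 and 4. *)
move=> h; apply: (ae_cvg_lincomb_moment mX idX indepX (M := fun n => n.+1)
  (a := fun n i => if i == n then (n%:R * ln n%:R)^-1 else 0) (b := fun=> 0)
  (c := 1) (C := 4) (n0 := 2)) => //.
- move=> n n2; rewrite eqxx.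
  have l0 : 0 < ln n%:R :> R by rewrite ln_gt0// ltr1n.
  have n0 : 0 < n%:R :> R by rewrite ltr0n; lia.
  have ln1 : ln n%:R <= ln n.+1%:R :> R by rewrite ler_ln ?posrE// ler_nat.
  have ln2 := ln_succ_le R n2.
  have p0 : 0 < n%:R * ln n%:R :> R by rewrite mulr_gt0.
  rewrite gtr0_norm ?invr_gt0// /phi natr1 ler_pdivlMl// ler_pdivrMl// mulr1.
  apply/andP; split; first by rewrite ler_pM// ?(ltW l0)// ler_nat.
  rewrite (_ : n%:R * ln n%:R * 4 = (n%:R * 2) * (2 * ln n%:R)); last by ring.
  by rewrite ler_pM ?ln_ge0 ?ler1n// -natrM ler_nat; lia.
- apply: filterS h => w; apply: eq_cvgn => n.
  rewrite /lincomb addr0 big_nat_recr; last by [].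
  rewrite eqxx mulrC big1_seq; first by rewrite /= add0r.
  move=> i /andP[_]; rewrite mem_index_iota => /andP[_ ni].
  by rewrite ltn_eqF// mul0r.
Qed.

(** The diagonal coefficient times [phi n] is [ln n.+1 / ln n], between 1 and 2 for [n >= 2]. *)
Lemma ell_moment : (\forall w \ae P, summable_ell (s w) 0) -> moment.
Proof.
move=> h; apply: (@ae_cvg_weighted_moment (fun n => n.+1)
  (fun n i => (ln n%:R)^-1 / i.+1%:R) 1 2 2) => //.
  move=> n n2; have l0 : 0 < ln n%:R :> R by rewrite ln_gt0// ltr1n.
  rewrite ger0_norm ?divr_ge0 ?invr_ge0 ?(ltW l0)// /phi natr1 -mulrA mulKf//.
  rewrite ler_pdivlMl// ler_pdivrMl// mulr1 [ln _ * 2]mulrC ln_succ_le// andbT.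
  by rewrite ler_ln ?posrE ?ltr0n ?ler_nat//; lia.
apply: filterS h => w; rewrite /summable_ell; apply: eq_cvgn => n.
by rewrite mulr_sumr; apply: eq_bigr => i _; rewrite mulrCA mulrC.
Qed.

(** For [n >= 2] the index [n] lies in its own window, so the diagonal coefficient is that of the
    plain logarithmic mean. *)
Lemma calL_moment lambda : 1 < lambda ->
  (\forall w \ae P, summable_calL lambda (s w) 0) -> moment.
Proof.
move=> l1 h; apply: (@ae_cvg_weighted_moment (fun n => n.+1)
  (fun n i => if n%:R `^ lambda^-1 < i%:R then (ln n%:R)^-1 / i.+1%:R else 0) 1 2 2) => //.
  move=> n n2; have l0 : 0 < ln n%:R :> R by rewrite ln_gt0// ltr1n.
  have n1 : 1 < n%:R :> R by rewrite ltr1n.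
  have -> : n%:R `^ lambda^-1 < n%:R :> R.
    have n0 : 0 < n%:R :> R by exact: lt_trans n1.
    rewrite -ltr_ln ?posrE ?powR_gt0// ln_powR gtr_pMl// invf_lt1//.
    exact: lt_trans l1.
  rewrite ger0_norm ?divr_ge0 ?invr_ge0 ?(ltW l0)// /phi natr1 -mulrA mulKf//.
  rewrite ler_pdivlMl// ler_pdivrMl// mulr1 [ln _ * 2]mulrC ln_succ_le// andbT.
  by rewrite ler_ln ?posrE ?ltr0n ?ler_nat//; lia.
apply: filterS h => w; rewrite /summable_calL mulr0.
apply: eq_cvgn => n; rewrite mulr_sumr big_mkcond/=; apply: eq_bigr => i _.
by case: ifP => _; rewrite ?mul0r// mulrCA mulrC.
Qed.

Lemma phi_mean_moment :
  (\forall w \ae P, (phi n%:R)^-1 * (\sum_(1 <= i < n.+1) (X i w - mu i))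
     @[n --> \oo] --> (0 : R)) -> moment.
Proof.
move=> h; apply: (@ae_cvg_weighted_moment (fun n => n.+1)
  (fun n i => (phi n%:R)^-1) 1 1 1) => //.
  move=> n n1; have p0 : 0 < phi n%:R :> R by rewrite phi_gt0// ltr0n.
  by rewrite gtr0_norm ?invr_gt0// mulVf ?gt_eqF// lexx.
apply: filterS h => w; apply: eq_cvgn => n.
rewrite mulr_sumr [RHS]big_ltn//= mulr0 add0r !big_nat; apply: eq_bigr => i /andP[i1 _].
by rewrite /s gtn_eqF.
Qed.

Lemma phi_block_moment (beta : R) : 1 < beta ->
  (\forall w \ae P, (phi n%:R)^-1 *
     (\sum_(1 <= i < n.+1 | phi_inv (beta^-1 * phi n%:R) < i%:R) (X i w - mu i))
     @[n --> \oo] --> (0 : R)) -> moment.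
Proof.
move=> b1 h; apply: (@ae_cvg_weighted_moment (fun n => n.+1)
  (fun n i => if phi_inv (beta^-1 * phi n%:R) < i%:R then (phi n%:R)^-1 else 0) 1 1 1) => //.
  move=> n n1; have p0 : 0 < phi n%:R :> R by rewrite phi_gt0// ltr0n.
  have b0 : 0 < beta by rewrite (lt_trans _ b1).
  have [q0 qE] : 0 <= phi_inv (beta^-1 * phi (n%:R : R)) /\
      phi (phi_inv (beta^-1 * phi n%:R)) = beta^-1 * phi (n%:R : R).
    by apply: phi_invP; rewrite mulr_ge0 ?invr_ge0 ?(ltW b0) ?(ltW p0).
  (* [phi_inv_itv] gives only a weak inequality; equality would make [beta^-1 * phi n] equal to the
     positive [phi n], against [1 < beta]. *)
  have -> : phi_inv (beta^-1 * phi n%:R) < n%:R :> R.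
    have /andP[_] := phi_inv_itv b1 (ler0n R n).
    rewrite le_eqVlt => /predU1P[E|//]; move: qE; rewrite E => /eqP.
    by rewrite -[X in X == _]mul1r (inj_eq (mulIf (lt0r_neq0 p0))) eq_sym invr_eq1 gt_eqF.
  by rewrite gtr0_norm ?invr_gt0// mulVf ?gt_eqF// lexx.
apply: filterS h => w; apply: eq_cvgn => n.
rewrite mulr_sumr [RHS]big_ltn//= mulr0 add0r big_mkcond/= !big_nat.
apply: eq_bigr => i /andP[i1 _]; rewrite /s gtn_eqF//.
by case: ifP => _; rewrite ?mul0r.
Qed.

(** At [x = ln n.+2] the boundary term of [riesz_sum] vanishes and the last surviving index is [n].
    Its coefficient times [phi n] is the product of [n.+1 * (ln n.+2 - ln n.+1)] and
    [ln n.+1 / ln n.+2], each between 1/2 and 1. *)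
Lemma Rlog_moment : (\forall w \ae P, summable_Rlog (s w) 0) -> moment.
Proof.
move=> h; apply: (@ae_cvg_weighted_moment (fun n => n.+1)
  (fun n i => (ln n.+2%:R)^-1 * (ln i.+2%:R - ln i.+1%:R)) 4^-1 1 1) => //.
  move=> n n1; have l2 : 0 < ln n.+2%:R :> R by rewrite ln_gt0// ltr1n.
  have l1 : 0 < ln n.+1%:R :> R by rewrite ln_gt0// ltr1n.
  have l12 : ln n.+1%:R <= ln n.+2%:R :> R by rewrite ler_ln ?posrE// ler_nat.
  have l21 := ln_succ_le R (n1 : (1 < n.+1)%N).
  have k0 : 0 < n.+1%:R :> R by [].
  have w1 : n.+1%:R * (ln n.+2%:R - ln n.+1%:R) <= 1 :> R.
    rewrite mulrC -ler_pdivlMr// -ln_div ?posrE// div1r.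
    rewrite -[X in ln (X / _)]natr1 mulrDl divff// mul1r.
    by apply: le_ln1Dx; rewrite (@lt_le_trans _ _ 0)// ?ltrN10// invr_ge0.
  have w2 : 2^-1 <= n.+1%:R * (ln n.+2%:R - ln n.+1%:R) :> R.
    have hh : ln n.+1%:R - ln n.+2%:R <= - n.+2%:R^-1 :> R.
      rewrite -ln_div ?posrE// (_ : n.+1%:R / n.+2%:R = 1 + - n.+2%:R^-1).
        by apply: le_ln1Dx; rewrite ltrN2 invf_lt1 ?ltr1n.
      have E (z : R) : z + 1 != 0 -> z / (z + 1) = 1 + - (z + 1)^-1 by move=> h0; field.
      by rewrite -(natr1 n.+1) E// natr1 pnatr_eq0.
    apply: (@le_trans _ _ (n.+1%:R * n.+2%:R^-1)); last first.
      by rewrite ler_pM2l// -[leRHS]opprB lerNr.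
    by rewrite ler_pdivlMr// ler_pdivrMl// -natrM ler_nat; lia.
  rewrite ger0_norm; last by rewrite mulr_ge0 ?invr_ge0 ?subr_ge0// ltW.
  rewrite /phi natr1.
  have -> : (ln n.+2%:R)^-1 * (ln n.+2%:R - ln n.+1%:R) * (n.+1%:R * ln n.+1%:R) =
     (ln n.+2%:R)^-1 * ((n.+1%:R * (ln n.+2%:R - ln n.+1%:R)) * ln n.+1%:R) :> R by ring.
  rewrite ler_pdivlMl// ler_pdivrMl// mulr1.
  have : n.+1%:R * (ln n.+2%:R - ln n.+1%:R) * ln n.+1%:R <= 1 * ln n.+1%:R :> R.
    by rewrite ler_wpM2r// ltW.
  have : 2^-1 * ln n.+1%:R <= n.+1%:R * (ln n.+2%:R - ln n.+1%:R) * ln n.+1%:R :> R.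
    by rewrite ler_wpM2r// ltW.
  lra.
apply: filterS h => w [a [sa ha]].
have hln : (ln n.+2%:R : R) @[n --> \oo] --> +oo%R.
  apply/cvgryPge => A; have [n0 hn] := ln_nat_unbounded A.
  by exists n0 => // n /= /hn.
have := cvg_comp _ _ hln ha; apply: eq_cvgn => n /=.
have ln0 : 0 <= ln n.+2%:R :> R by rewrite ln_ge0// ler1n.
rewrite riesz_integral// lnK ?posrE// natrK (riesz_sum _ _ sa) subrr mul0r addr0.
by rewrite mulr_sumr; apply: eq_bigr => i _; rewrite mulrA.
Qed.

End CenteredMeans.

(** * From Abel means to the moment condition *)

Section AbelMeans.
Context d (T : measurableType d) (R : realType) (P : probability T R).
Variable X : nat -> T -> R.
Hypothesis mX : forall i, measurable_fun [set: T] (X i).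
Hypothesis idX : forall i B, measurable B -> P (X i @^-1` B) = P (X 0%N @^-1` B).
Hypothesis indepX : forall (J : {fset nat}) (B : nat -> set R),
  (forall j, j \in J -> measurable (B j)) ->
  P (\bigcap_(j in [set` J]) (X j @^-1` B j)) =
  (\prod_(j <- J) P (X j @^-1` B j))%E.
Variable mu : nat -> R.
Let s w i := if i == 0%N then 0 else X i w - mu i.

(** At this sampling point the normalization [- ln (1 - x n)] is [ln n.+2], and the powers up to
    [x n ^+ n.+1] stay above [expR (- 1)]. *)
Let x n : R := n.+1%:R / n.+2%:R.

Let x_gt0 n : 0 < x n. Proof. by rewrite /x divr_gt0. Qed.

Let x_lt1 n : x n < 1. Proof. by rewrite /x ltr_pdivrMr// mul1r ltr_nat. Qed.

Let onem_x n : 1 - x n = n.+2%:R^-1.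
Proof.
have E (z : R) : z + 1 != 0 -> 1 - z / (z + 1) = (z + 1)^-1 by move=> h0; field.
by rewrite /x -(natr1 n.+1) E// natr1 pnatr_eq0.
Qed.

(** The lower bound rests on [(1 + 1 / n.+1) ^+ n.+1 <= expR 1] and [ln n.+2 <= 2 * ln n.+1]. *)
Lemma abel_coef_bounds n : (0 < n)%N -> expR (- 1) / 2 <=
  `|(ln n.+2%:R)^-1 * (x n ^+ n.+1 / n.+1%:R)| * phi n%:R <= 1.
Proof.
move=> n0; have l2 : 0 < ln n.+2%:R :> R by rewrite ln_gt0// ltr1n.
have l1 : 0 < ln n.+1%:R :> R by rewrite ln_gt0// ltr1n.
have l12 : ln n.+1%:R <= ln n.+2%:R :> R by rewrite ler_ln ?posrE// ler_nat.
have l21 := @ln_succ_le R n.+1 n0.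
have xn0 : 0 < x n ^+ n.+1 by rewrite exprn_gt0.
have xn1 : x n ^+ n.+1 <= 1 by rewrite exprn_ile1// ltW.
have xe : expR (- 1) <= x n ^+ n.+1.
  have h : (x n)^-1 <= expR (n.+1%:R^-1).
    apply: le_trans (expR_ge1Dx _); rewrite /x invf_div -(natr1 n.+1) mulrDl divff//.
    by rewrite div1r.
  have h2 : (x n)^-1 ^+ n.+1 <= expR 1.
    rewrite (_ : expR 1 = expR (n.+1%:R^-1) ^+ n.+1).
      by rewrite ler_pXn2r ?nnegrE ?expR_ge0// invr_ge0 ltW.
    by rewrite -expRM_natl mulfV.
  by rewrite expRN -[leRHS]invrK -exprVn lef_pV2 ?posrE ?expR_gt0// exprn_gt0// invr_gt0.
rewrite gtr0_norm; last by rewrite mulr_gt0 ?invr_gt0// divr_gt0.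
rewrite /phi natr1.
have -> : (ln n.+2%:R)^-1 * (x n ^+ n.+1 / n.+1%:R) * (n.+1%:R * ln n.+1%:R) =
   (ln n.+2%:R)^-1 * (x n ^+ n.+1 * ln n.+1%:R).
  by field; rewrite addrC natr1 pnatr_eq0 gt_eqF.
rewrite ler_pdivlMl// ler_pdivrMl// mulr1.
apply/andP; split; last first.
  by rewrite (le_trans _ l12)// ler_piMl// ltW.
rewrite (_ : ln n.+2%:R * _ = expR (- 1) * (ln n.+2%:R / 2)); last by ring.
by rewrite ler_pM// ?expR_ge0 ?divr_ge0 ?(ltW l2)// ler_pdivrMr// mulrC.
Qed.

Let S n M w : R := \sum_(0 <= i < M) s w i / i.+1%:R * x n ^+ i.+1.
Let G n M := \bigcup_(K >= M) [set w | 1 < `|S n K w - S n M w|].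

Let mS n M : measurable_fun [set: T] (S n M).
Proof.
rewrite /S; elim: M => [|M IH].
  by under eq_fun do rewrite big_geq//; exact: measurable_cst.
under eq_fun do rewrite big_nat_recr//=.
apply: measurable_funD => //; apply: measurable_funM => //.
apply: measurable_funM => //; rewrite /s; case: eqP => _; first exact: measurable_cst.
exact: measurable_funB.
Qed.

Let mG n M : measurable (G n M).
Proof.
apply: bigcup_measurable => K _; apply: measurable_gt.
by apply: measurableT_comp => //; exact: measurable_funB.
Qed.

Lemma geometric_half n : \sum_(0 <= i < n) (2^-1 : R) ^+ i <= 2.
Proof.
have -> : \sum_(0 <= i < n) (2^-1 : R) ^+ i = 2 - 2 * 2^-1 ^+ n.
  elim: n => [|n IH]; first by rewrite big_geq// expr0 mulr1 subrr.
  by rewrite big_nat_recr//= IH exprS; field.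
by rewrite gerBl mulr_ge0// exprn_ge0// invr_ge0.
Qed.

(* Replaces the Abel series at [x n = 1 - 1 / (n + 2)] by a finite sum, to which
   [ae_cvg_weighted_moment] applies. *)
Lemma series_cutoff : (\forall w \ae P, summable_L (s w) 0) ->
  exists M : nat -> nat, (forall n, (n < M n)%N) /\
    \forall w \ae P, exists N, forall n, (N <= n)%N ->
      forall K, (M n <= K)%N -> `|S n K w - S n (M n) w| <= 1.
Proof.
move=> [A [mA A0 hA]].
have G0 n : P (lim_sup_set (G n)) = 0%E.
  apply: (@subset_measure0 _ _ _ P _ A) => //.
    by apply: bigcapT_measurable => N; exact: bigcup_measurable.
  move=> w hw; apply: hA => /= -[hc _].
  have xn : 0 < x n < 1 by rewrite x_gt0 x_lt1.
  have half0 : 0 < 2^-1 :> R by rewrite invr_gt0.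
  have [N _ hN] := (cvgrPdist_lt _ _).1 (hc _ xn) 2^-1 half0.
  have [M /= NM [K /= MK]] := hw N I.
  have hK := hN K (leq_trans NM MK); have hM := hN M NM.
  rewrite ltNge => /negP; apply.
  move: hK hM; rewrite /series/= -/(S n K w) -/(S n M w).
  set l := limn _ => hK hM.
  apply: le_trans (ler_distD l _ _) _; rewrite (distrC _ l); lra.
have q n : 0 < (2^-1 : R) ^+ n by rewrite exprn_gt0// invr_gt0.
(* Convergence of the series at [x n] gives probability 0 to [G n k] for infinitely many [k]; so the
   union over late [k] can be made smaller than a summable sequence in [n]. *)
have /choice[N hN] : forall n, exists N, fine (P (\bigcup_(k >= N) G n k)) <= 2^-1 ^+ n.
  by move=> n; exact: lim_sup_set_small.
(* The maximum with [n.+1] keeps the diagonal term of index [n] inside the cut sum. *)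
exists (fun n => maxn (N n) n.+1); split; first by move=> n; rewrite leq_max ltnSn orbT.
have : \forall w \ae P, exists N0, forall n, (N0 <= n)%N -> ~ G n (maxn (N n) n.+1) w.
  apply: (@borel_cantelli1 _ _ _ _ _ 2) => // n.
  apply: le_trans (geometric_half n); apply: ler_sum => i _.
  apply: le_trans (hN i); apply: prob_le => //; first exact: bigcup_measurable.
  by move=> w Gw; exists (maxn (N i) i.+1) => //=; exact: leq_maxl.
apply: filterS => w [N0 hN0]; exists N0 => n /hN0 nG K MK.
by rewrite leNgt; apply/negP => h; apply: nG; exists K.
Qed.

Lemma abel_moment : (\forall w \ae P, summable_L (s w) 0) ->
  (\int[P]_w (expW `|X 0%N w|)%:E < +oo)%E.
Proof.
move=> h; have [M [nM hM]] := series_cutoff h.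
apply: (@ae_cvg_weighted_moment _ _ _ _ X mX idX indepX mu M
  (fun n i => (ln n.+2%:R)^-1 * (x n ^+ i.+1 / i.+1%:R)) (expR (- 1) / 2) 1 1) => //.
  exact: abel_coef_bounds.
apply: filterS2 hM h => w [N hN] [hc hL].
apply: (@eq_cvgn _ (fun n => (ln n.+2%:R)^-1 * S n (M n) w)).
  move=> n; rewrite /S mulr_sumr; apply: eq_bigr => i _; rewrite /s; ring.
apply/cvgr0Pnorm_le => e e0.
have e20 : 0 < e / 2 by rewrite divr_gt0.
have [dl /= dl0 hdl] := (cvgr0Pnorm_le _).1 hL (e / 2) e20.
have [n1 hn1] := ln_nat_unbounded (e / 2)^-1.
near=> n.
have l0 : 0 < ln n.+2%:R :> R by rewrite ln_gt0// ltr1n.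
have lnx : - ln (1 - x n) = ln n.+2%:R by rewrite onem_x lnV ?posrE// opprK.
have hF : `|(ln n.+2%:R)^-1 * limn [series s w i / i.+1%:R * x n ^+ i.+1]_i| <= e / 2.
  rewrite -lnx; apply: hdl; last exact: x_lt1.
  rewrite /= ger0_norm ?subr_ge0 ?(ltW (x_lt1 n))// onem_x.
  rewrite invf_plt ?posrE// (@lt_trans _ _ n.+1%:R) ?ltr_nat//.
  rewrite -truncn_le_nat; near: n.
  by exists (Num.truncn dl^-1).
have hS : `|limn [series s w i / i.+1%:R * x n ^+ i.+1]_i - S n (M n) w| <= 1.
  have xn : 0 < x n < 1 by rewrite x_gt0 x_lt1.
  have cS : `|S n K w - S n (M n) w| @[K --> \oo] -->
      `|limn [series s w i / i.+1%:R * x n ^+ i.+1]_i - S n (M n) w|.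
    by apply: cvg_norm; apply: cvgB; [exact: hc|exact: cvg_cst].
  apply: cvgr_to_le cS _.
  by exists (M n) => // K /= MK; apply: hN MK; near: n; exists N.
have hl : (ln n.+2%:R)^-1 <= e / 2.
  rewrite invf_ple ?posrE//; apply: hn1; near: n; by exists n1.
set l := limn _ in hF hS.
(* The cutoff error is at most 1 and vanishes after division by [ln n.+2]. *)
have -> : (ln n.+2%:R)^-1 * S n (M n) w = (ln n.+2%:R)^-1 * l -
   (ln n.+2%:R)^-1 * (l - S n (M n) w) by ring.
apply: (le_trans (ler_normB _ _)).
have : `|(ln n.+2%:R)^-1 * (l - S n (M n) w)| <= (ln n.+2%:R)^-1 * 1.
  by rewrite normrM gtr0_norm ?invr_gt0// ler_wpM2l// invr_ge0 ltW.
lra.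
Unshelve. all: by end_near. Qed.

End AbelMeans.

(** * From real to integer parameters *)

Section Restriction.
Context (R : realType).
Implicit Types (s : nat -> R) (l : R).

Lemma fsum_range_cond (A : set nat) (f : nat -> R) (p : pred nat) m n :
  (forall i, A i <-> (m <= i < n)%N && p i) ->
  \sum_(i \in A) f i = \sum_(m <= i < n | p i) f i.
Proof.
move=> AE; rewrite -[RHS]big_filter [RHS]fsbig_seq ?filter_uniq ?iota_uniq//.
apply: eq_fsbigl; apply/seteqP; split=> i /=.
  by rewrite mem_filter mem_index_iota andbC => /AE.
by rewrite mem_filter mem_index_iota andbC => /AE.
Qed.

Lemma summable_ellx_ell s l : summable_ellx s l -> summable_ell s l.
Proof.
move=> h; apply: (cvg_pinfty_nat h) => n; congr (_ * _).
by apply: fsum_range => i /=; rewrite ler_nat ltnS.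
Qed.

Lemma summable_calLx_calL lambda s l :
  summable_calLx lambda s l -> summable_calL lambda s l.
Proof.
move=> h; apply: (cvg_pinfty_nat h) => n; congr (_ * _).
by apply: fsum_range_cond => i /=; rewrite ler_nat ltnS andbC.
Qed.

Lemma phi_mean_nat s l :
  (phi x)^-1 * (\sum_(i \in [set i : nat | (1 : R) <= i%:R <= x]) s i) @[x --> +oo%R] --> l ->
  (phi n%:R)^-1 * (\sum_(1 <= i < n.+1) s i) @[n --> \oo] --> l.
Proof.
move=> h; apply: (cvg_pinfty_nat h) => n; congr (_ * _).
by apply: fsum_range => i /=; rewrite ler_nat ler1n ltnS.
Qed.

Lemma phi_block_nat beta s l :
  (phi x)^-1 * (\sum_(i \in [set i : nat | phi_inv (beta^-1 * phi x) < i%:R <= x]) s i)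
    @[x --> +oo%R] --> l ->
  1 < beta ->
  (phi n%:R)^-1 * (\sum_(1 <= i < n.+1 | phi_inv (beta^-1 * phi n%:R) < i%:R) s i)
    @[n --> \oo] --> l.
Proof.
move=> h b1; apply: (cvg_pinfty_nat h) => n; congr (_ * _).
apply: fsum_range_cond => i /=; rewrite ler_nat ltnS.
case: (posnP i) => [->|i0]/=; last by rewrite andbC.
have /andP[p0 _] := phi_inv_itv b1 (ler0n R n).
by rewrite ltNge p0.
Qed.

End Restriction.

(** * Assembly of the equivalences *)

Section Equivalence.
Context d (T : measurableType d) (R : realType) (P : probability T R).
Variable X : nat -> {RV P >-> R}.
Hypothesis hX : iid X.
Let Y i : T -> R := X i.
Let moment := (\int[P]_w (expW `|Y 0%N w|)%:E < +oo)%E.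

Let mY i : measurable_fun [set: T] (Y i).
Proof. exact: measurable_funP. Qed.

Let idY i (B : set R) : measurable B -> P (Y i @^-1` B) = P (Y 0%N @^-1` B).
Proof. exact: hX.2. Qed.

Let indepY (J : {fset nat}) (B : nat -> set R) :
  (forall j, j \in J -> measurable (B j)) ->
  P (\bigcap_(j in [set` J]) (Y j @^-1` B j)) =
  (\prod_(j <- J) P (Y j @^-1` B j))%E.
Proof. exact: hX.1. Qed.

Lemma trunc_meanE : trunc_mean P (X 0%N) = tmean P Y.
Proof.
apply/funext => y; rewrite /trunc_mean /tmean /Rintegral unlock; congr fine.
apply: eq_integral => w _; congr (_%:E); rewrite indicE /trunc.
case: ifP => h; first by rewrite mem_set// mulr1.
by rewrite memNset ?mulr0//= h.
Qed.

Lemma moment_iff :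
  (('E_P[(fun w => expR (lambertW `|X 0%N w|))%R] < +oo)%E <-> moment) /\
  (('E_P[(fun w => `|X 0%N w| / Num.max (ln `|X 0%N w|) 1)%R] < +oo)%E <-> moment) /\
  (('E_P[(fun w => `|X 0%N w| / (1 + ln_plus `|X 0%N w|))%R] < +oo)%E <-> moment).
Proof.
rewrite unlock.
have mn : measurable_fun [set: T] (fun w => `|Y 0%N w|) by exact: measurableT_comp.
have ml : measurable_fun [set: T] (fun w => ln `|Y 0%N w|).
  exact: measurableT_comp (@measurable_ln R) mn.
have m1 := measurable_expW_norm (mY 0%N).
(* On positive functions the inverse is [expR] of minus [ln], a composition of measurable maps. *)
have mi (f : T -> R) : (forall w, 0 < f w) -> measurable_fun [set: T] f ->
    measurable_fun [set: T] (fun w => (f w)^-1).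
  move=> f0 mf; rewrite (_ : (fun w => _) = expR \o (fun w => - ln (f w))).
    by do 2!apply: measurableT_comp => //; exact: measurableT_comp (@measurable_ln R) mf.
  by apply/funext => w /=; rewrite expRN lnK// posrE.
have m2 : measurable_fun [set: T] (fun w => `|Y 0%N w| / Num.max (ln `|Y 0%N w|) 1).
  apply: measurable_funM => //; apply: mi; last exact: measurable_maxr.
  by move=> w; rewrite lt_max ltr01 orbT.
have m3 : measurable_fun [set: T] (fun w => `|Y 0%N w| / (1 + ln_plus `|Y 0%N w|)).
  apply: measurable_funM => //; apply: mi.
    by move=> w; rewrite ltr_pwDl// /ln_plus le_max lexx orbT.
  by apply: measurable_funD => //; exact: measurable_maxr.
have p1 w : 0 <= expW `|Y 0%N w| by exact: expR_ge0.
have p2 w : 0 <= `|Y 0%N w| / Num.max (ln `|Y 0%N w|) 1.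
  by rewrite divr_ge0// le_max ler01 orbT.
have p3 w : 0 <= `|Y 0%N w| / (1 + ln_plus `|Y 0%N w|).
  by rewrite divr_ge0// addr_ge0// /ln_plus le_max lexx orbT.
have e1 := expR_ge0 (1 : R).
split; first by [].
split; split.
- apply: (integral_lty_le m1 m2 p1 p2 (a := 2) (b := expR 1)) => // w.
  exact: expW_le_ratio.
- apply: (integral_lty_le m2 m1 p2 p1 (a := 1) (b := 0)) => // w.
  by rewrite mul1r addr0 ratio_le_expW.
- apply: (integral_lty_le m1 m3 p1 p3 (a := 4) (b := expR 1)) => // w.
  have := expW_le_ratio (normr_ge0 (Y 0%N w)).
  have := ratio_le_plus (normr_ge0 (Y 0%N w)); lra.
- apply: (integral_lty_le m3 m1 p3 p1 (a := 1) (b := 0)) => // w.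
  rewrite mul1r addr0 (le_trans (ratio_plus_le (normr_ge0 _)))//.
  exact: ratio_le_expW.
Qed.

Lemma moment_log_small : moment -> \forall w \ae P,
  log_small (fun n => \sum_(0 <= i < n.+1) centered X w i / i.+1%:R).
Proof.
move=> h; have := centered_log_small mY idY h indepY.
by apply: filterS => w; rewrite /centered trunc_meanE.
Qed.

Lemma moment_phi_mean : moment -> \forall w \ae P,
  (phi x)^-1 * (\sum_(i \in [set i : nat | (1 : R) <= i%:R <= x])
     (X i w - trunc_mean P (X 0%N) i%:R)) @[x --> +oo%R] --> (0 : R).
Proof.
move=> /moment_log_small; apply: filterS => w hw.
have a0 : \forall x \near +oo, 0 <= (0 : R) <= x.
  by near=> x; rewrite lexx/=; near: x; apply: nbhs_pinfty_ge.
have := weighted_sum_itv hw a0; apply: cvg_trans; apply: near_eq_cvg.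
near=> x; congr (_ * _).
rewrite (_ : [set i : nat | (1 : R) <= i%:R <= x] = [set i : nat | (0 : R) < i%:R <= x]); last first.
  by apply/seteqP; split=> i /=; rewrite ler1n ltr0n.
apply: eq_fsbigr => i; rewrite inE/= ltr0n => /andP[i0 _].
by rewrite /centered gtn_eqF.
Unshelve. all: by end_near. Qed.

Lemma moment_phi_block (beta : R) : moment -> 1 < beta -> \forall w \ae P,
  (phi x)^-1 * (\sum_(i \in [set i : nat | phi_inv (beta^-1 * phi x) < i%:R <= x])
     (X i w - trunc_mean P (X 0%N) i%:R)) @[x --> +oo%R] --> (0 : R).
Proof.
move=> /moment_log_small h b1; apply: filterS h => w hw.
have a0 : \forall x \near +oo, 0 <= phi_inv (beta^-1 * phi x) <= x.
  near=> x; apply: phi_inv_itv => //; near: x; apply: nbhs_pinfty_ge; exact: num_real.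
have := weighted_sum_itv hw a0; apply: cvg_trans; apply: near_eq_cvg.
near=> x; congr (_ * _).
have /andP[p0 _] : 0 <= phi_inv (beta^-1 * phi x) <= x by near: x.
apply: eq_fsbigr => i; rewrite inE/= => /andP[pi _].
by rewrite /centered gtn_eqF// -(ltr0n R) (le_lt_trans p0).
Unshelve. all: by end_near. Qed.

Lemma tail_sum_max (m : nat -> nat -> R) (c : nat -> R) : (forall n, 0 <= c n) ->
  (\sum_(1 <= n <oo) (n%:R^-1)%:E * P [set w | (c n <
     \big[Num.max/0]_(1 <= k < n.+1) `|\sum_(1 <= i < k.+1) (X i w - m n i)|)%R] < +oo)%E ->
  (\sum_(1 <= n <oo) (n%:R^-1)%:E * P [set w | (c n <
     `|\sum_(1 <= i < n.+1) (X i w - m n i)|)%R] < +oo)%E.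
Proof.
move=> c0; apply: le_lt_trans; apply: lee_nneseries => n n1.
  by rewrite mule_ge0// lee_fin invr_ge0.
rewrite lee_wpmul2l ?lee_fin ?invr_ge0//.
apply: le_measure; rewrite ?inE.
- apply: measurable_gt; apply: measurableT_comp => //.
  exact: (measurable_centered_sum mY).
- exact: (measurable_max_sum P mY).
move=> w /= cn; apply/lt_bigmax_nat => //; exists n; last exact: cn.
rewrite leqnn andbT lt0n; apply/negP => /eqP n0; move: cn.
by rewrite n0 big_geq// normr0 ltNge c0.
Qed.

End Equivalence.

Theorem theorem7 (d : measure_display) (T : measurableType d) (R : realType)
    (P : probability T R) (X : nat -> {RV P >-> R}) (hX : iid X) :
  let m : R -> R := trunc_mean P (X 0%N) in
  let s : T -> nat -> R := centered X in
  [<->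
    (* (i) *)
    ('E_P[(fun w => expR (lambertW `|X 0%N w|))%R] < +oo)%E;
    ('E_P[(fun w => `|X 0%N w| / Num.max (ln `|X 0%N w|) 1)%R] < +oo)%E;
    ('E_P[(fun w => `|X 0%N w| / (1 + ln_plus `|X 0%N w|))%R] < +oo)%E;
    (* (ii) *)
    \forall w \ae P, X n w / (n%:R * ln n%:R) @[n --> \oo] --> (0 : R);
    (* (iii) *)
    \forall w \ae P, summable_ell (s w) 0;
    (* (iv) *)
    \forall w \ae P, summable_L (s w) 0;
    (* (v) *)
    \forall w \ae P, summable_Rlog (s w) 0;
    exists2 lambda : R, 1 < lambda &
      \forall w \ae P, summable_calL lambda (s w) 0;
    forall lambda : R, 1 < lambda ->
      \forall w \ae P, summable_calL lambda (s w) 0;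
    exists2 lambda : R, 1 < lambda &
      \forall w \ae P, summable_calLx lambda (s w) 0;
    forall lambda : R, 1 < lambda ->
      \forall w \ae P, summable_calLx lambda (s w) 0;
    \forall w \ae P, summable_ellx (s w) 0;
    (* (vi) *)
    \forall w \ae P,
      (phi n%:R)^-1 * (\sum_(1 <= i < n.+1) (X i w - m i%:R))
        @[n --> \oo] --> (0 : R);
    \forall w \ae P,
      (phi x)^-1 *
        (\sum_(i \in [set i : nat | (1 : R) <= i%:R <= x]) (X i w - m i%:R))
        @[x --> +oo%R] --> (0 : R);
    (* (vii) *)
    forall beta : R, 1 < beta -> \forall w \ae P,
      (phi n%:R)^-1 *
        (\sum_(1 <= i < n.+1 | phi_inv (beta^-1 * phi n%:R) < i%:R)
           (X i w - m i%:R))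
        @[n --> \oo] --> (0 : R);
    forall beta : R, 1 < beta -> \forall w \ae P,
      (phi x)^-1 *
        (\sum_(i \in [set i : nat | phi_inv (beta^-1 * phi x) < i%:R <= x])
           (X i w - m i%:R))
        @[x --> +oo%R] --> (0 : R);
    (* (viii) *)
    forall epsilon gamma : R, 0 < epsilon -> 1 < gamma ->
      (\sum_(1 <= n <oo) (n%:R^-1)%:E *
        P [set w | (phi (n%:R / (gamma - 1)) * epsilon <
             `|\sum_(1 <= i < n.+1)
                 (X i w - m (i%:R + n%:R / (gamma - 1)))|)%R] < +oo)%E;
    (* (ix) *)
    forall epsilon gamma : R, 0 < epsilon -> 1 < gamma ->
      (\sum_(1 <= n <oo) (n%:R^-1)%:E *
        P [set w | (phi (n%:R / (gamma - 1)) * epsilon <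
             \big[Num.max/0]_(1 <= k < n.+1)
               `|\sum_(1 <= i < k.+1)
                   (X i w - m (i%:R + n%:R / (gamma - 1)))|)%R] < +oo)%E
  ].
Proof.
move=> m s.
pose moment := (\int[P]_w (expW `|X 0%N w|)%:E < +oo)%E.
have mY i : measurable_fun [set: T] (X i : T -> R) by exact: measurable_funP.
have idY i (B : set R) : measurable B -> P (X i @^-1` B) = P (X 0%N @^-1` B).
  by move=> mB; exact: hX.2.
have indepY := hX.1.
have [[i1 i2] [[i3 i4] [i5 i6]]] := moment_iff X.
have smallP (Q : (nat -> R) -> Prop) :
    (forall u : nat -> R, log_small (fun n => \sum_(0 <= i < n.+1) u i / i.+1%:R) -> Q u) ->
    moment -> \forall w \ae P, Q (s w).
  by move=> hQ /(moment_log_small hX); apply: filterS => w /hQ.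
have ell_m := @ell_moment _ _ _ P _ mY idY indepY (fun i => m i%:R).
have L_m := @abel_moment _ _ _ P _ mY idY indepY (fun i => m i%:R).
have Rlog_m := @Rlog_moment _ _ _ P _ mY idY indepY (fun i => m i%:R).
have calL_m := @calL_moment _ _ _ P _ mY idY indepY (fun i => m i%:R).
(* The value 2 instantiates every universally quantified lambda, beta and gamma, and is the witness
   for the existential lambda. *)
have two1 : 1 < 2 :> R by rewrite ltr1n.
have moment_calLx : moment -> forall lambda : R, 1 < lambda ->
    \forall w \ae P, summable_calLx lambda (s w) 0.
  move=> hm lambda l1; apply: (smallP (summable_calLx lambda ^~ 0)) hm => u hu; exact: log_small_calLx.
have small_phi (n : nat) (gamma eps : R) : 0 < eps -> 1 < gamma ->
    0 <= phi (n%:R / (gamma - 1)) * eps.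
  move=> e0 g1; rewrite mulr_ge0 ?(ltW e0)// phi_ge0// divr_ge0// subr_ge0; exact: ltW.
(* At gamma 2 and epsilon 1 the threshold is exactly [phi n], and the centering [m (i + n)] is one
   of the arbitrary arrays that the converse admits. *)
have sums_m : (\sum_(1 <= n <oo) (n%:R^-1)%:E *
    P [set w | (phi (n%:R / (2 - 1)) * 1 < `|\sum_(1 <= i < n.+1)
      (X i w - m (i%:R + n%:R / (2 - 1)))|)%R] < +oo)%E -> moment.
  have d1 (n : nat) : n%:R / (2 - 1) = n%:R :> R.
    by rewrite (_ : 2 - 1 = 1 :> R) ?divr1//; lra.
  under eq_eseriesr do rewrite d1 mulr1.
  exact: (complete_convergence_moment mY idY indepY (b := fun n i => m (i%:R + n%:R))).
(* Every arrow of the cycle passes through [moment], so neighbouring statements need no direct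
   comparison; those with a real parameter are first restricted to integers. *)
tfae.
- by move=> /i1 /i4.
- by move=> /i3 /i6.
- by move=> /i5 hm; exact: moment_ratio_ae mY idY hm.
- move=> /(ratio_moment mY idY indepY); apply: (smallP (@summable_ell R ^~ 0)) => u /log_small_ellx.
  exact: summable_ellx_ell.
- by move=> /ell_m; apply: (smallP (@summable_L R ^~ 0)) => u; exact: log_small_L.
- by move=> /L_m; apply: (smallP (@summable_Rlog R ^~ 0)) => u; exact: log_small_Rlog.
- move=> /Rlog_m hm; exists 2 => //; apply: (smallP (summable_calL 2 ^~ 0)) hm => u hu.
  by apply: summable_calLx_calL; exact: log_small_calLx.
- move=> [l l1 /(calL_m _ l1)] hm lambda l2; apply: (smallP (summable_calL lambda ^~ 0)) hm => u hu.
  by apply: summable_calLx_calL; exact: log_small_calLx.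
- by move=> /(_ _ two1) /(calL_m _ two1) hm; exists 2 => //; exact: moment_calLx.
- move=> [l l1 hl]; apply: moment_calLx; apply: (calL_m _ l1).
  by apply: filterS hl => w; exact: summable_calLx_calL.
- move=> /(_ _ two1) hl; have : moment.
    apply: (calL_m _ two1).
    by apply: filterS hl => w; exact: summable_calLx_calL.
  by apply: (smallP (@summable_ellx R ^~ 0)) => u; exact: log_small_ellx.
- move=> hl; have hm : moment.
    by apply: ell_m; apply: filterS hl => w; exact: summable_ellx_ell.
  by apply: filterS (moment_phi_mean hX hm) => w; exact: phi_mean_nat.
- by move=> /(phi_mean_moment mY idY indepY); exact: moment_phi_mean.
- move=> hl beta b1.
  have hm : moment.
    apply: (phi_mean_moment mY idY indepY (mu := fun i => m i%:R)).
    by apply: filterS hl => w; exact: phi_mean_nat.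
  by apply: filterS (moment_phi_block hX hm b1) => w hw; exact: phi_block_nat hw b1.
- move=> /(_ _ two1) /(phi_block_moment mY idY indepY two1) hm beta.
  exact: moment_phi_block.
- move=> /(_ _ two1) hl eps gam e0 g1.
  apply: tail_sum_max; first by move=> n; exact: small_phi.
  rewrite /m trunc_meanE; apply: complete_convergence => //.
  apply: (phi_block_moment mY idY indepY two1 (mu := fun i => m i%:R)).
  by apply: filterS hl => w hw; exact: phi_block_nat hw two1.
- move=> /(_ 1 2 ltr01 two1) /sums_m hm eps gam e0 g1.
  by rewrite /m trunc_meanE; apply: complete_convergence.
- move=> /(_ 1 2 ltr01 two1) h; apply/i2/sums_m.
  apply: (tail_sum_max (c := fun n => phi (n%:R / (2 - 1)) * 1)
    (m := fun n i => m (i%:R + n%:R / (2 - 1)))) h => n.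
  exact: small_phi.
Qed.
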